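(* Let $d=3$, $N=2$, $L=17$. (i) Let $q=(q_1,q_2):\mathbb R\times(0,T)\to M_2\cong\mathbb C^2$ be a solution of $\kappa_0\nabla^g_t\partial_tq+\kappa_1\partial_tq-\nabla^g_{y_3}\partial_3q=0$ with values in a compact set $K\subset M_2$, with $\partial_3q,\kappa_0\partial_0q\in C(0,T;H^L(\mathbb R))$ and $\|\partial_3q\|_{L^\infty_TH^L(\mathbb R)}+\kappa_0\|\partial_0q\|_{L^\infty_TH^L(\mathbb R)}<\infty$. Let $U_\varepsilon=(\Phi_\varepsilon,A_\varepsilon):\mathbb R^3\times(0,T_0/\varepsilon)\to\mathbb C\times\mathbb R^{3+1}$ be the associated solutions (described in the context) of (dAHM) with $\lambda_\varepsilon=1$. Assume that there exists $(\bar x_3,\bar t)\in\mathbb R\times(0,T_0)$ such that $D:=q_1^2-4q_2$ satisfies $$D(\bar x_3,\bar t)=0,\qquad \{\partial_tD(\bar x_3,\bar t),\ \partial_3D(\bar x_3,\bar t)\}\ \text{are linearly independent over }\mathbb R .$$ Then for all $\delta>0$ there exists $\varepsilon_0>0$ such that, if $0<\varepsilon<\varepsilon_0$, the vortex filaments of $U_\varepsilon$ reconnect (in the sense defined in the context) in $$\Big\{(x_3,t):\ \big|x_3-\tfrac{\bar x_3}\varepsilon\big|<\tfrac\delta\varepsilon,\ \big|t-\tfrac{\bar t}\varepsilon\big|<\tfrac\delta\varepsilon\Big\}.$$ (ii) The same result holds in the periodic near-critical setting: $\iota\in\mathbb R$, $R>0$, $q:\mathbb T^1_R\times(0,T)\to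 M_2$ is a solution of $\kappa_0\nabla^g_t\partial_tq+\kappa_1\partial_tq-\nabla^g_{y_3}\partial_3q+\iota\nabla_gV_0(q)=0$, $V_0(q)=\frac18\int_{\mathbb R^2}(|\varphi(q)|^2-1)^2$, with values in a compact $K\subset M_2$ and $\|\partial_3q\|_{L^\infty_TH^L(\mathbb T^1_R)}+\kappa_0\|\partial_0q\|_{L^\infty_TH^L(\mathbb T^1_R)}<\infty$; $U_\varepsilon$ are the associated solutions on $\mathbb R^2\times\mathbb T^1_{R/\varepsilon}\times(0,T_0/\varepsilon)$ of (dAHM) with $\lambda_\varepsilon=1+\iota\varepsilon^2$ (described in the context), and $(\bar x_3,\bar t)\in\mathbb T^1_R\times(0,T_0)$ satisfies the displayed condition on $D$.
   Context: Conventions. Indices $j,k$ run over $1,2,3$; $a$ over $1,2$; $\mu,\nu$ over $1,\dots,2N=4$; repeated indices are summed. $\mathbb T^1_R=\mathbb R/R\mathbb Z$. $x=(x_1,x_2,x_3)$, $z=x_1+ix_2$, $\partial_0=\partial_t$. $(v,w)=\frac12(v\bar w+w\bar v)$ for $v,w\in\mathbb C$. Constants $0\le\kappa_0,\kappa_1\le1$ are fixed, with $\kappa_1>0$ if $\kappa_0=0$. $\|v\|_{L^\infty_\tau X}=\operatorname{ess\,sup}_{0<t<\tau}\|v(\cdot,t)\|_X$. The system (dAHM). For $U=(\Phi,A)$, $\Phi$ complex-valued, $A=(A_1,A_2,A_3,A_0)$ real-valued, $D_\alpha=\partial_\alpha-iA_\alpha$, $F_{\alpha\beta}=\partial_\alpha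 A_\beta-\partial_\beta A_\alpha$: $$(\kappa_0D_0+\varepsilon\kappa_1)D_0\Phi-D_jD_j\Phi+\tfrac{\lambda_\varepsilon}2(|\Phi|^2-1)\Phi=0,$$ $$(\kappa_0\partial_0+\varepsilon\kappa_1)F_{0j}-\partial_kF_{kj}-(i\Phi,D_j\Phi)=0\ (j=1,2,3),\qquad -\partial_kF_{k0}-(i\Phi,D_0\Phi)=0.$$ Moduli space. For $u=(\phi,A_1,A_2)\in H^1_{loc}(\mathbb R^2;\mathbb C\times\mathbb R^2)$ let $e(u)=\frac12\sum_a|D_a\phi|^2+\frac12F_{12}^2+\frac18(|\phi|^2-1)^2$, $j_a(u)=(i\phi,D_a\phi)$, $\omega(u)=\frac12[\partial_1j_2-\partial_2j_1+F_{12}]$, $\mathcal E_2=\{u:\int e(u)<\infty,\int\omega(u)=2\pi\}$. For $q=(q_1,q_2)\in\mathbb C^2$ let $p(z;q)=z^2+q_1z+q_2$; $\mathfrak u(\cdot;q)=(\varphi,\mathcal A_a)(\cdot;q)$ is the unique element of $\mathcal E_2$ solving $(D_1+iD_2)\phi=0$, $F_{12}+\frac12(|\phi|^2-1)=0$ with $\varphi(z)=f(z)p(z;q)/\sqrt{1+|p(z;q)|^2}$, $f>0$ everywhere. $M_2:=\mathbb C^2\cong\mathbb R^4$ with real coordinates $q_\mu$, $\partial_\mu=\partial/\partial q_\mu$ (Sobolev norms of maps into $M_2$ use the Euclidean structure). $\chi_\mu(\cdot;q)$ is the unique solution of $-\Delta\chi_\mu+|\varphi|^2\chi_\mu=(i\varphi,\partial_\mu\varphi)$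 on $\mathbb R^2$ decaying exponentially to $(i\varphi,\partial_\mu\varphi)$ at infinity; $\tilde n_\mu=(\partial_\mu\varphi-i\varphi\chi_\mu,\partial_\mu\mathcal A_a-\partial_a\chi_\mu)$; $g_{\mu\nu}=(\tilde n_\mu,\tilde n_\nu)_{L^2(\mathbb R^2)}$; $\nabla^g$, $\nabla_g$ are the Levi-Civita connection and gradient of $(M_2,g)$. Associated solutions. Put $q_\varepsilon(x_3,t)=q(\varepsilon x_3,\varepsilon t)$, $\varphi(q_\varepsilon)(x,t)=\varphi(x_1,x_2;q_\varepsilon(x_3,t))$, and similarly $\mathcal A_a(q_\varepsilon)$. In case (i), the paper constructs $T_0\in(0,T)$, $\varepsilon_1>0$, $C$ and for $0<\varepsilon<\varepsilon_1$ a continuous solution $U_\varepsilon$ of (dAHM), $\lambda_\varepsilon=1$, on $\mathbb R^3\times(0,T_0/\varepsilon)$ with $\|\Phi_\varepsilon-\varphi(q_\varepsilon)\|_{L^\infty_{T_0/\varepsilon}W^{2,\infty}}+\kappa_0\|\partial_t(\Phi_\varepsilon-\varphi(q_\varepsilon))\|_{L^\infty_{T_0/\varepsilon}W^{1,\infty}}\le C\varepsilon^2$, $\|A_{\varepsilon a}-\mathcal A_a(q_\varepsilon)\|_{L^\infty_{T_0/\varepsilon}W^{2,\infty}}+\kappa_0\|\partial_t(A_{\varepsilon a}-\mathcal A_a(q_\varepsilon))\|_{L^\infty_{T_0/\varepsilon}W^{1,\infty}}\le C\varepsilon^2$ for $a=1,2$, and $\|A_{\varepsilon\alpha}\|_{L^\infty_{T_0/\varepsilon}W^{2,\infty}}+\kappa_0\|\partial_tA_{\varepsilon\alpha}\|_{L^\infty_{T_0/\varepsilon}W^{1,\infty}}\le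 C\varepsilon$ for $\alpha=0,3$. In case (ii), it constructs $T_0\in(0,T)$, $\varepsilon_1>0$, $C$ and continuous solutions on $\mathbb R^2\times\mathbb T^1_{R/\varepsilon}\times(0,T_0/\varepsilon)$, $\lambda_\varepsilon=1+\iota\varepsilon^2$, with $\|\Phi_\varepsilon-\varphi(q_\varepsilon)\|_{L^\infty_{T_0/\varepsilon}W^{2,\infty}}\le C\varepsilon^2$, $\|A_{\varepsilon a}-\mathcal A_a(q_\varepsilon)\|_{L^\infty_{T_0/\varepsilon}W^{2,\infty}}\le C\varepsilon^2$, $\|A_{\varepsilon\alpha}\|_{L^\infty_{T_0/\varepsilon}W^{2,\infty}}\le C\varepsilon$. $U_\varepsilon$ denotes such a family. Reconnection. Write $\Phi(z,x_3,t)$ for $\Phi$ at $z=x_1+ix_2$, height $x_3$, time $t$. The vortex filaments of $U=(\Phi,A)$ reconnect in a set $W$ of points $(x_3,t)$ if there is a continuous closed path $\Gamma:[\tau_0,\tau_1]\to W$, $\Gamma(\tau_0)=\Gamma(\tau_1)$, such that $\Phi(\cdot,\Gamma(\tau_0))$ has zeros and, for each zero $z_1$ of $\Phi(\cdot,\Gamma(\tau_0))$, there is a unique continuous $\zeta:[\tau_0,\tau_1]\to\mathbb C$ with $\zeta(\tau_0)=z_1$ and $\Phi(\zeta(\tau),\Gamma(\tau))=0$ for all $\tau$, and this $\zeta$ satisfies $\zeta(\tau_1)\ne\zeta(\tau_0)$. *)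

(* Defs.v *)
From HB Require Import structures.
From mathcomp Require Import all_boot all_order all_algebra.
From mathcomp Require Import all_classical all_reals all_analysis.
From mathcomp Require Import ess_sup_inf.
From mathcomp Require Import complex.
Set Implicit Arguments. Unset Strict Implicit. Unset Printing Implicit Defensive.
Import Order.TTheory GRing.Theory Num.Theory.
Import numFieldNormedType.Exports.
Local Open Scope classical_set_scope.
Local Open Scope ring_scope.
Local Open Scope complex_scope.

(* Points: (x1, x2) in the plane, ((x1, x2), x3) in space, (((x1, x2), x3), t)
   in space-time, and (y3, t) for the domain of q. Complex numbers are R[i];
   derivatives and continuity of complex functions are taken on the real and
   imaginary parts. *)
Notation E2 R := (R * R)%type.
Notation E3 R := (R * R * R)%type.
Notation E4 R := (R * R * R * R)%type.

Section Calculus.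
Variable R : realType.

(* For finite-dimensional V this is k-times continuous differentiability. *)
Fixpoint Ck (V : normedModType R) (k : nat) (f : V -> R) : Prop :=
  continuous f /\
  match k with
  | 0 => True
  | k'.+1 => forall v : V,
      (forall x, derivable f x v) /\ Ck k' (fun x => 'D_v f x)
  end.

Definition Csmooth (V : normedModType R) (f : V -> R) := forall k, Ck k f.

Definition derC (V : normedModType R) (v : V) (f : V -> R[i]) (x : V) : R[i] :=
  ('D_v (fun y => complex.Re (f y)) x) +i* ('D_v (fun y => complex.Im (f y)) x).

Definition ip (v w : R[i]) : R := complex.Re (2^-1 * (v * w^*%C + w * v^*%C)).

Definition normsq (z : R[i]) : R := ip z z.

Definition leb2 : {measure set (measurableTypeR R * measurableTypeR R) -> \bar R}
  := (@lebesgue_measure R \x @lebesgue_measure R)%E.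
Definition leb3 : {measure set
    (measurableTypeR R * measurableTypeR R * measurableTypeR R) -> \bar R}
  := (leb2 \x @lebesgue_measure R)%E.
Definition leb4 : {measure set
    (measurableTypeR R * measurableTypeR R * measurableTypeR R
      * measurableTypeR R) -> \bar R}
  := (leb3 \x @lebesgue_measure R)%E.

(* Test functions are C^1 with compact support in Om: weak derivatives are only
   ever taken one order at a time, for which this is equivalent to testing
   against smooth functions, by mollification. *)
Definition test_fun (V : normedModType R) (Om : set V) : set (V -> R) :=
  [set psi | Ck 1 psi /\
    exists K : set V, [/\ compact K, K `<=` Om & forall x, ~ K x -> psi x = 0]].

(* T and V carry the measurable and the normed structure of the same space; j is
   always the identity. *)
Definition loc_integrable (V : normedModType R) d (T : measurableType d)
    (j : T -> V) (mu : {measure set T -> \bar R}) (Om : set V) (f : V -> R) :=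
  forall K : set V, compact K -> K `<=` Om ->
    mu.-integrable (j @^-1` K) (fun x => (f (j x))%:E).

Definition weak_deriv (V : normedModType R) d (T : measurableType d)
    (j : T -> V) (mu : {measure set T -> \bar R}) (Om : set V) (v : V)
    (f g : V -> R) : Prop :=
  [/\ loc_integrable j mu Om f, loc_integrable j mu Om g &
   forall psi, test_fun Om psi ->
     \int[mu]_(x in j @^-1` Om) (f (j x) * 'D_v psi (j x)) =
     - \int[mu]_(x in j @^-1` Om) (g (j x) * psi (j x))].

Definition weak_derivC (V : normedModType R) d (T : measurableType d)
    (j : T -> V) (mu : {measure set T -> \bar R}) (Om : set V) (v : V)
    (f g : V -> R[i]) : Prop :=
  weak_deriv j mu Om v (fun x => complex.Re (f x)) (fun x => complex.Re (g x)) /\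
  weak_deriv j mu Om v (fun x => complex.Im (f x)) (fun x => complex.Im (g x)).

Definition id1 : measurableTypeR R -> R := idfun.
Definition id2 : measurableTypeR R * measurableTypeR R -> E2 R := idfun.
Definition id3 : measurableTypeR R * measurableTypeR R * measurableTypeR R ->
  E3 R := idfun.
Definition id4 : measurableTypeR R * measurableTypeR R * measurableTypeR R
  * measurableTypeR R -> E4 R := idfun.

(* Index a : 'I_2 stands for the direction x_(a+1), j : 'I_3 for x_(j+1); in
   space-time the index 0 : 'I_4 is time and 1, 2, 3 are the space directions. *)
Definition e2 (a : 'I_2) : E2 R := ((a == 0)%:R, (a == 1)%:R).
Definition e3 (j : 'I_3) : E3 R := ((j == 0)%:R, (j == 1)%:R, (j == 2)%:R).
Definition e4 (al : 'I_4) : E4 R :=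
  ((al == 1)%:R, (al == 2)%:R, (al == 3)%:R, (al == 0)%:R).

Definition d3 : E2 R := (1, 0).
Definition dt : E2 R := (0, 1).

(* The L^oo W^(k,oo) norms below use the maximum over all derivatives of order
   at most k. *)
Fixpoint W_le (k : nat) (v : E3 R -> R[i]) (B : \bar R) : Prop :=
  [/\ measurable_fun setT (fun x => complex.Re (v (id3 x))),
      measurable_fun setT (fun x => complex.Im (v (id3 x))),
      (ess_sup leb3 (fun x => (Normc.normc (v (id3 x)))%:E) <= B)%E &
      match k with
      | 0 => True
      | k'.+1 => forall j : 'I_3, exists g : E3 R -> R[i],
          weak_derivC id3 leb3 setT (e3 j) v g /\ W_le k' g B
      end].

(* +oo when v does not belong to W^(k,oo)(R^3). *)
Definition Wnorm (k : nat) (v : E3 R -> R[i]) : \bar R :=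
  ereal_inf [set B | W_le k v B].

(* ess sup over 0 < t < tau; \_ extends by zero, and h is nonnegative. *)
Definition ess_sup_time (tau : R) (h : R -> \bar R) : \bar R :=
  ess_sup (@lebesgue_measure R) (h \_ `]0, tau[).

Definition LinfW (tau : R) (k : nat) (v : E4 R -> R[i]) : \bar R :=
  ess_sup_time tau (fun t => Wnorm k (fun x => v (x, t))).

Definition slab (tau : R) : set (E4 R) := [set p | 0 < p.2 < tau].

(* Norm of the distributional time derivative of v; +oo if there is none. *)
Definition LinfW_dt (tau : R) (k : nat) (v : E4 R -> R[i]) : \bar R :=
  ereal_inf [set LinfW tau k w |
    w in [set w | weak_derivC id4 leb4 (slab tau) (e4 0) v w]].

(* The parameter l >= 0 encodes the one-dimensional domain: the line if l = 0,
   the circle R/lZ if l > 0. Functions on the circle are l-periodic functions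
   on the line. *)
Definition period_cell (l : R) : set R := if l == 0 then setT else [set y | 0 <= y <= l].

(* Sobolev norm H^L of maps into R^4; w k is the k-th weak derivative. *)
Definition Hsum (l : R) (L : nat) (w : nat -> R -> 'rV[R]_4) : \bar R :=
  (\sum_(k < L.+1) \sum_(mu < 4)
     \int[@lebesgue_measure R]_(y in period_cell l) (w k y 0%R mu ^+ 2)%:E)%E.

Definition Hnorm (l : R) (L : nat) (v : R -> 'rV[R]_4) : \bar R :=
  ereal_inf [set poweR (Hsum l L w) 2^-1
    | w in [set w : nat -> R -> 'rV[R]_4 | w 0%N = v /\
        forall k, (k < L)%N -> forall mu,
          weak_deriv id1 (@lebesgue_measure R) setT 1
            (fun y => w k y 0 mu) (fun y => w k.+1 y 0 mu)]].

End Calculus.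

Section Vortices.
Variable R : realType.
Local Notation M2 := 'rV[R]_4.
Local Notation leb2 := (leb2 R).

(* dphi b and dA b c represent d_b phi and d_b A_c. *)
Definition h1loc (phi : E2 R -> R[i]) (A : 'I_2 -> E2 R -> R)
    (dphi : 'I_2 -> E2 R -> R[i]) (dA : 'I_2 -> 'I_2 -> E2 R -> R) : Prop :=
  let L2loc (f : E2 R -> R) := loc_integrable (@id2 R) leb2 setT f /\
    loc_integrable (@id2 R) leb2 setT (fun x => f x ^+ 2) in
  let L2locC (f : E2 R -> R[i]) :=
    L2loc (fun x => complex.Re (f x)) /\ L2loc (fun x => complex.Im (f x)) in
  [/\ forall b, weak_derivC (@id2 R) leb2 setT (e2 R b) phi (dphi b),
      forall b c, weak_deriv (@id2 R) leb2 setT (e2 R b) (A c) (dA b c),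
      L2locC phi /\ (forall b, L2locC (dphi b)) &
      (forall c, L2loc (A c)) /\ (forall b c, L2loc (dA b c))].

Definition cov (phi : E2 R -> R[i]) (A : 'I_2 -> E2 R -> R)
    (dphi : 'I_2 -> E2 R -> R[i]) (b : 'I_2) (x : E2 R) : R[i] :=
  dphi b x - 'i%C * (A b x)%:C * phi x.

Definition F12 (dA : 'I_2 -> 'I_2 -> E2 R -> R) (x : E2 R) : R :=
  dA 0 1 x - dA 1 0 x.

Definition energy_density phi A dphi dA (x : E2 R) : R :=
  2^-1 * (\sum_(b < 2) normsq (cov phi A dphi b x)) + 2^-1 * F12 dA x ^+ 2
  + 8^-1 * (normsq (phi x) - 1) ^+ 2.

Definition current phi A dphi (b : 'I_2) (x : E2 R) : R :=
  ip ('i%C * phi x) (cov phi A dphi b x).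

(* omega(u) is an integrable function which equals
   (d_1 j_2 - d_2 j_1 + F_12) / 2 in the sense of distributions. *)
Definition in_calE2 (phi : E2 R -> R[i]) (A : 'I_2 -> E2 R -> R) : Prop :=
  exists dphi dA, [/\ h1loc phi A dphi dA,
    (\int[leb2]_x (energy_density phi A dphi dA (id2 x))%:E < +oo)%E &
    exists om : E2 R -> R, [/\ leb2.-integrable setT (fun x => (om (id2 x))%:E),
      (forall psi, test_fun (setT : set (E2 R)) psi ->
        \int[leb2]_x (om (id2 x) * psi (id2 x)) =
        2^-1 * \int[leb2]_x (
          - current phi A dphi 1 (id2 x) * 'D_(e2 R 0) psi (id2 x)
          + current phi A dphi 0 (id2 x) * 'D_(e2 R 1) psi (id2 x)
          + F12 dA (id2 x) * psi (id2 x))) &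
      \int[leb2]_x om (id2 x) = 2 * pi]].

Definition bogomolny (phi : E2 R -> R[i]) (A : 'I_2 -> E2 R -> R) : Prop :=
  exists dphi dA, [/\ h1loc phi A dphi dA,
    {ae leb2, forall x,
       cov phi A dphi 0 (id2 x) + 'i%C * cov phi A dphi 1 (id2 x) = 0} &
    {ae leb2, forall x, F12 dA (id2 x) + 2^-1 * (normsq (phi (id2 x)) - 1) = 0}].

(* C^2 = R^4 with real coordinates (Re q_1, Im q_1, Re q_2, Im q_2). *)
Definition cq1 (q : M2) : R[i] := q 0 0 +i* q 0 1.
Definition cq2 (q : M2) : R[i] := q 0 2 +i* q 0 3.

Definition vpoly (q : M2) (z : R[i]) : R[i] := z ^+ 2 + cq1 q * z + cq2 q.

(* For each q, (phi q, A q) is the (unique) element of calE_2 with the stated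
   properties. Joint smoothness in (x, q) is the regularity of this family that
   gives a meaning to the derivatives d_mu phi, d_mu A, and to the metric. *)
Definition vortex_family (phi : M2 -> E2 R -> R[i]) (A : M2 -> 'I_2 -> E2 R -> R)
    : Prop :=
  (forall q, [/\ in_calE2 (phi q) (A q), bogomolny (phi q) (A q) &
    exists f : E2 R -> R, forall x, 0 < f x /\
      let p := vpoly q (x.1 +i* x.2) in
      phi q x = (f x)%:C * p / (Num.sqrt (1 + normsq p))%:C]) /\
  [/\ Csmooth (fun y : E2 R * M2 => complex.Re (phi y.2 y.1)),
      Csmooth (fun y : E2 R * M2 => complex.Im (phi y.2 y.1)) &
      forall b, Csmooth (fun y : E2 R * M2 => A y.2 b y.1)].

Definition eM (mu : 'I_4) : M2 := delta_mx 0 mu.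

Definition dmu_phi (phi : M2 -> E2 R -> R[i]) (mu : 'I_4) (q : M2) (x : E2 R) :=
  derC (eM mu) (fun r => phi r x) q.

Definition gauge_fixing (phi : M2 -> E2 R -> R[i])
    (chi : 'I_4 -> M2 -> E2 R -> R) : Prop :=
  forall mu q, [/\ Ck 2 (chi mu q),
    (forall x, - (\sum_(b < 2) 'D_(e2 R b) (fun y => 'D_(e2 R b) (chi mu q) y) x)
       + normsq (phi q x) * chi mu q x = ip ('i%C * phi q x) (dmu_phi phi mu q x)) &
    exists C c : R, 0 < c /\ forall x,
      `|chi mu q x - ip ('i%C * phi q x) (dmu_phi phi mu q x)|
        <= C * expR (- c * Num.sqrt (x.1 ^+ 2 + x.2 ^+ 2))].

Section Metric.
Variables (phi : M2 -> E2 R -> R[i]) (A : M2 -> 'I_2 -> E2 R -> R)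
  (chi : 'I_4 -> M2 -> E2 R -> R).

Definition ntilde_phi (mu : 'I_4) (q : M2) (x : E2 R) : R[i] :=
  dmu_phi phi mu q x - 'i%C * phi q x * (chi mu q x)%:C.

Definition ntilde_A (mu : 'I_4) (q : M2) (b : 'I_2) (x : E2 R) : R :=
  'D_(eM mu) (fun r => A r b x) q - 'D_(e2 R b) (chi mu q) x.

Definition metric (q : M2) : 'M[R]_4 := \matrix_(mu, nu)
  \int[leb2]_x (ip (ntilde_phi mu q (id2 x)) (ntilde_phi nu q (id2 x))
    + \sum_(b < 2) ntilde_A mu q b (id2 x) * ntilde_A nu q b (id2 x)).

Definition christoffel (la mu nu : 'I_4) (q : M2) : R :=
  2^-1 * \sum_(si < 4) invmx (metric q) la si *
    ('D_(eM mu) (fun r => metric r nu si) q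
     + 'D_(eM nu) (fun r => metric r mu si) q
     - 'D_(eM si) (fun r => metric r mu nu) q).

Definition V0 (q : M2) : R :=
  8^-1 * \int[leb2]_x (normsq (phi q (id2 x)) - 1) ^+ 2.

Definition grad_V0 (q : M2) (la : 'I_4) : R :=
  \sum_(mu < 4) invmx (metric q) la mu * 'D_(eM mu) V0 q.

(* nabla^g_v d_v q at y, v a coordinate direction of the (y3, t) plane. *)
Definition cov_acc (v : E2 R) (q : E2 R -> M2) (y : E2 R) (la : 'I_4) : R :=
  ('D_v (fun s => 'D_v q s) y) 0 la
  + \sum_(mu < 4) \sum_(nu < 4) christoffel la mu nu (q y)
      * ('D_v q y) 0 mu * ('D_v q y) 0 nu.

(* Classical solution on 0 < t < T, taking values in some compact set. *)
Definition wave_map_solution (k0 k1 iota T : R) (q : E2 R -> M2) : Prop :=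
  let Om := [set y : E2 R | 0 < y.2 < T] in
  [/\ (exists K : set M2, compact K /\ forall y, Om y -> K (q y)),
      (forall y, Om y -> [/\ {for y, continuous q},
         derivable q y (d3 R) /\ {for y, continuous (fun s => 'D_(d3 R) q s)},
         derivable q y (dt R) /\ {for y, continuous (fun s => 'D_(dt R) q s)},
         derivable (fun s => 'D_(d3 R) q s) y (d3 R) /\
           {for y, continuous (fun s => 'D_(d3 R) (fun r => 'D_(d3 R) q r) s)} &
         k0 != 0 -> derivable (fun s => 'D_(dt R) q s) y (dt R) /\
           {for y, continuous (fun s => 'D_(dt R) (fun r => 'D_(dt R) q r) s)}]) &
      (forall y, Om y -> forall la,
         k0 * cov_acc (dt R) q y la + k1 * ('D_(dt R) q y) 0 la
         - cov_acc (d3 R) q y la + iota * grad_V0 (q y) la = 0)].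

End Metric.

Definition slice (f : E2 R -> M2) (t : R) : R -> M2 := fun y => f (y, t).

(* f belongs to C(0,T; H^L). *)
Definition cont_in_H (l : R) (L : nat) (T : R) (f : E2 R -> M2) : Prop :=
  forall t, 0 < t < T -> (Hnorm l L (slice f t) < +oo)%E /\
    Hnorm l L (fun y => slice f s y - slice f t y) @[s --> t] --> 0%E.

Definition finite_H_norm (l : R) (L : nat) (T k0 : R) (q : E2 R -> M2) : Prop :=
  (ess_sup_time T (fun t => Hnorm l L (slice (fun y => 'D_(d3 R) q y) t))
   + k0%:E * ess_sup_time T
       (fun t => Hnorm l L (slice (fun y => 'D_(dt R) q y) t)) < +oo)%E.

Definition discr (q : E2 R -> M2) (y : E2 R) : R[i] :=
  cq1 (q y) ^+ 2 - 4 * cq2 (q y).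

Definition lin_indep2 (v w : R[i]) : Prop :=
  forall a b : R, a%:C * v + b%:C * w = 0 -> a = 0 /\ b = 0.

End Vortices.

Section AbelianHiggs.
Variable R : realType.
Local Notation M2 := 'rV[R]_4.
Local Notation leb4 := (leb4 R).

(* Distributional solution on R^3 x (0, tau), in divergence form: dPhi and F
   represent the distributions d_al Phi and d_al A_be - d_be A_al. The time
   component of the connection is A 0. *)
Definition dAHM_solution (k0 k1 eps lam tau : R)
    (Phi : E4 R -> R[i]) (A : 'I_4 -> E4 R -> R) : Prop :=
  let Om := slab tau in
  let integral (f : E4 R -> R) := \int[leb4]_(p in @id4 R @^-1` Om) f (id4 p) in
  exists (dPhi : 'I_4 -> E4 R -> R[i]) (F : 'I_4 -> 'I_4 -> E4 R -> R),
  let DPhi al p := dPhi al p - 'i%C * (A al p)%:C * Phi p in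
  [/\ forall al, weak_derivC (@id4 R) leb4 Om (e4 R al) Phi (dPhi al),
      forall al be, loc_integrable (@id4 R) leb4 Om (F al be) /\
        forall psi, test_fun Om psi ->
          integral (fun p => F al be p * psi p) =
          integral (fun p => A al p * 'D_(e4 R be) psi p
                             - A be p * 'D_(e4 R al) psi p),
      forall psi, test_fun Om psi ->
        let integrand p :=
          - k0%:C * DPhi 0 p * ('D_(e4 R 0) psi p)%:C
          + ((eps * k1)%:C * DPhi 0 p - k0%:C * 'i%C * (A 0 p)%:C * DPhi 0 p)
            * (psi p)%:C
          + \sum_(j < 4 | j != 0) (DPhi j p * ('D_(e4 R j) psi p)%:C
              + 'i%C * (A j p)%:C * DPhi j p * (psi p)%:C)
          + (lam / 2 * (normsq (Phi p) - 1))%:C * Phi p * (psi p)%:C in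
        integral (fun p => complex.Re (integrand p)) = 0 /\
        integral (fun p => complex.Im (integrand p)) = 0,
      forall j : 'I_4, j != 0 -> forall psi, test_fun Om psi ->
        integral (fun p => - k0 * F 0 j p * 'D_(e4 R 0) psi p
          + eps * k1 * F 0 j p * psi p
          + \sum_(k < 4 | k != 0) F k j p * 'D_(e4 R k) psi p
          - ip ('i%C * Phi p) (DPhi j p) * psi p) = 0 &
      forall psi, test_fun Om psi ->
        integral (fun p => \sum_(k < 4 | k != 0) F k 0 p * 'D_(e4 R k) psi p
          - ip ('i%C * Phi p) (DPhi 0 p) * psi p) = 0].

(* In the periodic case (l > 0) the fields are l/eps-periodic in x3. *)
Definition continuous_dAHM_solution (l k0 k1 eps lam tau : R)
    (Phi : E4 R -> R[i]) (A : 'I_4 -> E4 R -> R) : Prop :=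
  [/\ forall p, slab tau p ->
        {for p, continuous (fun s => complex.Re (Phi s))} /\
        {for p, continuous (fun s => complex.Im (Phi s))},
      forall al p, slab tau p -> {for p, continuous (A al)},
      forall x x3 t, Phi (x, x3 + l / eps, t) = Phi (x, x3, t) /\
        forall al, A al (x, x3 + l / eps, t) = A al (x, x3, t) &
      dAHM_solution k0 k1 eps lam tau Phi A].

Definition pull (X : Type) (eps : R) (q : E2 R -> M2) (f : M2 -> E2 R -> X)
    (p : E4 R) : X :=
  f (q (eps * p.1.2, eps * p.2)) p.1.1.

Section Associated.
Variables (phi : M2 -> E2 R -> R[i]) (calA : M2 -> 'I_2 -> E2 R -> R)
  (k0 k1 T0 eps1 C : R) (q : E2 R -> M2)
  (Phi : R -> E4 R -> R[i]) (A : R -> 'I_4 -> E4 R -> R).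

Definition Phi_error (eps : R) (p : E4 R) : R[i] :=
  Phi eps p - pull eps q phi p.

(* The plane index b : 'I_2 corresponds to the space-time index b + 1. *)
Definition A_error (eps : R) (b : 'I_2) (p : E4 R) : R[i] :=
  (A eps (inord b.+1) p - pull eps q (fun r => calA r b) p)%:C.

Definition associated_line : Prop :=
  forall eps, 0 < eps < eps1 -> let tau := T0 / eps in
  [/\ continuous_dAHM_solution 0 k0 k1 eps 1 tau (Phi eps) (A eps),
      (LinfW tau 2 (Phi_error eps) + k0%:E * LinfW_dt tau 1 (Phi_error eps)
        <= (C * eps ^+ 2)%:E)%E,
      (forall b, (LinfW tau 2 (A_error eps b)
        + k0%:E * LinfW_dt tau 1 (A_error eps b) <= (C * eps ^+ 2)%:E)%E) &
      (forall al : 'I_4, al = 0 \/ al = 3 ->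
        (LinfW tau 2 (fun p => (A eps al p)%:C)
         + k0%:E * LinfW_dt tau 1 (fun p => (A eps al p)%:C)
         <= (C * eps)%:E)%E)].

Definition associated_circle (l iota : R) : Prop :=
  forall eps, 0 < eps < eps1 -> let tau := T0 / eps in
  [/\ continuous_dAHM_solution l k0 k1 eps (1 + iota * eps ^+ 2) tau
        (Phi eps) (A eps),
      (LinfW tau 2 (Phi_error eps) <= (C * eps ^+ 2)%:E)%E,
      (forall b, (LinfW tau 2 (A_error eps b) <= (C * eps ^+ 2)%:E)%E) &
      (forall al : 'I_4, al = 0 \/ al = 3 ->
        (LinfW tau 2 (fun p => (A eps al p)%:C) <= (C * eps)%:E)%E)].

End Associated.

(* The distance between x and y in R/lZ (in R if l = 0) is less than r. *)
Definition near_mod (l r x y : R) : Prop :=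
  exists k : int, `|x - y - k%:~R * l| < r.

(* A path in (R/lZ) x R is given by representatives in R x R, continuous for the
   quotient distance. Phi is l-periodic in x3. *)
Definition closed_path (l t0 t1 : R) (Gam : R -> E2 R) : Prop :=
  (forall s, t0 <= s <= t1 -> forall r, 0 < r -> exists2 h, 0 < h &
     forall s', t0 <= s' <= t1 -> `|s' - s| < h ->
       near_mod l r (Gam s').1 (Gam s).1 /\ `|(Gam s').2 - (Gam s).2| < r) /\
  ((exists k : int, (Gam t1).1 = (Gam t0).1 + k%:~R * l) /\
   (Gam t1).2 = (Gam t0).2).

Definition at_point (Phi : E4 R -> R[i]) (z : R[i]) (y : E2 R) : R[i] :=
  Phi (complex.Re z, complex.Im z, y.1, y.2).

Definition zero_lift (Phi : E4 R -> R[i]) (t0 t1 : R) (Gam : R -> E2 R)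
    (z1 : R[i]) (zeta : R -> R[i]) : Prop :=
  [/\ {within `[t0, t1], continuous (fun s => complex.Re (zeta s))},
      {within `[t0, t1], continuous (fun s => complex.Im (zeta s))},
      zeta t0 = z1 &
      forall s, t0 <= s <= t1 -> at_point Phi (zeta s) (Gam s) = 0].

Definition reconnects (l : R) (Phi : E4 R -> R[i]) (W : set (E2 R)) : Prop :=
  exists (t0 t1 : R) (Gam : R -> E2 R),
  [/\ t0 < t1, closed_path l t0 t1 Gam,
      (forall s, t0 <= s <= t1 -> W (Gam s)),
      (exists z, at_point Phi z (Gam t0) = 0) &
      forall z1, at_point Phi z1 (Gam t0) = 0 ->
        exists zeta, [/\ zero_lift Phi t0 t1 Gam z1 zeta,
          (forall zeta', zero_lift Phi t0 t1 Gam z1 zeta' ->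
             forall s, t0 <= s <= t1 -> zeta' s = zeta s) &
          zeta t1 <> zeta t0]].

(* The part of the window lying in the time interval (0, tau) on which the
   fields are defined. *)
Definition window (l tau delta eps x3 t : R) : set (E2 R) :=
  [set y | [/\ 0 < y.2 < tau, near_mod l (delta / eps) y.1 (x3 / eps) &
               `|y.2 - t / eps| < delta / eps]].

End AbelianHiggs.

(* Main.v *)
(* The only facts used about the data are the C^1 regularity of [q], the
   Bogomolny equations and the finite energy of each u(.;q), and the bound by
   C eps^2 of the error Phi_eps - phi(q_eps) and of its Lipschitz constant in z.

   Since the differential of D is invertible at the given point, there is a loop
   [gam] around it along which D is within sg^2 / 64 of sg^2 exp(2 i a),
   0 <= a <= pi. Writing phi = g p with g > 0, the Bogomolny equations express
   d log g through the connection, so that E = 1 / g is bounded and Lipschitz on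
   discs, uniformly for q in a compact set, and the zeros of Phi_eps in a disc
   are those of E Phi_eps = p + E err, a small Lipschitz perturbation of the
   quadratic polynomial p. By a contraction argument there is exactly one near
   each of (- q_1 + sg exp(i a)) / 2 and (- q_1 - sg exp(i a)) / 2, depending
   continuously on a, and these two points are exchanged between a = 0 and
   a = pi.

   That no other zeros exist follows from |phi|^2 >= m > 0 outside a disc: by
   finite energy there are arbitrarily large squares on whose boundary
   |phi| >= 1/2, and Delta log |phi|^2 = |phi|^2 - 1 excludes interior minima
   of |phi| < 1 away from the zeros of p. *)

Require Import Defs.
From HB Require Import structures.
From mathcomp Require Import all_boot all_order all_algebra.
From mathcomp Require Import all_classical all_reals all_analysis.
From mathcomp Require Import ess_sup_inf measurable_realfun.
From mathcomp Require Import complex.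
From mathcomp Require Import ring lra.
Set Implicit Arguments. Unset Strict Implicit. Unset Printing Implicit Defensive.
Import Order.TTheory GRing.Theory Num.Theory.
Import numFieldNormedType.Exports.
Local Open Scope classical_set_scope.
Local Open Scope ring_scope.
Local Open Scope complex_scope.

(** * Functions of class C^k and almost everywhere bounds *)

(** Reconnection asks that every zero have exactly one continuous lift. Uniform closeness of Phi_eps
    to phi(q_eps) would only yield zeros, by a degree argument; it is the Lipschitz bound on the
    error that isolates each of them in a disc of radius sg / 8. The factor [f] in the definition of
    the family is just a positive function, not even determined by phi where p vanishes, so no
    regularity can be read off from it. The bounds on E therefore come from the connection, and at
    the zeros of p the value of E is defined by extension. The data are weak: the Bogomolny
    equations and the energy involve weak derivatives, and the Sobolev bounds on the error hold for
    almost every time. Continuity turns the former into classical identities and the latter into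
    pointwise bounds at all times. The loop is fixed before eps: sg depends on q, the point and
    delta only, and eps is then taken so small that the error is negligible against sg^2. The defect
    sg^2 / 64 of D is divided by 4 when it enters p, which leaves room for the error within the sg^2
    / 64 that the argument on discs of radius sg / 8 tolerates. *)

Section Ck_theory.
Variables (R : realType) (V : normedModType R).
Implicit Types f g : V -> R.

Lemma Ck_continuous k f : Ck k f -> continuous f.
Proof. by case: k => [|k] []. Qed.

Lemma Ck_le k f : Ck k.+1 f -> Ck k f.
Proof.
elim: k f => [|k IH] f [cf df]; first by split.
split => // v; have [d1 d2] := df v; split => //; exact: IH.
Qed.

Lemma Ck_derivable k f v x : Ck k.+1 f -> derivable f x v.
Proof. by move=> [_ /(_ v) []]. Qed.

Lemma Ck_derive k f v : Ck k.+1 f -> Ck k (fun x => 'D_v f x).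
Proof. by move=> [_ /(_ v) []]. Qed.

Lemma Ck_cst k (c : R) : Ck k (fun _ : V => c).
Proof.
elim: k c => [|k IH] c; (split; first by move=> x; exact: cvg_cst) => // v.
split; first by move=> x; exact: derivable_cst.
have -> : (fun x => 'D_v (fun _ : V => c) x) = fun _ => 0.
  by apply/funext => x; rewrite (derive_cst c x v).
exact: IH.
Qed.

Lemma CkD k f g : Ck k f -> Ck k g -> Ck k (fun x => f x + g x).
Proof.
elim: k f g => [|k IH] f g [cf df] [cg dg];
  (split; first by move=> x; apply: cvgD; [exact: cf|exact: cg]) => // v.
have [df1 df2] := df v; have [dg1 dg2] := dg v.
split; first by move=> x; exact: derivableD.
have -> : (fun x => 'D_v (fun x => f x + g x) x) = fun x => 'D_v f x + 'D_v g x.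
  by apply/funext => x; rewrite -deriveD.
exact: IH.
Qed.

Lemma CkM k f g : Ck k f -> Ck k g -> Ck k (fun x => f x * g x).
Proof.
elim: k f g => [|k IH] f g Cf Cg;
  (split; first by move=> x; apply: cvgM; [exact: Ck_continuous Cf x|exact: Ck_continuous Cg x]) => // v.
split; first by move=> x; apply: derivableM; [exact: Ck_derivable Cf|exact: Ck_derivable Cg].
have -> : (fun x => 'D_v (fun x => f x * g x) x) = fun x => f x * 'D_v g x + g x * 'D_v f x.
  apply/funext => x; have := @deriveM _ _ f g x v.
  by rewrite /= => ->; [|exact: Ck_derivable Cf|exact: Ck_derivable Cg].
by apply: CkD; apply: IH; (exact: Ck_le || exact: Ck_derive).
Qed.

Lemma CkN k f : Ck k f -> Ck k (fun x => - f x).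
Proof.
move=> Cf; have -> : (fun x => - f x) = (fun x => -1 * f x).
  by apply/funext => x; rewrite mulN1r.
by apply: CkM => //; exact: Ck_cst.
Qed.

Lemma CkB k f g : Ck k f -> Ck k g -> Ck k (fun x => f x - g x).
Proof. by move=> Cf Cg; apply: CkD => //; exact: CkN. Qed.

End Ck_theory.

Lemma derive_section (R : realType) (V W : normedModType R) (f : V * W -> R)
    (w : W) (v x : V) :
  (derivable (fun x => f (x, w)) x v <-> derivable f (x, w) (v, 0)) /\
  'D_v (fun x => f (x, w)) x = 'D_(v, 0) f (x, w).
Proof.
rewrite /derive /derivable.
have -> : (fun h : R => h^-1 *: ((f \o shift (x, w)) (h *: (v, 0)) - f (x, w)))
   = (fun h : R => h^-1 *: (((fun x => f (x, w)) \o shift x) (h *: v) - f (x, w))).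
  apply/funext => h /=; congr (_ *: (f _ - _)).
  by apply/pair_equal_spec => /=; rewrite scaler0 add0r.
by split.
Qed.

Lemma derive_section2 (R : realType) (V W : normedModType R) (f : V * W -> R)
    (w : V) (v x : W) :
  (derivable (fun x => f (w, x)) x v <-> derivable f (w, x) (0, v)) /\
  'D_v (fun x => f (w, x)) x = 'D_(0, v) f (w, x).
Proof.
rewrite /derive /derivable.
have -> : (fun h : R => h^-1 *: ((f \o shift (w, x)) (h *: (0, v)) - f (w, x)))
   = (fun h : R => h^-1 *: (((fun x => f (w, x)) \o shift x) (h *: v) - f (w, x))).
  apply/funext => h /=; congr (_ *: (f _ - _)).
  by apply/pair_equal_spec => /=; rewrite scaler0 add0r.
by split.
Qed.

Lemma continuous_section (X Y Z : topologicalType) (f : X * Y -> Z) (y : Y) :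
  continuous f -> continuous (fun x => f (x, y)).
Proof.
move=> cf x; apply: (@continuous_comp _ _ _ (fun x => (x, y)) f); last exact: cf.
by apply: cvg_pair => //=; exact: cvg_cst.
Qed.

Lemma continuous_section2 (X Y Z : topologicalType) (f : X * Y -> Z) (x : X) :
  continuous f -> continuous (fun y => f (x, y)).
Proof.
move=> cf y.
have h : (x, z) @[z --> y] --> (x, y) by apply: cvg_pair; [exact: cvg_cst|exact: cvg_id].
exact: (continuous_comp (f := fun z => (x, z)) h (cf (x, y))).
Qed.

Lemma Ck_section (R : realType) (V W : normedModType R) (f : V * W -> R)
    (w : W) k : Ck k f -> Ck k (fun x => f (x, w)).
Proof.
elim: k f => [|k IH] f Cf;
  (split; first exact/continuous_section/Ck_continuous/Cf) => // v.
split.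
  by move=> x; have [dx _] := derive_section f w v x; apply/dx; exact: Ck_derivable Cf.
have -> : (fun x => 'D_v (fun x => f (x, w)) x) = fun x => 'D_(v, 0) f (x, w).
  by apply/funext => x; rewrite (derive_section f w v x).2.
exact/(IH (fun y => 'D_(v, 0) f y))/Ck_derive.
Qed.

Lemma dist_lt (R : realFieldType) (x y e : R) :
  x - e < y -> y < x + e -> `|x - y| < e.
Proof. by move=> h1 h2; rewrite ltr_norml; apply/andP; split; lra. Qed.

(** * Open sets and null sets in the product measure spaces *)

Section Borel.
Variable R : realType.

(* A countable family of measurable sets which is a base of neighbourhoods;
   [j] is the identity between two structures on the same space. *)
Definition countable_nbase (V : topologicalType) d (T : measurableType d)
    (j : T -> V) (I : countType) (B : I -> set T) :=
  (forall i, measurable (B i)) /\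
  forall x U, nbhs (j x) U -> exists i, B i x /\ B i `<=` j @^-1` U.

(** An open set is the union of the countably many members of the base that it contains. This links
    the product sigma-algebra to the product topology. *)
Lemma nbase_open_measurable (V : topologicalType) d (T : measurableType d)
    (j : T -> V) (I : countType) (B : I -> set T) (U : set V) :
  countable_nbase j B -> open U -> measurable (j @^-1` U).
Proof.
move=> [mB hB] oU.
have -> : j @^-1` U = \bigcup_i (if `[< B i `<=` j @^-1` U >] then B i else set0).
  apply/seteqP; split=> x /=.
    move=> Ux; have [i [Bx BU]] := hB x U (open_nbhs_nbhs (conj oU Ux)).
    by exists i => //; case: asboolP.
  by move=> [i _]; case: asboolP => // BU Bx; exact: BU.
apply: countable_bigcupT_measurable => // i; by case: ifP.
Qed.

Lemma nbase_continuous_measurable (V : topologicalType) d (T : measurableType d)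
    (j : T -> V) (I : countType) (B : I -> set T) (f : V -> R) :
  countable_nbase j B -> continuous f -> measurable_fun setT (fun x => f (j x)).
Proof.
move=> hB /continuousP cf; apply: (measurability _ (measurable_realfun.RGenOpens.measurableE R)).
move=> _ [_ [a [b ->] <-]]; rewrite setTI.
have -> : (fun x => f (j x)) @^-1` `]a, b[ = j @^-1` (f @^-1` `]a, b[) by [].
apply: (nbase_open_measurable hB); apply: cf; exact: interval_open.
Qed.

Definition rbox1 (i : rat * rat) : set (measurableTypeR R) :=
  [set` `]ratr i.1, ratr i.2[%R].

Lemma nbase1 : countable_nbase (@id1 R) rbox1.
Proof.
split; first by move=> i; exact: measurable_itv.
move=> x U /nbhs_ballP[e /= e0 eU].
have /rat_in_itvoo[a] : (x - e < x)%R by rewrite ltrBlDr ltrDl.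
have /rat_in_itvoo[b] : (x < x + e)%R by rewrite ltrDl.
rewrite !in_itv/= => /andP[b1 b2] /andP[a1 a2].
exists (a, b); split; first by rewrite /rbox1 /= in_itv/= a2 b1.
move=> y; rewrite /rbox1 /= in_itv/= => /andP[y1 y2]; apply: eU => /=.
apply: dist_lt; [exact: lt_trans a1 y1|exact: lt_trans y2 b2].
Qed.

Lemma nbaseX (V1 V2 : topologicalType) d1 d2 (T1 : measurableType d1)
   (T2 : measurableType d2) (j1 : T1 -> V1) (j2 : T2 -> V2) (I1 I2 : countType)
   (B1 : I1 -> set T1) (B2 : I2 -> set T2) :
  countable_nbase j1 B1 -> countable_nbase j2 B2 ->
  countable_nbase (fun x : T1 * T2 => (j1 x.1, j2 x.2) : V1 * V2)
    (fun i : I1 * I2 => B1 i.1 `*` B2 i.2).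
Proof.
move=> [m1 h1] [m2 h2]; split; first by move=> i; exact: measurableX.
move=> [x1 x2] U [[P Q] /= [hP hQ] PQ].
have [i1 [B1x P1]] := h1 _ _ hP; have [i2 [B2x P2]] := h2 _ _ hQ.
exists (i1, i2); split => //= y [By1 By2] /=; apply: PQ; split; [exact: P1|exact: P2].
Qed.

Definition rbox2 (i : (rat * rat) * (rat * rat)) := rbox1 i.1 `*` rbox1 i.2.

Lemma nbase2 : countable_nbase (@id2 R) rbox2.
Proof.
have -> : @id2 R = fun x => (id1 x.1, id1 x.2) by apply/funext => -[].
exact: nbaseX nbase1 nbase1.
Qed.

Definition rbox3 (i : (rat * rat) * (rat * rat) * (rat * rat)) :=
  rbox2 i.1 `*` rbox1 i.2.

Lemma nbase3 : countable_nbase (@id3 R) rbox3.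
Proof.
have -> : @id3 R = fun x => (id2 x.1, id1 x.2) by apply/funext => -[].
exact: nbaseX nbase2 nbase1.
Qed.

Lemma continuous_measurable2 (f : E2 R -> R) :
  continuous f -> measurable_fun setT (fun x => f (id2 x)).
Proof. exact: nbase_continuous_measurable nbase2. Qed.

Lemma leb2_box (A B : set (measurableTypeR R)) : measurable A -> measurable B ->
  leb2 R (A `*` B) = (lebesgue_measure A * lebesgue_measure B)%E.
Proof. by move=> mA mB; exact: product_measure1E. Qed.

Lemma leb3_box (A B C : set (measurableTypeR R)) :
  measurable A -> measurable B -> measurable C ->
  leb3 R (A `*` B `*` C) =
    (lebesgue_measure A * lebesgue_measure B * lebesgue_measure C)%E.
Proof.
move=> mA mB mC; rewrite -leb2_box//.
apply: product_measure1E => //; exact: measurableX.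
Qed.

Lemma lebesgue_ball (x r : R) : 0 < r ->
  (0 < @lebesgue_measure R [set` `]x - r, x + r[%R])%E.
Proof.
move=> r0; rewrite lebesgue_measure_itv/= lte_fin ifT; last by lra.
by rewrite -EFinB lte_fin; lra.
Qed.

(** A strict inequality [c < f x] would persist on a box around [x], which has positive measure. *)
Lemma ae_leb2_continuous (f : E2 R -> R) (c : R) (x : E2 R) :
  {for x, continuous f} -> {ae leb2 R, forall y, f (id2 y) <= c} -> f x <= c.
Proof.
move=> cf [N [mN N0 hN]]; rewrite leNgt; apply/negP => fx.
have : \forall y \near x, c < f y by exact: (cvgr_gt (f x) cf).
move=> /nbhs_ballP[e /= e0 eU].
pose B : set (measurableTypeR R * measurableTypeR R) :=
  [set` `]x.1 - e, x.1 + e[%R] `*` [set` `]x.2 - e, x.2 + e[%R].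
have mB : measurable B by apply: measurableX.
have : (leb2 R B <= leb2 R N)%E.
  apply: le_measure; rewrite ?inE// => -[y1 y2] [/= yB1 yB2].
  apply: hN => /=; apply/negP; rewrite -ltNge; apply: eU.
  by move: yB1 yB2; rewrite !in_itv/= => /andP[a b] /andP[p q]; split; apply: dist_lt.
rewrite N0 leNgt => /negP; apply.
by rewrite leb2_box// mule_gt0// lebesgue_ball.
Qed.

Lemma ae_leb3_continuous (f : E3 R -> R) (c : R) (x : E3 R) :
  {for x, continuous f} -> {ae leb3 R, forall y, f (id3 y) <= c} -> f x <= c.
Proof.
move=> cf [N [mN N0 hN]]; rewrite leNgt; apply/negP => fx.
have : \forall y \near x, c < f y by exact: (cvgr_gt (f x) cf).
move=> /nbhs_ballP[e /= e0 eU].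
pose B : set (measurableTypeR R * measurableTypeR R * measurableTypeR R) :=
  [set` `]x.1.1 - e, x.1.1 + e[%R] `*` [set` `]x.1.2 - e, x.1.2 + e[%R]
  `*` [set` `]x.2 - e, x.2 + e[%R].
have mB : measurable B by apply: measurableX => //; apply: measurableX.
have : (leb3 R B <= leb3 R N)%E.
  apply: le_measure; rewrite ?inE// => -[[y1 y2] y3] [[/= yB1 yB2] yB3].
  apply: hN => /=; apply/negP; rewrite -ltNge; apply: eU.
  by move: yB1 yB2 yB3; rewrite !in_itv/= => /andP[a b] /andP[p q] /andP[u v];
    split; first split; apply: dist_lt.
rewrite N0 leNgt => /negP; apply.
by rewrite leb3_box// !mule_gt0// lebesgue_ball.
Qed.

(** A null set contains no interval. This is how times with good bounds are found arbitrarily close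
    to a given time. *)
Lemma ae_lebesgue_dense (P : set R) (a b : R) : a < b ->
  {ae @lebesgue_measure R, forall t, P t} -> exists t, a < t < b /\ P t.
Proof.
move=> ab [N [mN N0 hN]]; apply: contrapT => /forallNP h.
have : (@lebesgue_measure R [set` `]a, b[%R] <= @lebesgue_measure R N)%E.
  apply: le_measure; rewrite ?inE// => t /=; rewrite in_itv/= => tab.
  by apply: hN => /= Pt; apply: (h t).
rewrite N0 leNgt => /negP; apply.
by rewrite lebesgue_measure_itv/= lte_fin ab -EFinB lte_fin subr_gt0.
Qed.

End Borel.

(** * Compactly supported functions and integration by parts *)

Lemma FTC2_R (R : realType) (F f : R -> R) (a b : R) : a <= b ->
  (forall x : R, is_derive x 1 F (f x)) -> continuous f ->
  (\int[@lebesgue_measure R]_(x in `[a, b]) (f x)%:E = (F b - F a)%:E)%E.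
Proof.
move=> ab dF cf.
have [->|ne] := eqVneq a b; first by rewrite set_itv1 integral_set1 subrr.
have {ab ne}ab : a < b by rewrite lt_neqAle ne ab.
have cF : continuous F.
  by move=> x; apply/differentiable_continuous/derivable1_diffP; have [] := dF x.
rewrite (@continuous_FTC2 R f F a b) ?EFinB//.
- exact: continuous_subspaceT.
- split; first by move=> x _; have [] := dF x.
  + exact/cvg_at_right_filter/cF.
  + exact/cvg_at_left_filter/cF.
- by move=> x _; rewrite derive1E; have := dF x => /@derive_val ->.
Qed.

(** On products the norm is the maximum norm, so these are squares and cubes, adapted to Fubini and
    to axis-parallel paths. *)
Definition cball (R : realType) (V : normedModType R) (n : R) : set V :=
  [set x | `|x| <= n].
Arguments cball {R} V n.

Section CompactSupport.
Variables (R : realType) (V : normedModType R) (d : measure_display)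
  (T : measurableType d) (j : T -> V) (mu : {measure set T -> \bar R}).

Definition csupp (f : V -> R) :=
  continuous f /\ exists n : R, forall x, n < `|x| -> f x = 0.

(** What the line, the plane and the space share: continuous functions are measurable, and balls are
    compact of finite measure. Integrability of continuous functions with compact support follows
    from this alone. *)
Definition tame := (exists (I : countType) (B : I -> set T), countable_nbase j B) /\
  forall n : R, compact (cball V n) /\
    (mu (j @^-1` (cball V n)) < +oo)%E.

Hypothesis tm : tame.

Lemma tame_measurable_ball (n : R) : measurable (j @^-1` (cball V n)).
Proof.
have [[I [B hB]] _] := tm.
have -> : j @^-1` (cball V n) = ~` (j @^-1` [set x : V | n < `|x|]).
  by apply/seteqP; split => x /=; rewrite /cball/= leNgt => /negP.
apply: measurableC; apply: (nbase_open_measurable hB).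
rewrite -[X in open X]/((fun x : V => `|x|) @^-1` [set y : R | n < y]).
by apply: open_comp; [move=> x _; exact: norm_continuous|exact: open_gt].
Qed.

Lemma tame_measurable_fun (f : V -> R) (D : set T) : measurable D ->
  continuous f -> measurable_fun D (fun x => f (j x)).
Proof.
move=> mD cf; have [[I [B hB]] _] := tm.
exact/(measurable_funS _ _ (nbase_continuous_measurable hB cf)).
Qed.

Lemma continuous_bounded_ball (f : V -> R) (n : R) : continuous f ->
  exists M, forall x, `|x| <= n -> `|f x| <= M.
Proof.
move=> cf; have [cK _] := (tm.2 n).
have : compact (f @` (cball V n)).
  by apply: continuous_compact => //; exact: continuous_subspaceT.
move=> /compact_bounded [M [_ hM]]; exists (M + 1) => x xn.
by apply: (hM (M + 1)) => /=; [rewrite ltrDl|exists x].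
Qed.

Lemma csupp_bounded (f : V -> R) : csupp f -> exists M, forall x, `|f x| <= M.
Proof.
move=> [cf [n fn]]; have [M hM] := continuous_bounded_ball n cf.
exists (Num.max M 0) => x; rewrite le_max.
by have [/hM ->//|/fn ->] := leP `|x| n; rewrite normr0 lexx orbT.
Qed.

Lemma integrable_ball_supp (g : T -> R) (n : R) :
  (forall x, n < `|j x| -> g x = 0) ->
  mu.-integrable (j @^-1` (cball V n)) (fun x => (g x)%:E) ->
  mu.-integrable setT (fun x => (g x)%:E).
Proof.
move=> gn /(integrable_mkcond _ (tame_measurable_ball n)).
rewrite (_ : _ \_ _ = fun x => (g x)%:E)//.
apply/funext => x; rewrite patchE; case: ifPn => //.
by rewrite notin_setE /= => /negP; rewrite -ltNge => /gn ->.
Qed.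

Lemma continuous_integrable_ball (f : V -> R) (n : R) : continuous f ->
  mu.-integrable (j @^-1` (cball V n)) (fun x => (f (j x))%:E).
Proof.
move=> cf; have [M hM] := continuous_bounded_ball n cf.
have mB := tame_measurable_ball n.
apply: (measurable_bounded_integrable (f := fun x => f (j x))) => //.
- by have [] := tm.2 n.
- exact: tame_measurable_fun.
- exists M; split; first exact: num_real.
  by move=> y My x /= xn; exact: le_trans (hM _ xn) (ltW My).
Qed.

Lemma csupp_integrable (f : V -> R) : csupp f ->
  mu.-integrable setT (fun x => (f (j x))%:E).
Proof.
move=> [cf [n fn]]; apply: (@integrable_ball_supp (fun x => f (j x)) n).
  by move=> x /fn.
exact: continuous_integrable_ball.
Qed.

Lemma continuous_loc_integrable (f : V -> R) : continuous f ->
  loc_integrable j mu setT f.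
Proof.
move=> cf K cK _; have [[I [B hB]] _] := tm.
have [M [_ hM]] := compact_bounded cK.
apply: (integrableS (tame_measurable_ball (M + 1))).
- have -> : j @^-1` K = ~` (j @^-1` (~` K)) by rewrite preimage_setC setCK.
  apply: measurableC; apply: (nbase_open_measurable hB).
  by apply: closed_openC; apply: compact_closed => //; exact: norm_hausdorff.
- by move=> x /= Kx; apply: (hM (M + 1)) => //; rewrite ltrDl.
- exact: continuous_integrable_ball.
Qed.

Lemma loc_integrable_csupp (f psi : V -> R) : loc_integrable j mu setT f ->
  csupp psi -> mu.-integrable setT (fun x => (f (j x) * psi (j x))%:E).
Proof.
move=> lf cpsi; have [M hM] := csupp_bounded cpsi.
have [cp [n pn]] := cpsi.
apply: (@integrable_ball_supp (fun x => f (j x) * psi (j x)) n).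
  by move=> x /pn ->; rewrite mulr0.
have mB := tame_measurable_ball n.
have /= := @integrableMl _ _ R mu (j @^-1` (cball V n)) mB
  (fun x => (f (j x))%:E) (fun x => psi (j x)).
apply.
- by apply: lf => //; have [] := tm.2 n.
- exact: tame_measurable_fun.
- exists M; split; first exact: num_real.
  by move=> y My x /= xn; exact: le_trans (hM _) (ltW My).
Qed.

Lemma csuppM (f g : V -> R) : continuous f -> csupp g -> csupp (fun x => f x * g x).
Proof.
move=> cf [cg [n gn]]; split.
  by move=> x; apply: cvgM; [exact: cf|exact: cg].
by exists n => x /gn ->; rewrite mulr0.
Qed.

Lemma csupp_test_fun (f : V -> R) : Ck 1 f -> csupp f -> test_fun setT f.
Proof.
move=> Cf [cf [n fn]]; split => //; exists (cball V n).
split => //; first by have [] := tm.2 n.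
by move=> x /negP; rewrite -ltNge => /fn.
Qed.

Lemma test_fun_csupp (f : V -> R) : test_fun setT f -> csupp f.
Proof.
move=> [Cf [K [cK _ fK]]]; split; first exact: Ck_continuous Cf.
have [M [_ hM]] := compact_bounded cK.
exists (M + 1) => x Mx; apply: fK => Kx.
by have := hM (M + 1); rewrite ltrDl ltr01 => /(_ isT _ Kx) /=; rewrite leNgt Mx.
Qed.

Lemma csupp_derive (f : V -> R) (v : V) : Ck 1 f -> csupp f ->
  csupp (fun x => 'D_v f x).
Proof.
move=> Cf [cf [n fn]]; split; first exact: Ck_continuous (Ck_derive v Cf).
exists n => x nx.
have near0 : \forall y \near x, (fun _ => 0) y = f y.
  have : \forall y \near x, n < `|y|.
    exact: (cvgr_gt `|x| (@norm_continuous _ V x) n nx).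
  by apply: filterS => y /fn.
have := near_eq_is_derive near0 (is_derive_cst (0 : R) x v).
by move=> /@derive_val.
Qed.

End CompactSupport.

Section TameSpaces.
Variable R : realType.

Lemma ball_itv (n : R) : cball R n = `[- n, n]%classic.
Proof. by apply/seteqP; split => x; rewrite /cball/= in_itv/= ler_norml. Qed.

Lemma ball_setX (V W : normedModType R) (n : R) :
  cball (V * W)%type n = cball V n `*` cball W n.
Proof.
by apply/seteqP; split => -[x y]; rewrite /cball/= prod_normE/= ge_max => /andP.
Qed.

Lemma tame1 : tame (@id1 R) (@lebesgue_measure R).
Proof.
split; first by exists _, (@rbox1 R); exact: nbase1.
move=> n; split; first by rewrite ball_itv; exact: segment_compact.
rewrite ball_itv.
have h : (@lebesgue_measure R [set` `[(- n), n]%R] < +oo)%E.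
  by rewrite lebesgue_measure_itv/=; case: ifP => // _; rewrite -EFinB ltry.
exact: h.
Qed.

Lemma tame2 : tame (@id2 R) (leb2 R).
Proof.
split; first by exists _, (@rbox2 R); exact: nbase2.
move=> n; split.
  by rewrite ball_setX; apply: compact_setX; exact: (tame1.2 n).1.
rewrite ball_setX -[X in leb2 R X]/((@id1 R @^-1` (cball R n)) `*`
  (@id1 R @^-1` (cball R n))).
rewrite leb2_box; [|exact: tame_measurable_ball tame1 n..].
by rewrite lte_mul_pinfty// ?ge0_fin_numE// (tame1.2 n).2.
Qed.

Lemma tame3 : tame (@id3 R) (leb3 R).
Proof.
split; first by exists _, (@rbox3 R); exact: nbase3.
move=> n; split.
  by rewrite ball_setX; apply: compact_setX; [exact: (tame2.2 n).1|exact: (tame1.2 n).1].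
rewrite !ball_setX -[X in leb3 R X]/((@id1 R @^-1` (cball R n)) `*`
  (@id1 R @^-1` (cball R n)) `*` (@id1 R @^-1` (cball R n))).
rewrite leb3_box; [|exact: tame_measurable_ball tame1 n..].
have h := (tame1.2 n).2.
by rewrite !lte_mul_pinfty// ?ge0_fin_numE// ?mule_ge0// lte_mul_pinfty// ge0_fin_numE.
Qed.

End TameSpaces.

(** * C^1 cutoff functions on the line *)

Section OneDim.
Variable R : realType.
Implicit Types x y : R.

(** The simplest C^1 function that vanishes exactly on a half-line; test functions are only required
    to be C^1. *)
Definition psq (y : R) : R := Num.max 0 y ^+ 2.

Lemma psq_ge0 y : 0 <= psq y. Proof. exact: sqr_ge0. Qed.

Lemma psq0 y : y <= 0 -> psq y = 0.
Proof. by move=> y0; rewrite /psq max_l// expr0n. Qed.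

Lemma psq_gt0 y : 0 < y -> 0 < psq y.
Proof. by move=> y0; rewrite /psq max_r ?ltW// exprn_gt0. Qed.

Lemma is_derive_psq x : is_derive x 1 psq (2 * Num.max 0 x).
Proof.
have [x0|x0|->] := ltgtP x 0.
- have h : \forall y \near x, (fun=> 0) y = psq y.
    by apply: filterS (cvgr_lt x (@cvg_id _ (nbhs x)) 0 x0) => y /ltW /psq0.
  rewrite mulr0; exact: near_eq_is_derive h (is_derive_cst _ _ _).
- have h : \forall y \near x, y ^+ 2 = psq y.
    apply: filterS (cvgr_gt x (@cvg_id _ (nbhs x)) 0 x0) => y /ltW y0.
    by rewrite /psq max_r.
  apply: near_eq_is_derive h _.
  by apply: is_derive_eq; rewrite [_%:A]mulr1 -mulr2n [RHS]mulr_natl.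
- rewrite mulr0.
  have h : (fun h : R => h^-1 *: (psq (h *: 1 + 0) - psq 0)) @ 0^' --> (0 : R).
    apply/cvgrPdist_lt => e e0.
    have : \forall t \near (0 : R)^', `|t| < e.
      by apply: dnbhs0_lt.
    apply: filterS2 (@nbhs_dnbhs_neq _ (0 : R)) => t t0 te.
    rewrite sub0r normrN (psq0 (lexx 0)) subr0 addr0 [_ *: 1]mulr1.
    apply: le_lt_trans te; rewrite normrM normfV /psq.
    have [t1|t1] := leP 0 t.
      by rewrite expr2 normrM mulKf// normr_eq0.
    by rewrite expr0n normr0 mulr0.
  apply: DeriveDef; first by apply/cvg_ex; exists 0.
  exact/cvg_lim.
Qed.

Lemma continuous_max0 : continuous (fun y : R => Num.max 0 y).
Proof. by move=> y; apply: continuous_max; [exact: cvg_cst|exact: cvg_id]. Qed.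

Lemma is_derive_continuous (F f : R -> R) :
  (forall x : R, is_derive x 1 F (f x)) -> continuous F.
Proof.
by move=> dF x; apply/differentiable_continuous/derivable1_diffP; have [] := dF x.
Qed.

Lemma Ck1_R (F f : R -> R) :
  (forall x : R, is_derive x 1 F (f x)) -> continuous f -> Ck 1 F.
Proof.
move=> dF cf; split; first exact: is_derive_continuous dF.
move=> v.
have dv x : is_derive x v F (v * f x).
  have /derivable1_diffP dfx : derivable F x 1 by have [] := dF x.
  apply: DeriveDef; first exact: diff_derivable.
  rewrite deriveE// -[v in 'd _ _ v]mulr1 [LHS]linearZ/= -deriveE//.
  by have := dF x => /@derive_val ->.
split; first by move=> x; have [] := dv x.
split => //; rewrite (_ : (fun x => _) = fun x => v * f x).
  by move=> x; apply: cvgM; [exact: cvg_cst|exact: cf].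
by apply/funext => x; exact: derive_val.
Qed.

(** A C^1 transition from 0 to 1 over the unit interval. The denominator never vanishes because [x]
    and [1 - x] are not both nonpositive. *)
Definition step (x : R) : R := psq x / (psq x + psq (1 - x)).
Definition dstep (x : R) : R :=
  2 * (Num.max 0 x * psq (1 - x) + psq x * Num.max 0 (1 - x))
    / (psq x + psq (1 - x)) ^+ 2.

Lemma step_den x : 0 < psq x + psq (1 - x).
Proof.
have [x0|x0] := ltP 0 x; first by rewrite ltr_pwDl ?psq_gt0 ?psq_ge0.
by rewrite ltr_wpDl ?psq_ge0// psq_gt0//; lra.
Qed.

Lemma step0 x : x <= 0 -> step x = 0.
Proof. by move=> x0; rewrite /step psq0// mul0r. Qed.

Lemma step1 x : 1 <= x -> step x = 1.
Proof.
move=> x1; rewrite /step [psq (1 - x)]psq0 ?addr0 ?divff//; last by lra.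
by rewrite gt_eqF// psq_gt0//; lra.
Qed.

Lemma step_ge0 x : 0 <= step x.
Proof. by rewrite divr_ge0 ?psq_ge0// ltW// step_den. Qed.

Lemma step_le1 x : step x <= 1.
Proof. by rewrite ler_pdivrMr ?step_den// mul1r lerDl psq_ge0. Qed.

Lemma step_gt0 x : 0 < x -> 0 < step x.
Proof. by move=> x0; rewrite divr_gt0 ?psq_gt0// step_den. Qed.

Lemma is_derive_step x : is_derive x 1 step (dstep x).
Proof.
have d1 := is_derive_psq x.
have d2 : is_derive x 1 (fun y => psq (1 - y)) (- (2 * Num.max 0 (1 - x))).
  rewrite -mulrN1; apply: is_derive1_comp; first exact: is_derive_psq.
  by apply: is_derive_eq; rewrite add0r mul1r.
have n0 : psq x + psq (1 - x) != 0 by rewrite gt_eqF// step_den.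
have d3 := is_deriveV (f := fun y => psq y + psq (1 - y)) n0.
have d4 : is_derive x 1 (fun y => psq y * (psq y + psq (1 - y))^-1) (dstep x).
  apply: is_derive_eq; rewrite /dstep /GRing.scale /=.
  by field.
exact: d4.
Qed.

Lemma dstep_ge0 x : 0 <= dstep x.
Proof.
have := step_den x => h; apply: divr_ge0; last exact: sqr_ge0.
by rewrite mulr_ge0// addr_ge0// mulr_ge0// ?psq_ge0// le_max lexx.
Qed.

Lemma dstep0 x : x <= 0 -> dstep x = 0.
Proof. by move=> x0; rewrite /dstep (psq0 x0) (max_idPl x0) !mul0r addr0 mulr0 mul0r. Qed.

Lemma dstep1 x : 1 <= x -> dstep x = 0.
Proof.
move=> x1; have x0 : 1 - x <= 0 by lra.
by rewrite /dstep (psq0 x0) (max_idPl x0) !mulr0 addr0 mulr0 mul0r.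
Qed.

Lemma continuous_psq : continuous psq.
Proof. exact: is_derive_continuous is_derive_psq. Qed.

Lemma continuous_dstep : continuous dstep.
Proof.
move=> x.
have c1 : (1 - y)%R @[y --> x] --> 1 - x by apply: cvgB; [exact: cvg_cst|exact: cvg_id].
have cp := @continuous_psq x; have cm := @continuous_max0 x.
have cp1 : psq (1 - y) @[y --> x] --> psq (1 - x).
  exact: (continuous_cvg _ (@continuous_psq _) c1).
have cm1 : Num.max 0 (1 - y) @[y --> x] --> Num.max 0 (1 - x).
  exact: (continuous_cvg _ (@continuous_max0 _) c1).
have cd : (psq y + psq (1 - y)) @[y --> x] --> psq x + psq (1 - x) by apply: cvgD.
apply: cvgM.
  by apply: cvgMr; apply: cvgD; apply: cvgM.
apply: cvgV; last by rewrite expr2; apply: cvgM.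
by rewrite expf_neq0// gt_eqF// step_den.
Qed.

End OneDim.

Section Products.
Variable R : realType.

Lemma Ck_fst (V W : normedModType R) k (g : V -> R) :
  Ck k g -> Ck k (fun x : V * W => g x.1).
Proof.
elim: k g => [|k IH] g Cg;
  (split; first by move=> x; apply: continuous_comp; [exact: cvg_fst|exact: Ck_continuous Cg _]) => // v.
split; first by move=> x; change (derivable g x.1 v.1); exact: Ck_derivable Cg.
by apply: (IH (fun x => 'D_v.1 g x)); exact: Ck_derive.
Qed.

Lemma Ck_snd (V W : normedModType R) k (g : W -> R) :
  Ck k g -> Ck k (fun x : V * W => g x.2).
Proof.
elim: k g => [|k IH] g Cg;
  (split; first by move=> x; apply: continuous_comp; [exact: cvg_snd|exact: Ck_continuous Cg _]) => // v.
split; first by move=> x; change (derivable g x.2 v.2); exact: Ck_derivable Cg.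
by apply: (IH (fun x => 'D_v.2 g x)); exact: Ck_derive.
Qed.

Lemma csupp_tensor (V W : normedModType R) (f : V -> R) (g : W -> R) :
  csupp f -> csupp g -> csupp (fun x : V * W => f x.1 * g x.2).
Proof.
move=> [cf [n fn]] [cg [m gm]]; split.
  move=> x; apply: cvgM.
    by apply: (continuous_comp (f := fst)); [exact: cvg_fst|exact: cf].
  by apply: (continuous_comp (f := snd)); [exact: cvg_snd|exact: cg].
exists (Num.max n m) => -[x y] /=; rewrite prod_normE/= lt_max => /orP[|] h.
  have [/fn ->|xn] := ltP n `|x|; first by rewrite mul0r.
  move: h; rewrite gt_max => /andP[/lt_le_trans - /(_ _ xn)].
  by rewrite ltxx.
have [/gm ->|ym] := ltP m `|y|; first by rewrite mulr0.
by move: h; rewrite gt_max => /andP[_ /lt_le_trans - /(_ _ ym)]; rewrite ltxx.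
Qed.

Lemma Rintegral_tensor d1 d2 (T1 : measurableType d1) (T2 : measurableType d2)
    (m1 : {sigma_finite_measure set T1 -> \bar R})
    (m2 : {sigma_finite_measure set T2 -> \bar R}) (f : T1 -> R) (g : T2 -> R) :
  m1.-integrable setT (EFin \o f) -> m2.-integrable setT (EFin \o g) ->
  (m1 \x m2)%E.-integrable setT (fun x => (f x.1 * g x.2)%:E) ->
  \int[(m1 \x m2)%E]_x (f x.1 * g x.2) = \int[m1]_x f x * \int[m2]_x g x.
Proof.
move=> hf hg hfg; rewrite -RintegralZr//.
rewrite /Rintegral -(integral12_prod_meas1 hfg); congr fine.
apply: eq_integral => x _; rewrite /fubini_F /=.
have h := @RintegralZl _ _ _ m2 setT g (f x) measurableT hg.
have ifg : m2.-integrable setT (EFin \o (fun y => f x * g y)).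
  exact: (integrableZl measurableT (f x) hg).
rewrite -(@fineK _ (\int[m2]_y (f x * g y)%:E)%E).
  by rewrite -[fine (integral _ _ _)]/(Rintegral m2 setT (fun y => f x * g y)) h.
exact: (integrable_fin_num measurableT ifg).
Qed.

Lemma csupp_fst (V W : normedModType R) (f : V * W -> R) (w : W) :
  csupp f -> csupp (fun x => f (x, w)).
Proof.
move=> [cf [n fn]]; split; first exact: continuous_section.
by exists n => x nx; apply: fn; rewrite prod_normE/= lt_max nx.
Qed.

Lemma csupp_snd (V W : normedModType R) (f : V * W -> R) (w : V) :
  csupp f -> csupp (fun x => f (w, x)).
Proof.
move=> [cf [n fn]]; split.
  move=> x; apply: (@continuous_comp _ _ _ (fun x => (w, x)) f); last exact: cf.
  by apply: cvg_pair => //=; exact: cvg_cst.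
by exists n => x nx; apply: fn; rewrite prod_normE/= lt_max nx orbT.
Qed.

Lemma integral_derive_csupp1 (F f : R -> R) : csupp F -> csupp f ->
  (forall x : R, is_derive x 1 F (f x)) ->
  (\int[@lebesgue_measure R]_x (f x)%:E = 0)%E.
Proof.
move=> [cF [n Fn]] [cf [m fm]] dF.
pose k := `|n| + `|m| + 1.
have kn : n < k by rewrite /k; have := ler_norm n; have := normr_ge0 m; lra.
have km : m < k by rewrite /k; have := ler_norm m; have := normr_ge0 n; lra.
have k0 : 0 <= k by rewrite addr_ge0// addr_ge0.
have -> : (\int[@lebesgue_measure R]_x (f x)%:E =
    \int[@lebesgue_measure R]_(x in `[(- k)%R, k]) (f x)%:E)%E.
  rewrite [RHS]integral_mkcond; apply: eq_integral => x _.
  rewrite patchE; case: ifPn => //; rewrite notin_setE /= in_itv/= -ler_norml.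
  by move=> /negP; rewrite -ltNge => /(lt_trans km) /fm ->.
rewrite (FTC2_R _ dF)//; last lra.
by rewrite !Fn ?normrN ?ger0_norm// subrr.
Qed.

(** By Fubini, with the variable of differentiation integrated first: the inner integral vanishes by
    the fundamental theorem of calculus. *)
Lemma Rintegral_derive2 (Psi : E2 R -> R) (b : 'I_2) : Ck 1 Psi -> csupp Psi ->
  \int[leb2 R]_x 'D_(e2 R b) Psi (id2 x) = 0.
Proof.
move=> CP cP.
have cD := csupp_derive (e2 R b) CP cP.
have iD := csupp_integrable (tame2 R) cD.
rewrite /Rintegral; case: b cD iD => [[|[|//]]] hb cD iD.
- rewrite -(integral21_prod_meas1 iD) /fubini_G integral0_eq// => y _.
  apply: (@integral_derive_csupp1 (fun x => Psi (x, y))).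
  + exact: csupp_fst.
  + exact: (csupp_fst _ cD).
  + move=> x; have [h1 h2] := derive_section Psi y 1 x.
    apply: DeriveDef; last by rewrite h2.
    by apply/h1; apply: Ck_derivable CP.
- rewrite -(integral12_prod_meas1 iD) /fubini_F integral0_eq// => y _.
  apply: (@integral_derive_csupp1 (fun x => Psi (y, x))).
  + exact: csupp_snd.
  + exact: (csupp_snd _ cD).
  + move=> x; have [h1 h2] := derive_section2 Psi y 1 x.
    apply: DeriveDef; last by rewrite h2.
    by apply/h1; apply: Ck_derivable CP.
Qed.

End Products.

(** * From weak to classical derivatives *)

Section WeakDerivative.
Variable R : realType.
Local Notation leb2 := (leb2 R).
Implicit Types (f g h psi : E2 R -> R).

Lemma square_bump (x0 : E2 R) (r : R) : 0 < r -> exists psi : E2 R -> R,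
  [/\ test_fun setT psi, forall x, 0 <= psi x <= 1,
     forall x, `|x - x0| <= r -> 0 < psi x & forall x, 2 * r < `|x - x0| -> psi x = 0].
Proof.
move=> r0.
(* A step rising over the interval from c - 2r to c - r times a step falling from c + r to c +
   2r. *)
pose b (c y : R) := step ((y - c) / r + 2) * step (2 - (y - c) / r).
have Cb c : Ck 1 (b c).
  have d1 (x : R) : is_derive x 1 (fun y => step ((y - c) / r + 2))
      (dstep ((x - c) / r + 2) * r^-1).
    apply: is_derive1_comp; first exact: is_derive_step.
    by apply: is_derive_eq; rewrite /GRing.scale/=; ring.
  have d2 (x : R) : is_derive x 1 (fun y => step (2 - (y - c) / r))
      (dstep (2 - (x - c) / r) * - r^-1).
    apply: is_derive1_comp; first exact: is_derive_step.
    by apply: is_derive_eq; rewrite /GRing.scale/=; ring.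
  have cl (s t : R) : continuous (fun y : R => s + (y - c) * t).
    by move=> y; apply: cvgD; [exact: cvg_cst|apply: cvgMl; apply: cvgB; [exact: cvg_id|exact: cvg_cst]].
  apply: CkM; [apply: (Ck1_R d1)|apply: (Ck1_R d2)].
  - have -> : (fun x : R => dstep ((x - c) / r + 2) / r) = (fun x => dstep (2 + (x - c) * r^-1) / r).
      by apply/funext => x; rewrite addrC.
    move=> x; apply: cvgMl.
    exact: (continuous_comp (cl 2 r^-1 x) (@continuous_dstep R _)).
  - have -> : (fun x : R => dstep (2 - (x - c) / r) * - r^-1) =
       (fun x => dstep (2 + (x - c) * - r^-1) * - r^-1).
      by apply/funext => x; rewrite !mulrN.
    move=> x; apply: cvgMl.
    exact: (continuous_comp (cl 2 (- r^-1) x) (@continuous_dstep R _)).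
have b01 c y : 0 <= b c y <= 1.
  by rewrite mulr_ge0 ?step_ge0//= mulr_ile1// ?step_ge0 ?step_le1.
have bout c y : 2 * r < `|y - c| -> b c y = 0.
  rewrite /b lter_normr => /orP[h|h].
  - by rewrite [X in _ * X]step0 ?mulr0// subr_le0 ler_pdivlMr// ltW.
  - by rewrite [X in X * _]step0 ?mul0r// -[2]opprK subr_le0 ler_pdivrMr// mulNr lerNr ltW.
have bin c y : `|y - c| <= r -> 0 < b c y.
  rewrite ler_norml => /andP[h1 h2]; apply: mulr_gt0; apply: step_gt0.
  - have : - 1 <= (y - c) / r by rewrite ler_pdivlMr// mulN1r.
    lra.
  - have : (y - c) / r <= 1 by rewrite ler_pdivrMr// mul1r.
    lra.
pose psi (x : E2 R) := b x0.1 x.1 * b x0.2 x.2.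
have Cpsi : Ck 1 psi by apply: CkM; [apply: Ck_fst|apply: Ck_snd].
have out x : 2 * r < `|x - x0| -> psi x = 0.
  by rewrite prod_normE/= lt_max /psi => /orP[/bout ->|/bout ->]; rewrite ?mul0r ?mulr0.
exists psi; split => //.
- apply: (csupp_test_fun (tame2 R)) => //; split; first exact: Ck_continuous Cpsi.
  exists (2 * r + `|x0|) => x h; apply: out; rewrite -ltrBrDr in h.
  by apply: lt_le_trans h _; exact: lerB_dist.
- move=> x; have /andP[p1 p2] := b01 x0.1 x.1; have /andP[p3 p4] := b01 x0.2 x.2.
  by rewrite mulr_ge0//= mulr_ile1.
- by move=> x; rewrite prod_normE/= ge_max => /andP[/bin p1 /bin p2]; exact: mulr_gt0.
Qed.

Lemma unit_cutoff (n : R) : exists psi : E2 R -> R,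
  [/\ test_fun setT psi, forall x, 0 <= psi x <= 1 &
     forall x, `|x| <= n -> psi x = 1].
Proof.
pose b (y : R) := step (y + n + 1) * step (n + 1 - y).
have Cb : Ck 1 b.
  have d1 (x : R) : is_derive x 1 (fun y => step (y + n + 1)) (dstep (x + n + 1)).
    rewrite -[dstep _]mulr1; apply: is_derive1_comp; first exact: is_derive_step.
    by apply: is_derive_eq; rewrite !addr0.
  have d2 (x : R) : is_derive x 1 (fun y => step (n + 1 - y)) (- dstep (n + 1 - x)).
    rewrite -mulrN1; apply: is_derive1_comp; first exact: is_derive_step.
    by apply: is_derive_eq; rewrite !add0r mul1r.
  apply: CkM; [apply: (Ck1_R d1)|apply: (Ck1_R d2)] => x.
  - apply: (@continuous_comp _ _ _ (fun x => x + n + 1) _ _ _ (@continuous_dstep R _)).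
    by apply: cvgD; [apply: cvgD; [exact: cvg_id|exact: cvg_cst]|exact: cvg_cst].
  - apply: cvgN; apply: (@continuous_comp _ _ _ (fun x => n + 1 - x) _ _ _ (@continuous_dstep R _)).
    by apply: cvgB; [exact: cvg_cst|exact: cvg_id].
have b01 y : 0 <= b y <= 1.
  by rewrite mulr_ge0 ?step_ge0//= mulr_ile1// ?step_ge0 ?step_le1.
have bout y : `|n| + 1 < `|y| -> b y = 0.
  have nn := ler_norm n.
  rewrite /b [in X in X -> _]lter_normr => /orP[h|h].
  - by rewrite [X in _ * X]step0 ?mulr0//; lra.
  - by rewrite [X in X * _]step0 ?mul0r//; lra.
have bin y : `|y| <= n -> b y = 1.
  rewrite ler_norml => /andP[h1 h2]; rewrite /b !step1 ?mulr1//; lra.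
pose psi (x : E2 R) := b x.1 * b x.2.
have Cpsi : Ck 1 psi by apply: CkM; [apply: Ck_fst|apply: Ck_snd].
exists psi; split => //.
- apply: (csupp_test_fun (tame2 R)) => //; split; first exact: Ck_continuous Cpsi.
  exists (`|n| + 1) => x; rewrite prod_normE/= lt_max /psi.
  by move=> /orP[/bout ->|/bout ->]; rewrite ?mul0r ?mulr0.
- move=> x; have /andP[p1 p2] := b01 x.1; have /andP[p3 p4] := b01 x.2.
  by rewrite mulr_ge0//= mulr_ile1.
- by move=> x; rewrite prod_normE/= ge_max /psi => /andP[/bin -> /bin ->]; rewrite mulr1.
Qed.

(** If [h x > 0], a bump supported where [h] is positive gives a nonnegative integrand with zero
    integral, hence zero almost everywhere and, by continuity, at [x]: a contradiction. The other
    sign follows with [- h]. *)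
Lemma fundamental_lemma h : continuous h ->
  (forall psi, test_fun setT psi ->
     \int[leb2]_x (h (id2 x) * psi (id2 x)) = 0) ->
  forall x, h x = 0.
Proof.
gen have pos : h / continuous h ->
  (forall psi, test_fun setT psi ->
     \int[leb2]_x (h (id2 x) * psi (id2 x)) = 0) ->
  forall x, h x <= 0.
  move=> ch h0 x; rewrite leNgt; apply/negP => hx.
  have : \forall y \near x, 0 < h y by exact: (cvgr_gt (h x) (ch x)).
  move=> /nbhs_ballP[e /= e0 eU].
  (* With radius [e / 4] the bump vanishes beyond distance [e / 2], well inside the ball where [h]
     is positive. *)
  have [psi [tpsi psi01 psi_in psi_out]] := square_bump x (divr_gt0 e0 (ltr0n R 4)).
  have ge y : 0 <= h y * psi y.
    have [xy|xy] := ltP (2 * (e / 4)) `|y - x|; first by rewrite psi_out// mulr0.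
    have /andP[p0 _] := psi01 y.
    apply: mulr_ge0 => //; apply: ltW; apply: eU; rewrite -ball_normE /= distrC.
    by apply: le_lt_trans xy _; lra.
  have cs : csupp (fun y => h y * psi y).
    by apply: csuppM => //; exact: test_fun_csupp.
  have : (\int[leb2]_x `|(h (id2 x) * psi (id2 x))%:E| = 0)%E.
    under eq_integral do rewrite gee0_abs ?lee_fin//.
    have := h0 _ tpsi; rewrite /Rintegral => /eqP.
    rewrite fine_eq0 ?(integrable_fin_num _ (csupp_integrable (tame2 R) cs))//.
    by move=> /eqP.
  have mm := measurable_int _ (csupp_integrable (tame2 R) cs).
  move=> /(ae_eq_integral_abs leb2 measurableT mm) ae0.
  have : h x * psi x <= 0.
    apply: (ae_leb2_continuous (f := fun y => h y * psi y)); first by case: cs => /(_ x).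
    by apply: filterS ae0 => y /(_ I) /= [->].
  by rewrite leNgt mulr_gt0// psi_in// subrr normr0; lra.
move=> ch h0 x; apply/eqP; rewrite eq_le pos//= -oppr_le0.
apply: (pos (fun x => - h x)) => [y|psi tpsi].
  by apply: cvgN; exact: ch.
have cs : csupp (fun y => h y * psi y) by apply: csuppM => //; exact: test_fun_csupp.
have := RintegralZl (-1) measurableT (csupp_integrable (tame2 R) cs).
rewrite h0// mulr0 => <-; apply: eq_Rintegral => y _.
by rewrite mulNr mulN1r.
Qed.


(** Equality of distributions between a weak quantity [g] and its classical counterpart [h]. It is
    stable under the linear operations that form covariant derivatives and curvature, so these need
    not be compared almost everywhere. *)
Definition weq (g h : E2 R -> R) := [/\ loc_integrable (@id2 R) leb2 setT g,
  loc_integrable (@id2 R) leb2 setT h &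
  forall psi, test_fun setT psi ->
    \int[leb2]_x (g (id2 x) * psi (id2 x)) = \int[leb2]_x (h (id2 x) * psi (id2 x))].

Lemma weq_refl h : continuous h -> weq h h.
Proof. by move=> ch; split => //; exact: (continuous_loc_integrable (tame2 R)). Qed.

Lemma loc_integrableD g h : loc_integrable (@id2 R) leb2 setT g ->
  loc_integrable (@id2 R) leb2 setT h ->
  loc_integrable (@id2 R) leb2 setT (fun x => g x + h x).
Proof.
move=> lg lh K cK KO; have mK : measurable (@id2 R @^-1` K).
  have -> : @id2 R @^-1` K = ~` (@id2 R @^-1` (~` K)) by rewrite preimage_setC setCK.
  apply: measurableC; apply: (nbase_open_measurable (@nbase2 R)).
  by apply: closed_openC; apply: compact_closed => //; exact: norm_hausdorff.
exact: (integrableD mK (lg K cK KO) (lh K cK KO)).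
Qed.

Lemma loc_integrableZ (c : R) g : loc_integrable (@id2 R) leb2 setT g ->
  loc_integrable (@id2 R) leb2 setT (fun x => c * g x).
Proof.
move=> lg K cK KO; have mK : measurable (@id2 R @^-1` K).
  have -> : @id2 R @^-1` K = ~` (@id2 R @^-1` (~` K)) by rewrite preimage_setC setCK.
  apply: measurableC; apply: (nbase_open_measurable (@nbase2 R)).
  by apply: closed_openC; apply: compact_closed => //; exact: norm_hausdorff.
exact: (integrableZl mK c (lg K cK KO)).
Qed.

Lemma weqD g1 h1 g2 h2 : weq g1 h1 -> weq g2 h2 ->
  weq (fun x => g1 x + g2 x) (fun x => h1 x + h2 x).
Proof.
move=> [lg1 lh1 e1] [lg2 lh2 e2]; split; [exact: loc_integrableD..|].
move=> psi tpsi; have cp := test_fun_csupp tpsi.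
under eq_Rintegral do rewrite mulrDl.
rewrite RintegralD//; [|exact: (loc_integrable_csupp (tame2 R))..].
under [RHS]eq_Rintegral do rewrite mulrDl.
rewrite RintegralD//; [|exact: (loc_integrable_csupp (tame2 R))..].
by rewrite e1// e2.
Qed.

Lemma weqZ (c : R) g h : weq g h -> weq (fun x => c * g x) (fun x => c * h x).
Proof.
move=> [lg lh e]; split; [exact: loc_integrableZ..|].
move=> psi tpsi; have cp := test_fun_csupp tpsi.
under eq_Rintegral do rewrite -mulrA.
rewrite RintegralZl//; last exact: (loc_integrable_csupp (tame2 R)).
under [RHS]eq_Rintegral do rewrite -mulrA.
rewrite RintegralZl//; last exact: (loc_integrable_csupp (tame2 R)).
by rewrite e.
Qed.

(** The integral of the derivative of [f psi] is zero, so the classical derivative of a C^1 function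
    satisfies the integral identity that defines the weak one. *)
Lemma weak_deriv_weq (b : 'I_2) f g : Ck 1 f ->
  weak_deriv (@id2 R) leb2 setT (e2 R b) f g -> weq g (fun x => 'D_(e2 R b) f x).
Proof.
move=> Cf [lf lg efg]; split => //.
  apply: (continuous_loc_integrable (tame2 R)).
  exact: Ck_continuous (Ck_derive (e2 R b) Cf).
move=> psi tpsi; have cp := test_fun_csupp tpsi; have [Cpsi _] := tpsi.
have Cfp : Ck 1 (fun x => f x * psi x) by exact: CkM.
have cfp : csupp (fun x => f x * psi x).
  by apply: csuppM => //; exact: Ck_continuous Cf.
have := Rintegral_derive2 b Cfp cfp.
have E x : 'D_(e2 R b) (fun x => f x * psi x) x =
    f x * 'D_(e2 R b) psi x + 'D_(e2 R b) f x * psi x.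
  have := @deriveM _ _ f psi x (e2 R b).
  rewrite /= => ->; [|exact: Ck_derivable Cf|exact: Ck_derivable Cpsi].
  by rewrite [in X in _ = _ + X]mulrC.
under eq_Rintegral do rewrite E.
have c1 : continuous f by exact: Ck_continuous Cf.
have c2 := Ck_continuous (Ck_derive (e2 R b) Cf).
rewrite RintegralD//; last 2 first.
- exact: (loc_integrable_csupp (tame2 R) (continuous_loc_integrable (tame2 R) c1)
    (csupp_derive _ Cpsi cp)).
- exact: (loc_integrable_csupp (tame2 R) (continuous_loc_integrable (tame2 R) c2) cp).
by have := efg _ tpsi; rewrite preimage_setT => -> /eqP; rewrite addrC subr_eq0 => /eqP.
Qed.

(** The passage from equations satisfied almost everywhere by weak derivatives to equations
    satisfied everywhere by classical ones. *)
Lemma weq_ae0 g h : weq g h -> continuous h ->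
  {ae leb2, forall x, g (id2 x) = 0} -> forall x, h x = 0.
Proof.
move=> [lg lh e] ch g0; apply: fundamental_lemma => // psi tpsi.
rewrite -e// /Rintegral (ae_eq_integral (cst 0)) ?integral_cst//=.
- by rewrite mul0e.
- have ig := loc_integrable_csupp (tame2 R) lg (test_fun_csupp tpsi).
  exact: measurable_int ig.
- by apply: filterS g0 => x -> _; rewrite mul0r.
Qed.

Lemma weq_eq g h g' h' : (forall x, g x = g' x) -> (forall x, h x = h' x) ->
  weq g h -> weq g' h'.
Proof. by move=> /funext -> /funext ->. Qed.

Lemma loc_integrable_measurable g : loc_integrable (@id2 R) leb2 setT g ->
  measurable_fun setT (fun x => g (id2 x)).
Proof.
move=> lg.
have -> : [set: measurableTypeR R * measurableTypeR R] =
    \bigcup_n (@id2 R @^-1` cball (R * R)%type n%:R).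
  apply/seteqP; split => // x _; exists (Num.truncn `|id2 x|).+1 => //=.
  by rewrite /cball/= ltW// truncnS_gt.
apply/measurable_fun_bigcup.
  by move=> n; exact: (tame_measurable_ball (tame2 R)).
move=> n; apply/measurable_EFinP.
have := lg (cball (R * R)%type n%:R) ((tame2 R).2 n%:R).1 (@subsetT _ _).
exact: measurable_int.
Qed.

(* Test the weak identity with [psi = chi h] and use [g h <= (g^2 + h^2) / 2]. *)
Lemma weq_cutoff g h chi : weq g h -> Ck 1 h -> test_fun setT chi ->
  (forall x, 0 <= chi x <= 1) ->
  (\int[leb2]_x (chi (id2 x) * h (id2 x) ^+ 2)%:E <=
   \int[leb2]_x (g (id2 x) ^+ 2)%:E)%E.
Proof.
move=> [lg lh e] Ch tchi chi01.
have mg : measurable_fun setT (fun x => g (id2 x)) by exact: loc_integrable_measurable.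
have mchi : measurable_fun setT (fun x => chi (id2 x)).
  by apply: continuous_measurable2; case: (test_fun_csupp tchi).
have [->|gfin] := eqVneq (\int[leb2]_x (g (id2 x) ^+ 2)%:E)%E +oo%E.
  by rewrite leey.
have ig : leb2.-integrable setT (fun x => (g (id2 x) ^+ 2)%:E).
  apply/integrableP; split; first exact/measurable_EFinP/measurable_funX.
  under eq_integral do rewrite gee0_abs ?lee_fin ?sqr_ge0//.
  by rewrite ltey.
have icg : leb2.-integrable setT (fun x => (chi (id2 x) * g (id2 x) ^+ 2)%:E).
  apply: (le_integrable measurableT _ _ ig).
    by apply/measurable_EFinP; apply: measurable_funM => //; exact: measurable_funX.
  move=> x _ /=; have /andP[c0 c1] := chi01 (id2 x).
  by rewrite lee_fin normrM (ger0_norm c0) ler_piMl.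
have ct := test_fun_csupp tchi; have ch : continuous h by exact: Ck_continuous Ch.
have cch : csupp (fun x => chi x * h x).
  by have := csuppM ch ct; congr csupp; apply/funext => x; rewrite mulrC.
have tch : test_fun setT (fun x => chi x * h x).
  exact: (csupp_test_fun (tame2 R) (CkM (proj1 tchi) Ch) cch).
have ich := loc_integrable_csupp (tame2 R) lh cch.
have igh := loc_integrable_csupp (tame2 R) lg cch.
have ich2 : leb2.-integrable setT (fun x => (chi (id2 x) * h (id2 x) ^+ 2)%:E).
  by apply: eq_integrable ich => // x _; congr EFin; ring.
have E : \int[leb2]_x (chi (id2 x) * h (id2 x) ^+ 2) =
    \int[leb2]_x (g (id2 x) * (chi (id2 x) * h (id2 x))).
  rewrite (e _ tch); apply: eq_Rintegral => x _; ring.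
have L : \int[leb2]_x (g (id2 x) * (chi (id2 x) * h (id2 x))) <=
   \int[leb2]_x (2^-1 * (chi (id2 x) * h (id2 x) ^+ 2) + 2^-1 * (chi (id2 x) * g (id2 x) ^+ 2)).
  apply: le_Rintegral => //.
    by apply: (integrableD measurableT (f := fun x => (2^-1 * (chi (id2 x) * h (id2 x) ^+ 2))%:E)
      (g := fun x => (2^-1 * (chi (id2 x) * g (id2 x) ^+ 2))%:E));
      [exact: (integrableZl measurableT 2^-1 ich2)|exact: (integrableZl measurableT 2^-1 icg)].
  move=> x _; have /andP[c0 _] := chi01 (id2 x).
  have : 0 <= chi (id2 x) * (g (id2 x) - h (id2 x)) ^+ 2 by rewrite mulr_ge0// sqr_ge0.
  nra.
rewrite RintegralD// in L; [|exact: (integrableZl measurableT 2^-1 ich2)|exact: (integrableZl measurableT 2^-1 icg)].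
rewrite !RintegralZl// -E in L.
have L2 : \int[leb2]_x (chi (id2 x) * h (id2 x) ^+ 2) <= \int[leb2]_x (chi (id2 x) * g (id2 x) ^+ 2) by lra.
have F1 : (\int[leb2]_x (chi (id2 x) * h (id2 x) ^+ 2)%:E <=
   \int[leb2]_x (chi (id2 x) * g (id2 x) ^+ 2)%:E)%E.
  rewrite -(fineK (integrable_fin_num measurableT ich2)).
  by rewrite -(fineK (integrable_fin_num measurableT icg)) lee_fin.
apply: le_trans F1 _; apply: ge0_le_integral => //.
- by move=> x _; have /andP[c0 _] := chi01 (id2 x); rewrite lee_fin mulr_ge0// sqr_ge0.
- exact: measurable_int icg.
- exact: measurable_int ig.
- move=> x _; have /andP[c0 c1] := chi01 (id2 x).
  by rewrite lee_fin ler_piMl// sqr_ge0.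
Qed.

(** Monotone convergence as the cutoff of [weq_cutoff] exhausts the plane. Finiteness of the energy
    thus passes from the weak to the classical derivatives by duality, without identifying them
    pointwise. *)
Lemma weq_energy g h : weq g h -> Ck 1 h ->
  (\int[leb2]_x (h (id2 x) ^+ 2)%:E <= \int[leb2]_x (g (id2 x) ^+ 2)%:E)%E.
Proof.
move=> gh Ch; have ch : continuous h by exact: Ck_continuous Ch.
have mh2 : measurable_fun setT (fun x => (h (id2 x) ^+ 2)%:E).
  by apply/measurable_EFinP; apply: measurable_funX; exact: continuous_measurable2.
pose F n := @id2 R @^-1` cball (R * R)%type n%:R.
have FT : \bigcup_n F n = setT.
  apply/seteqP; split => // x _; exists (Num.truncn `|id2 x|).+1 => //=.
  by rewrite /F/= /cball/= ltW// truncnS_gt.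
have mF n : measurable (F n) by exact: (tame_measurable_ball (tame2 R)).
have := @ge0_nondecreasing_set_cvg_integral _ _ _ F (fun x => (h (id2 x) ^+ 2)%:E) leb2.
rewrite FT => cv; have {}cv : (\int[leb2]_(x in F i) (h (id2 x) ^+ 2)%:E @[i --> \oo]
    --> \int[leb2]_x (h (id2 x) ^+ 2)%:E)%E.
  apply: cv => //.
  - move=> n m nm; apply/subsetPset => x; rewrite /F/= /cball/= => /le_trans; apply.
    by rewrite ler_nat.
  - by move=> n; exact: measurable_funTS.
  - by move=> n x _; rewrite lee_fin sqr_ge0.
rewrite -(cvg_lim _ cv)//; apply: lime_le; first by apply/cvg_ex; eexists; exact: cv.
apply: nearW => n.
have [chi [tchi chi01 chi_in]] := unit_cutoff n%:R.
apply: le_trans (weq_cutoff gh Ch tchi chi01).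
rewrite [leLHS]integral_mkcond; apply: ge0_le_integral => //.
- by move=> x _; rewrite patchE; case: ifPn => // _; rewrite lee_fin sqr_ge0.
- exact/(measurable_restrictT _ (mF n))/measurable_funTS.
- apply/measurable_EFinP; apply: measurable_funM; last exact/measurable_EFinP.
  by apply: continuous_measurable2; case: (test_fun_csupp tchi).
- move=> x _; rewrite patchE; case: ifPn.
    by rewrite inE /F/= /cball/= => /chi_in ->; rewrite mul1r.
  by move=> _; have /andP[c0 c1] := chi01 (id2 x); rewrite lee_fin mulr_ge0// sqr_ge0.
Qed.

End WeakDerivative.

(** * Classical Bogomolny configurations *)

Section VortexConfig.
Variable R : realType.
Local Notation leb2 := (leb2 R).
Local Notation M2 := 'rV[R]_4.

Lemma normsqE (z : R[i]) : normsq z = complex.Re z ^+ 2 + complex.Im z ^+ 2.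
Proof.
case: z => x y; rewrite /normsq /ip /=.
by field.
Qed.

Definition edens (a b A0 A1 : E2 R -> R) (x : E2 R) : R :=
  ('D_(1, 0) a x + A0 x * b x) ^+ 2 + ('D_(1, 0) b x - A0 x * a x) ^+ 2
  + ('D_(0, 1) a x + A1 x * b x) ^+ 2 + ('D_(0, 1) b x - A1 x * a x) ^+ 2
  + (a x ^+ 2 + b x ^+ 2 - 1) ^+ 2.

(* [a + i b] is the Higgs field; the first two equations are the real and
   imaginary parts of [(D_1 + i D_2) phi = 0]. *)
Definition vortex_config (a b A0 A1 : E2 R -> R) :=
  [/\ [/\ Ck 2 a, Ck 2 b, Ck 2 A0 & Ck 2 A1],
    forall x, 'D_(1, 0) a x + A0 x * b x - 'D_(0, 1) b x + A1 x * a x = 0,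
    forall x, 'D_(1, 0) b x - A0 x * a x + 'D_(0, 1) a x + A1 x * b x = 0,
    forall x, 'D_(1, 0) A1 x - 'D_(0, 1) A0 x
        + 2^-1 * (a x ^+ 2 + b x ^+ 2 - 1) = 0 &
    (\int[leb2]_x (edens a b A0 A1 (id2 x))%:E < +oo)%E].

Lemma cov_Re (phi : E2 R -> R[i]) A dphi (c : 'I_2) (x : E2 R) :
  complex.Re (cov phi A dphi c x) =
  complex.Re (dphi c x) + A c x * complex.Im (phi x).
Proof.
by rewrite /cov; case: (dphi c x) => u v; case: (phi x) => a b /=; simpc => /=; ring.
Qed.

Lemma cov_Im (phi : E2 R -> R[i]) A dphi (c : 'I_2) (x : E2 R) :
  complex.Im (cov phi A dphi c x) =
  complex.Im (dphi c x) - A c x * complex.Re (phi x).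
Proof.
by rewrite /cov; case: (dphi c x) => u v; case: (phi x) => a b /=; simpc => /=; ring.
Qed.

Lemma bogomolny_Re_Im (u v : R[i]) : u + 'i%C * v = 0 ->
  complex.Re u - complex.Im v = 0 /\ complex.Im u + complex.Re v = 0.
Proof. by case: u => a b; case: v => c d; simpc => /eqP; rewrite eq_complex /= => /andP[/eqP -> /eqP ->]. Qed.

Section FromWeak.
Variables (phi : E2 R -> R[i]) (A : 'I_2 -> E2 R -> R).
Let a x := complex.Re (phi x).
Let b x := complex.Im (phi x).
Hypotheses (Ca : Ck 2 a) (Cb : Ck 2 b) (CA : forall c, Ck 2 (A c)).

Lemma cov_weq dphi dA : h1loc phi A dphi dA -> forall c,
  weq (fun x => complex.Re (cov phi A dphi c x)) (fun x => 'D_(e2 R c) a x + A c x * b x) /\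
  weq (fun x => complex.Im (cov phi A dphi c x)) (fun x => 'D_(e2 R c) b x - A c x * a x).
Proof.
move=> [wphi _ _ _] c; have [w1 w2] := wphi c.
have cc f : Ck 2 f -> continuous (fun x => A c x * f x).
  by move=> Cf; exact: (Ck_continuous (CkM (CA c) Cf)).
split.
- apply: (weq_eq _ _ (weqD (weak_deriv_weq (Ck_le Ca) w1) (weq_refl (cc _ Cb)))) => // x.
  by rewrite cov_Re.
- apply: (weq_eq _ _ (weqD (weak_deriv_weq (Ck_le Cb) w2) (weqZ (-1) (weq_refl (cc _ Ca))))) => // x.
  + by rewrite cov_Im mulN1r.
  + by rewrite mulN1r.
Qed.

(** The hypotheses come with their own weak derivatives, [dphi] and [dphi']. Each is compared with
    the classical derivatives of [a], [b] and [A], so the two need not be compared with each other.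
    The three equations come from [weq_ae0], the energy from [weq_energy]. *)
Lemma vortex_config_of_weak : in_calE2 phi A -> bogomolny phi A ->
  vortex_config a b (A 0) (A 1).
Proof.
move=> [dphi [dA [h1 efin _]]] [dphi' [dA' [h1' bog1 bog2]]].
have cont1 (f : E2 R -> R) v : Ck 2 f -> continuous (fun x => 'D_v f x).
  by move=> Cf; exact: (Ck_continuous (Ck_derive v Cf)).
have contM c (f : E2 R -> R) : Ck 2 f -> continuous (fun x => A c x * f x).
  by move=> Cf; exact: (Ck_continuous (CkM (CA c) Cf)).
have C1 (f : E2 R -> R) v : Ck 2 f -> Ck 1 (fun x => 'D_v f x) by exact: Ck_derive.
split; first (split; [exact: Ca|exact: Cb|exact: CA|exact: CA]).
- have W := weqD (cov_weq h1' 0).1 (weqZ (-1) (cov_weq h1' 1).2).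
  move=> x; rewrite -[RHS](weq_ae0 W _ _ x).
  + rewrite -[(1, 0)]/(e2 R 0) -[(0, 1)]/(e2 R 1); ring.
  + move=> y; apply: cvgD; first by apply: cvgD; [exact: cont1|exact: contM].
    by apply: cvgMr; apply: cvgB; [exact: cont1|exact: contM].
  + by apply: filterS bog1 => y /bogomolny_Re_Im[/= <- _]; rewrite mulN1r.
- have W := weqD (cov_weq h1' 0).2 (cov_weq h1' 1).1.
  move=> x; rewrite -[RHS](weq_ae0 W _ _ x).
  + rewrite -[(1, 0)]/(e2 R 0) -[(0, 1)]/(e2 R 1); ring.
  + move=> y; apply: cvgD; last by apply: cvgD; [exact: cont1|exact: contM].
    by apply: cvgB; [exact: cont1|exact: contM].
  + by apply: filterS bog1 => y /bogomolny_Re_Im[/= _ <-].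
- have [_ wA _ _] := h1'.
  have CW : continuous (fun x => 2^-1 * (a x ^+ 2 + b x ^+ 2 - 1)).
    have Cab : Ck 2 (fun x => 2^-1 * (a x * a x + b x * b x - 1)).
      apply: CkM; first exact: Ck_cst.
      exact: (CkB (CkD (CkM Ca Ca) (CkM Cb Cb)) (Ck_cst _ 2%N 1)).
    exact: (Ck_continuous Cab).
  have W := weqD (weqD (weak_deriv_weq (Ck_le (CA 1)) (wA 0 1))
     (weqZ (-1) (weak_deriv_weq (Ck_le (CA 0)) (wA 1 0)))) (weq_refl CW).
  move=> x; rewrite -[RHS](weq_ae0 W _ _ x).
  + rewrite -[(1, 0)]/(e2 R 0) -[(0, 1)]/(e2 R 1); ring.
  + have CD : Ck 1 (fun y => 'D_(e2 R 0) (A 1) y + -1 * 'D_(e2 R 1) (A 0) y).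
      apply: CkD; first exact: (C1 (A 1) _ (CA 1)).
      by apply: CkM; [exact: Ck_cst|exact: (C1 (A 0) _ (CA 0))].
    by move=> y; apply: cvgD; [exact: (Ck_continuous CD)|exact: CW].
  + by apply: filterS bog2 => y /= <-; rewrite /F12 normsqE mulN1r.
- have meas : measurable_fun setT (fun x => energy_density phi A dphi dA (id2 x)).
    have [wphi wA _ _] := h1.
    have mR c : measurable_fun setT (fun x => complex.Re (cov phi A dphi c (id2 x))).
      by apply: (loc_integrable_measurable (g := fun x => complex.Re (cov phi A dphi c x)));
        case: (cov_weq h1 c).1.
    have mI c : measurable_fun setT (fun x => complex.Im (cov phi A dphi c (id2 x))).
      by apply: (loc_integrable_measurable (g := fun x => complex.Im (cov phi A dphi c x)));
        case: (cov_weq h1 c).2.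
    have mA c c' : measurable_fun setT (fun x => dA c c' (id2 x)).
      by apply: loc_integrable_measurable; case: (wA c c').
    have ma : measurable_fun setT (fun x => a (id2 x)).
      by apply: continuous_measurable2; exact: Ck_continuous Ca.
    have mb : measurable_fun setT (fun x => b (id2 x)).
      by apply: continuous_measurable2; exact: Ck_continuous Cb.
    rewrite (_ : (fun x => _) = fun x => 2^-1 * (\sum_(c < 2)
       (complex.Re (cov phi A dphi c (id2 x)) ^+ 2 + complex.Im (cov phi A dphi c (id2 x)) ^+ 2))
       + 2^-1 * (dA 0 1 (id2 x) - dA 1 0 (id2 x)) ^+ 2
       + 8^-1 * (a (id2 x) ^+ 2 + b (id2 x) ^+ 2 - 1) ^+ 2); last first.
      apply/funext => x; rewrite /energy_density /F12 normsqE; congr (_ * _ + _ + _).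
      by apply: eq_bigr => c _; rewrite normsqE.
    apply: measurable_funD; first apply: measurable_funD.
    + apply: measurable_funM => //; under eq_fun do rewrite big_ord_recl big_ord1.
      by apply: measurable_funD; apply: measurable_funD; apply: measurable_funX.
    + by apply: measurable_funM => //; apply: measurable_funX; exact: measurable_funB.
    + apply: measurable_funM => //; apply: measurable_funX; apply: measurable_funB => //.
      by apply: measurable_funD; apply: measurable_funX.
  have e0 x : 0 <= energy_density phi A dphi dA x.
    have : 0 <= \sum_(c < 2) normsq (cov phi A dphi c x).
      by apply: sumr_ge0 => c _; rewrite normsqE addr_ge0 ?sqr_ge0.
    have := sqr_ge0 (F12 dA x); have := sqr_ge0 (normsq (phi x) - 1).
    by rewrite /energy_density; lra.
  (* The factor 8 clears the smallest coefficient in the energy density, the one of the potential,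
     so one bound serves all five squares. *)
  have bound (g : E2 R -> R) : measurable_fun setT (fun x => g (id2 x)) ->
     (forall x, g x ^+ 2 <= 8 * energy_density phi A dphi dA x) ->
     (\int[leb2]_x (g (id2 x) ^+ 2)%:E < +oo)%E.
    move=> mg ge; apply: (@le_lt_trans _ _
      (\int[leb2]_x (8%:E * (energy_density phi A dphi dA (id2 x))%:E))%E).
      apply: ge0_le_integral => //.
      - by move=> x _; rewrite lee_fin sqr_ge0.
      - by apply/measurable_EFinP; exact: measurable_funX.
      - by apply/measurable_EFinP; exact: measurable_funM.
      - by move=> x _; rewrite -EFinM lee_fin.
    rewrite ge0_integralZl//; last 2 first.
    - exact/measurable_EFinP.
    - by move=> x _; rewrite lee_fin.
    by rewrite lte_mul_pinfty// lee_fin.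
  have covb c x : complex.Re (cov phi A dphi c x) ^+ 2 + complex.Im (cov phi A dphi c x) ^+ 2
      <= 8 * energy_density phi A dphi dA x.
    have h : complex.Re (cov phi A dphi c x) ^+ 2 + complex.Im (cov phi A dphi c x) ^+ 2 <=
        \sum_(c < 2) normsq (cov phi A dphi c x).
      rewrite -normsqE (bigD1 c)//= lerDl sumr_ge0// => d _.
      by rewrite normsqE addr_ge0 ?sqr_ge0.
    rewrite /energy_density; set S := \sum_(_ < 2) _ in h *.
    have := sqr_ge0 (F12 dA x); have := sqr_ge0 (normsq (phi x) - 1).
    have : 0 <= S.
      by apply: sumr_ge0 => d _; rewrite normsqE addr_ge0 ?sqr_ge0.
    by lra.
  have fin c : (\int[leb2]_x (('D_(e2 R c) a (id2 x) + A c (id2 x) * b (id2 x)) ^+ 2)%:E < +oo)%E /\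
      (\int[leb2]_x (('D_(e2 R c) b (id2 x) - A c (id2 x) * a (id2 x)) ^+ 2)%:E < +oo)%E.
    have [W1 W2] := cov_weq h1 c; split.
    - apply: le_lt_trans (weq_energy W1 _) _.
        exact: (CkD (C1 _ _ Ca) (Ck_le (CkM (CA c) Cb))).
      apply: (bound (fun x => complex.Re (cov phi A dphi c x))).
        by apply: (loc_integrable_measurable (g := fun x => complex.Re (cov phi A dphi c x))); case: W1.
      by move=> x; apply: le_trans (covb c x); rewrite lerDl sqr_ge0.
    - apply: le_lt_trans (weq_energy W2 _) _.
        exact: (CkB (C1 _ _ Cb) (Ck_le (CkM (CA c) Ca))).
      apply: (bound (fun x => complex.Im (cov phi A dphi c x))).
        by apply: (loc_integrable_measurable (g := fun x => complex.Im (cov phi A dphi c x))); case: W2.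
      by move=> x; apply: le_trans (covb c x); rewrite lerDr sqr_ge0.
  have Cu : Ck 2 (fun x => a x * a x + b x * b x - 1).
    exact: (CkB (CkD (CkM Ca Ca) (CkM Cb Cb)) (Ck_cst _ 2%N 1)).
  have finu : (\int[leb2]_x ((a (id2 x) ^+ 2 + b (id2 x) ^+ 2 - 1) ^+ 2)%:E < +oo)%E.
    apply: (bound (fun x => a x * a x + b x * b x - 1)).
      by apply: (continuous_measurable2 (f := fun x => a x * a x + b x * b x - 1));
        exact: Ck_continuous Cu.
    move=> x; rewrite /energy_density normsqE -!expr2.
    have := sqr_ge0 (F12 dA x).
    have : 0 <= \sum_(c < 2) normsq (cov phi A dphi c x).
      by apply: sumr_ge0 => d _; rewrite normsqE addr_ge0 ?sqr_ge0.
    by lra.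
  have add (f g : E2 R -> R) : continuous f -> continuous g ->
     (forall x, 0 <= f x) -> (forall x, 0 <= g x) ->
     (\int[leb2]_x (f (id2 x))%:E < +oo)%E -> (\int[leb2]_x (g (id2 x))%:E < +oo)%E ->
     (\int[leb2]_x (f (id2 x) + g (id2 x))%:E < +oo)%E.
    move=> cf cg f0 g0 ff gf; under eq_integral do rewrite EFinD.
    rewrite ge0_integralD//; last 4 first.
    - by move=> x _; rewrite lee_fin.
    - by apply/measurable_EFinP; exact: continuous_measurable2.
    - by move=> x _; rewrite lee_fin.
    - by apply/measurable_EFinP; exact: continuous_measurable2.
    by rewrite lte_add_pinfty.
  have csq (f : E2 R -> R) : continuous f -> continuous (fun x => f x ^+ 2).
    move=> cf; have -> : (fun x => f x ^+ 2) = (fun x => f x * f x) by apply/funext => x; rewrite expr2.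
    by move=> x; apply: cvgM; exact: cf.
  have cD f g : continuous f -> continuous g -> continuous (fun x : E2 R => f x + g x : R).
    by move=> cf cg x; apply: cvgD; [exact: cf|exact: cg].
  have cF c : continuous (fun x => ('D_(e2 R c) a x + A c x * b x) ^+ 2).
    by apply: csq; apply: cD; [exact: (cont1 _ _ Ca)|exact: (contM c _ Cb)].
  have cG c : continuous (fun x => ('D_(e2 R c) b x - A c x * a x) ^+ 2).
    by apply: csq => x; apply: cvgB; [exact: (cont1 _ _ Cb)|exact: (contM c _ Ca)].
  have cU : continuous (fun x => (a x ^+ 2 + b x ^+ 2 - 1) ^+ 2).
    by apply: csq; exact: (Ck_continuous Cu).
  have sq0 (f : E2 R -> R) x : 0 <= f x ^+ 2 by exact: sqr_ge0.
  have [p1 p2] := fin 0; have [p3 p4] := fin 1.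
  apply: (add (fun x => ('D_(e2 R 0) a x + A 0 x * b x) ^+ 2 + ('D_(e2 R 0) b x - A 0 x * a x) ^+ 2
    + ('D_(e2 R 1) a x + A 1 x * b x) ^+ 2 + ('D_(e2 R 1) b x - A 1 x * a x) ^+ 2)
    (fun x => (a x ^+ 2 + b x ^+ 2 - 1) ^+ 2)) => //.
  + exact: (cD _ _ (cD _ _ (cD _ _ (cF 0) (cG 0)) (cF 1)) (cG 1)).
  + by move=> x; rewrite !addr_ge0 ?sqr_ge0.
  + by move=> x; exact: sqr_ge0.
  apply: (add (fun x => ('D_(e2 R 0) a x + A 0 x * b x) ^+ 2 + ('D_(e2 R 0) b x - A 0 x * a x) ^+ 2
    + ('D_(e2 R 1) a x + A 1 x * b x) ^+ 2) (fun x => ('D_(e2 R 1) b x - A 1 x * a x) ^+ 2)) => //.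
  + exact: (cD _ _ (cD _ _ (cF 0) (cG 0)) (cF 1)).
  + by move=> x; rewrite !addr_ge0 ?sqr_ge0.
  + by move=> x; exact: sqr_ge0.
  apply: (add (fun x => ('D_(e2 R 0) a x + A 0 x * b x) ^+ 2 + ('D_(e2 R 0) b x - A 0 x * a x) ^+ 2)
     (fun x => ('D_(e2 R 1) a x + A 1 x * b x) ^+ 2)) => //.
  + exact: (cD _ _ (cF 0) (cG 0)).
  + by move=> x; rewrite !addr_ge0 ?sqr_ge0.
  + by move=> x; exact: sqr_ge0.
  apply: (add (fun x => ('D_(e2 R 0) a x + A 0 x * b x) ^+ 2)
     (fun x => ('D_(e2 R 0) b x - A 0 x * a x) ^+ 2)) => //.
  + by move=> x; exact: sqr_ge0.
  + by move=> x; exact: sqr_ge0.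
Qed.

End FromWeak.

Lemma vortex_family_config (phi : M2 -> E2 R -> R[i]) (A : M2 -> 'I_2 -> E2 R -> R)
    (q : M2) : vortex_family phi A ->
  vortex_config (fun x => complex.Re (phi q x)) (fun x => complex.Im (phi q x))
    (A q 0) (A q 1).
Proof.
move=> [H [sR sI sA]]; have [H1 H2 _] := H q.
apply: vortex_config_of_weak => //.
- exact: (Ck_section q (sR 2%N)).
- exact: (Ck_section q (sI 2%N)).
- by move=> c; exact: (Ck_section q (sA c 2%N)).
Qed.

End VortexConfig.

(** * The ratio of p to phi *)

Lemma section_derive1 (R : realType) (f : E2 R -> R) (x y : R) : Ck 1 f ->
  is_derive x 1 (fun t => f (t, y)) ('D_(1, 0) f (x, y)).
Proof.
move=> Cf; have [h1 h2] := derive_section f y 1 x.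
by apply: DeriveDef; [apply/h1; exact: Ck_derivable Cf|rewrite h2].
Qed.

Lemma section_derive2 (R : realType) (f : E2 R -> R) (x y : R) : Ck 1 f ->
  is_derive y 1 (fun t => f (x, t)) ('D_(0, 1) f (x, y)).
Proof.
move=> Cf; have [h1 h2] := derive_section2 f x 1 y.
by apply: DeriveDef; [apply/h1; exact: Ck_derivable Cf|rewrite h2].
Qed.

Lemma is_derive_unique (R : realType) (f : R -> R) (x d d' : R) :
  is_derive x 1 f d -> is_derive x 1 f d' -> d = d'.
Proof. by move=> /@derive_val <- /@derive_val <-. Qed.

Lemma MVT_bound (R : realType) (f df : R -> R) (a b M : R) :
  (forall x, Num.min a b <= x <= Num.max a b -> is_derive x 1 f (df x)) ->
  (forall x, Num.min a b <= x <= Num.max a b -> `|df x| <= M) ->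
  `|f b - f a| <= M * `|b - a|.
Proof.
wlog ab : a b / a <= b => [W|] hd hM.
  have [ab|ba] := leP a b; first exact: W.
  rewrite distrC [in leRHS]distrC; apply: W; first exact: ltW.
  - by move=> x; rewrite minC maxC; exact: hd.
  - by move=> x; rewrite minC maxC; exact: hM.
rewrite (min_idPl ab) (max_idPr ab) in hd hM.
have [||c cab ->] := @MVT_segment _ f df a b ab.
- by move=> x xab; apply: hd; rewrite !ltW// (itvP xab).
- apply: derivable_within_continuous => x xab.
  by have [] := hd x; rewrite ?(itvP xab).
- by rewrite normrM ler_wpM2r// hM// (itvP cab).
Qed.

(** Of the three distinct numbers [e / 2], [e / 3], [e / 4], two forbidden values leave at least
    one. Used to move a point off the coordinates of both roots. *)
Lemma avoid2 (R : realFieldType) (e u v : R) : 0 < e ->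
  exists d, [/\ 0 < d < e, d != u & d != v].
Proof.
move=> e0.
have [h1|/negP h1] := boolP ((e / 2 != u) && (e / 2 != v)).
  by exists (e / 2); case/andP: h1; split => //; lra.
have [h2|/negP h2] := boolP ((e / 3 != u) && (e / 3 != v)).
  by exists (e / 3); case/andP: h2; split => //; lra.
exists (e / 4); split; first lra.
- apply/eqP => h; apply: h2; rewrite -h; apply/andP; split; first by apply/eqP; lra.
  apply/eqP => h3; apply: h1; rewrite -h3 -h; apply/andP; split; apply/eqP; lra.
- apply/eqP => h; apply: h2; rewrite -h; apply/andP; split; last by apply/eqP; lra.
  apply/eqP => h3; apply: h1; rewrite -h3 -h; apply/andP; split; apply/eqP; lra.
Qed.

Lemma expR_lip (R : realType) (s t k : R) : s <= k -> t <= k ->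
  `|expR s - expR t| <= expR k * `|s - t|.
Proof.
wlog st : s t / t <= s => [W|] sk tk.
  have [ts|st] := leP t s; first exact: W.
  by rewrite distrC [in leRHS]distrC; apply: W => //; exact: ltW.
rewrite !ger0_norm ?subr_ge0 ?ler_expR//.
have := expR_ge1Dx (t - s); rewrite expRD => h.
have : expR s * (1 + (t - s)) <= expR t.
  have := ler_wpM2l (expR_ge0 s) h; rewrite mulrCA -expRD subrr expR0 mulr1.
  by [].
have : expR s * (s - t) <= expR k * (s - t).
  by rewrite ler_wpM2r ?subr_ge0// ler_expR.
by lra.
Qed.

Section LogFactor.
Variable R : realType.
Variables (a b A0 A1 : E2 R -> R) (r1 r2 s1 s2 : R) (g : E2 R -> R).

(** Real and imaginary parts of (z - r)(z - s) for r = r1 + i r2, s = s1 + i s2; [distsq] is |z -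
    r|^2, so |p|^2 is a product of two [distsq]. *)
Definition polyRe (r1 r2 s1 s2 : R) (x : E2 R) : R :=
  (x.1 - r1) * (x.1 - s1) - (x.2 - r2) * (x.2 - s2).
Definition polyIm (r1 r2 s1 s2 : R) (x : E2 R) : R :=
  (x.1 - r1) * (x.2 - s2) + (x.2 - r2) * (x.1 - s1).
Definition distsq (r1 r2 : R) (x : E2 R) : R := (x.1 - r1) ^+ 2 + (x.2 - r2) ^+ 2.

Lemma continuous_polyRe (p1 p2 q1 q2 : R) : continuous (polyRe p1 p2 q1 q2).
Proof.
move=> x; apply: cvgB; apply: cvgM; apply: cvgB;
  (exact: cvg_cst || exact: cvg_fst || exact: cvg_snd).
Qed.

Lemma continuous_polyIm (p1 p2 q1 q2 : R) : continuous (polyIm p1 p2 q1 q2).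
Proof.
move=> x; apply: cvgD; apply: cvgM; apply: cvgB;
  (exact: cvg_cst || exact: cvg_fst || exact: cvg_snd).
Qed.

Let P := polyRe r1 r2 s1 s2.
Let Q := polyIm r1 r2 s1 s2.
Let N (x : E2 R) := distsq r1 r2 x * distsq s1 s2 x.

Hypothesis cfg : vortex_config a b A0 A1.
Hypothesis g0 : forall x, 0 < g x.
Hypothesis ag : forall x, a x = g x * P x.
Hypothesis bg : forall x, b x = g x * Q x.

Let NE x : N x = P x ^+ 2 + Q x ^+ 2.
Proof. by rewrite /N /P /Q /polyRe /polyIm /distsq; ring. Qed.

Definition usq (x : E2 R) := a x ^+ 2 + b x ^+ 2.

Let uE x : usq x = g x ^+ 2 * N x.
Proof. by rewrite /usq ag bg NE; ring. Qed.

Let N_ge0 x : 0 <= N x.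
Proof. by rewrite NE addr_ge0 ?sqr_ge0. Qed.

Let u_gt0 x : N x != 0 -> 0 < usq x.
Proof. by move=> N0; rewrite uE mulr_gt0 ?exprn_gt0// lt_neqAle eq_sym N0 N_ge0. Qed.

(** log (|phi| / |p|), that is log g off the roots. It is written through |phi|^2 and |p|^2 because
    these are differentiable by construction, while nothing is known about derivatives of [g]. *)
Definition logmod (x : E2 R) := 2^-1 * (ln (usq x) - ln (N x)).

Let Ca : Ck 1 a. Proof. by have [[Ca _ _ _] _ _ _ _] := cfg; exact: Ck_le Ca. Qed.
Let Cb : Ck 1 b. Proof. by have [[_ Cb _ _] _ _ _ _] := cfg; exact: Ck_le Cb. Qed.

Let dP1 (x y : R) : is_derive x 1 (fun t => P (t, y)) ((x - s1) + (x - r1)).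
Proof. by rewrite /P /polyRe /=; apply: is_derive_eq; rewrite /GRing.scale/=; ring. Qed.
Let dQ1 (x y : R) : is_derive x 1 (fun t => Q (t, y)) ((y - s2) + (y - r2)).
Proof. by rewrite /Q /polyIm /=; apply: is_derive_eq; rewrite /GRing.scale/=; ring. Qed.
Let dP2 (x y : R) : is_derive y 1 (fun t => P (x, t)) (- (y - s2) - (y - r2)).
Proof. by rewrite /P /polyRe /=; apply: is_derive_eq; rewrite /GRing.scale/=; ring. Qed.
Let dQ2 (x y : R) : is_derive y 1 (fun t => Q (x, t)) ((x - r1) + (x - s1)).
Proof. by rewrite /Q /polyIm /=; apply: is_derive_eq; rewrite /GRing.scale/=; ring. Qed.

(** phi is a real multiple of p, so [a Q - b P] vanishes identically. Differentiating this identity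
    expresses that g is real without differentiating g. *)
Let phase1 (x y : R) : 'D_(1, 0) a (x, y) * Q (x, y) + a (x, y) * ((y - s2) + (y - r2))
  - 'D_(1, 0) b (x, y) * P (x, y) - b (x, y) * ((x - s1) + (x - r1)) = 0.
Proof.
have d1 := section_derive1 x y Ca; have d2 := section_derive1 x y Cb.
have dp := dP1 x y; have dq := dQ1 x y.
have d : is_derive x 1 (fun t => a (t, y) * Q (t, y) - b (t, y) * P (t, y))
  ('D_(1, 0) a (x, y) * Q (x, y) + a (x, y) * ((y - s2) + (y - r2))
  - 'D_(1, 0) b (x, y) * P (x, y) - b (x, y) * ((x - s1) + (x - r1))).
  by apply: is_derive_eq; rewrite /GRing.scale/=; ring.
apply: (is_derive_unique d).
have -> : (fun t => a (t, y) * Q (t, y) - b (t, y) * P (t, y)) = (fun=> 0).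
  by apply/funext => t; rewrite ag bg; ring.
exact: is_derive_cst.
Qed.

Let phase2 (x y : R) : 'D_(0, 1) a (x, y) * Q (x, y) + a (x, y) * ((x - r1) + (x - s1))
  - 'D_(0, 1) b (x, y) * P (x, y) - b (x, y) * (- (y - s2) - (y - r2)) = 0.
Proof.
have d1 := section_derive2 x y Ca; have d2 := section_derive2 x y Cb.
have dp := dP2 x y; have dq := dQ2 x y.
have d : is_derive y 1 (fun t => a (x, t) * Q (x, t) - b (x, t) * P (x, t))
  ('D_(0, 1) a (x, y) * Q (x, y) + a (x, y) * ((x - r1) + (x - s1))
  - 'D_(0, 1) b (x, y) * P (x, y) - b (x, y) * (- (y - s2) - (y - r2))).
  by apply: is_derive_eq; rewrite /GRing.scale/=; ring.
apply: (is_derive_unique d).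
have -> : (fun t => a (x, t) * Q (x, t) - b (x, t) * P (x, t)) = (fun=> 0).
  by apply/funext => t; rewrite ag bg; ring.
exact: is_derive_cst.
Qed.

Let bog_re (p r t v : R) : p + r - t + v = 0 -> t = p + r + v.
Proof. lra. Qed.
Let bog_im (p r t v : R) : p - r + t + v = 0 -> t = - p + r - v.
Proof. lra. Qed.

(* [g = |phi| / |p|] is real, so the Bogomolny equation for [phi = g p] reduces
   to [d_1 log g = - A_2], [d_2 log g = A_1]. *)
Lemma is_derive_logmod1 (x y : R) : N (x, y) != 0 ->
  is_derive x 1 (fun t => logmod (t, y)) (- A1 (x, y)).
Proof.
move=> N0; have u0 := u_gt0 N0; have Np : 0 < N (x, y) by rewrite lt_neqAle eq_sym N0 N_ge0.
have d1 := section_derive1 x y Ca; have d2 := section_derive1 x y Cb.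
have dp := dP1 x y; have dq := dQ1 x y.
have du : is_derive x 1 (fun t => usq (t, y))
    (2 * (a (x, y) * 'D_(1, 0) a (x, y) + b (x, y) * 'D_(1, 0) b (x, y))).
  by apply: is_derive_eq; rewrite /GRing.scale/=; ring.
have dN : is_derive x 1 (fun t => N (t, y))
    (2 * (P (x, y) * ((x - s1) + (x - r1)) + Q (x, y) * ((y - s2) + (y - r2)))).
  have -> : (fun t => N (t, y)) = (fun t => P (t, y) ^+ 2 + Q (t, y) ^+ 2).
    by apply/funext => t; exact: NE.
  by apply: is_derive_eq; rewrite /GRing.scale/=; ring.
have dlu := @is_derive1_comp _ (@ln R) (fun t => usq (t, y)) x _ _ (is_derive1_ln u0) du.
have dlN := @is_derive1_comp _ (@ln R) (fun t => N (t, y)) x _ _ (is_derive1_ln Np) dN.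
have dL : is_derive x 1 (fun t => 2^-1 * ((@ln R \o (fun t => usq (t, y))) t - (@ln R \o (fun t => N (t, y))) t)) (- A1 (x, y)); last exact: dL.
apply: is_derive_eq; rewrite /GRing.scale/=.
have [_ B1 B2 _ _] := cfg.
have := B1 (x, y); have := B2 (x, y); have := phase2 x y.
have gx := g0 (x, y); rewrite uE.
have := NE (x, y); rewrite !ag !bg => NEx p2 b2 b1.
(* The Bogomolny equations replace the derivatives along the second axis in [phase2] by derivatives
   along the first one. *)
have key : P (x, y) * 'D_(1, 0) a (x, y) + Q (x, y) * 'D_(1, 0) b (x, y) =
  - A1 (x, y) * g (x, y) * N (x, y) + g (x, y) * (P (x, y) * ((x - s1) + (x - r1)) + Q (x, y) * ((y - s2) + (y - r2))).
  have e2 : 'D_(0, 1) b (x, y) = 'D_(1, 0) a (x, y) + A0 (x, y) * (g (x, y) * Q (x, y)) + A1 (x, y) * (g (x, y) * P (x, y)) := bog_re b1.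
  have e1 : 'D_(0, 1) a (x, y) = - 'D_(1, 0) b (x, y) + A0 (x, y) * (g (x, y) * P (x, y)) - A1 (x, y) * (g (x, y) * Q (x, y)) := bog_im b2.
  by move: p2; rewrite e1 e2 NEx => p2; apply/eqP; rewrite -subr_eq0 -[X in _ == X]oppr0 -{3}p2; apply/eqP; ring.
rewrite (_ : g (x, y) * P (x, y) * 'D_(1, 0) a (x, y) + g (x, y) * Q (x, y) * 'D_(1, 0) b (x, y)
   = g (x, y) * (P (x, y) * 'D_(1, 0) a (x, y) + Q (x, y) * 'D_(1, 0) b (x, y))); last ring.
rewrite key; field.
by rewrite N0 gt_eqF.
Qed.

Lemma is_derive_logmod2 (x y : R) : N (x, y) != 0 ->
  is_derive y 1 (fun t => logmod (x, t)) (A0 (x, y)).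
Proof.
move=> N0; have u0 := u_gt0 N0; have Np : 0 < N (x, y) by rewrite lt_neqAle eq_sym N0 N_ge0.
have d1 := section_derive2 x y Ca; have d2 := section_derive2 x y Cb.
have dp := dP2 x y; have dq := dQ2 x y.
have du : is_derive y 1 (fun t => usq (x, t))
    (2 * (a (x, y) * 'D_(0, 1) a (x, y) + b (x, y) * 'D_(0, 1) b (x, y))).
  by apply: is_derive_eq; rewrite /GRing.scale/=; ring.
have dN : is_derive y 1 (fun t => N (x, t))
    (2 * (P (x, y) * (- (y - s2) - (y - r2)) + Q (x, y) * ((x - r1) + (x - s1)))).
  have -> : (fun t => N (x, t)) = (fun t => P (x, t) ^+ 2 + Q (x, t) ^+ 2).
    by apply/funext => t; exact: NE.
  by apply: is_derive_eq; rewrite /GRing.scale/=; ring.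
have dlu := @is_derive1_comp _ (@ln R) (fun t => usq (x, t)) y _ _ (is_derive1_ln u0) du.
have dlN := @is_derive1_comp _ (@ln R) (fun t => N (x, t)) y _ _ (is_derive1_ln Np) dN.
have dL : is_derive y 1 (fun t => 2^-1 * ((@ln R \o (fun t => usq (x, t))) t - (@ln R \o (fun t => N (x, t))) t)) (A0 (x, y)); last exact: dL.
apply: is_derive_eq; rewrite /GRing.scale/=.
have [_ B1 B2 _ _] := cfg.
have := B1 (x, y); have := B2 (x, y); have := phase1 x y.
have gx := g0 (x, y); rewrite uE.
have := NE (x, y); rewrite !ag !bg => NEx p2 b2 b1.
have key : P (x, y) * 'D_(0, 1) a (x, y) + Q (x, y) * 'D_(0, 1) b (x, y) =
  A0 (x, y) * g (x, y) * N (x, y) + g (x, y) * (P (x, y) * (- (y - s2) - (y - r2)) + Q (x, y) * ((x - r1) + (x - s1))).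
  have e2 : 'D_(0, 1) b (x, y) = 'D_(1, 0) a (x, y) + A0 (x, y) * (g (x, y) * Q (x, y)) + A1 (x, y) * (g (x, y) * P (x, y)) := bog_re b1.
  have e1 : 'D_(0, 1) a (x, y) = - 'D_(1, 0) b (x, y) + A0 (x, y) * (g (x, y) * P (x, y)) - A1 (x, y) * (g (x, y) * Q (x, y)) := bog_im b2.
  by rewrite e1 e2 NEx; apply/eqP; rewrite -subr_eq0 -[X in _ == X]p2; apply/eqP; ring.
rewrite (_ : g (x, y) * P (x, y) * 'D_(0, 1) a (x, y) + g (x, y) * Q (x, y) * 'D_(0, 1) b (x, y)
   = g (x, y) * (P (x, y) * 'D_(0, 1) a (x, y) + Q (x, y) * 'D_(0, 1) b (x, y))); last ring.
rewrite key; field.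
by rewrite N0 gt_eqF.
Qed.

Definition generic (x : E2 R) :=
  [/\ x.1 != r1, x.1 != s1, x.2 != r2 & x.2 != s2].

Let N_neq0l x : x.1 != r1 -> x.1 != s1 -> N x != 0.
Proof.
move=> h1 h2; rewrite /N /distsq mulf_neq0// paddr_eq0 ?sqr_ge0//.
  by rewrite sqrf_eq0 subr_eq0 (negbTE h1).
by rewrite sqrf_eq0 subr_eq0 (negbTE h2).
Qed.

Let N_neq0r x : x.2 != r2 -> x.2 != s2 -> N x != 0.
Proof.
move=> h1 h2; rewrite /N /distsq mulf_neq0// paddr_eq0 ?sqr_ge0//.
  by rewrite !sqrf_eq0 !subr_eq0 (negbTE h1) andbF.
by rewrite !sqrf_eq0 !subr_eq0 (negbTE h2) andbF.
Qed.

Lemma between_norm (t u v n : R) : `|u| <= n -> `|v| <= n ->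
  Num.min u v <= t <= Num.max u v -> `|t| <= n.
Proof.
rewrite !ler_norml => /andP[u1 u2] /andP[v1 v2] /andP[t1 t2]; apply/andP; split.
  by apply: le_trans t1; rewrite le_min u1.
by apply: le_trans t2 _; rewrite ge_max u2.
Qed.

(** The path goes horizontally to the corner [(y1, x2)] and then vertically. The first segment keeps
    the ordinate of a generic point and the second the abscissa of one, so both miss the roots, and
    the mean value theorem applies with the components of the connection as derivatives. *)
Lemma logmod_lip (n M : R) :
  (forall x, `|x| <= n -> `|A0 x| <= M) -> (forall x, `|x| <= n -> `|A1 x| <= M) ->
  forall x x', `|x| <= n -> `|x'| <= n -> generic x -> generic x' ->
  `|logmod x' - logmod x| <= M * (`|x'.1 - x.1| + `|x'.2 - x.2|).
Proof.
move=> h0 h1 [x1 x2] [y1 y2] + + [/= gx1 gx2 gx3 gx4] [/= gy1 gy2 gy3 gy4].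
rewrite !prod_normE /= !ge_max => /andP[nx1 nx2] /andP[ny1 ny2].
have st1 : `|logmod (y1, x2) - logmod (x1, x2)| <= M * `|y1 - x1|.
  apply: (MVT_bound (f := fun t => logmod (t, x2)) (df := fun t => - A1 (t, x2))).
    by move=> t _; apply: is_derive_logmod1; exact: N_neq0r.
  move=> t ht; rewrite normrN; apply: h1.
  by rewrite prod_normE/= ge_max nx2 andbT (between_norm nx1 ny1).
have st2 : `|logmod (y1, y2) - logmod (y1, x2)| <= M * `|y2 - x2|.
  apply: (MVT_bound (f := fun t => logmod (y1, t)) (df := fun t => A0 (y1, t))).
    by move=> t _; apply: is_derive_logmod2; exact: N_neq0l.
  move=> t ht; apply: h0.
  by rewrite prod_normE/= ge_max ny1/= (between_norm nx2 ny2).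
rewrite mulrDr; apply: le_trans (lerD st1 st2).
have -> : logmod (y1, y2) - logmod (x1, x2) = (logmod (y1, x2) - logmod (x1, x2)) + (logmod (y1, y2) - logmod (y1, x2)) by lra.
exact: ler_normD.
Qed.

Lemma logmod_generic x : generic x -> expR (- logmod x) * a x = P x /\ expR (- logmod x) * b x = Q x.
Proof.
move=> [h1 h2 _ _]; have N0 := N_neq0l h1 h2; have u0 := u_gt0 N0.
have Np : 0 < N x by rewrite lt_neqAle eq_sym N0 N_ge0.
have -> : - logmod x = - ln (g x).
  have -> : logmod x = ln (g x); last by [].
  by rewrite /logmod uE lnM ?posrE ?exprn_gt0// lnXn// -mulr_natl; field.
by rewrite expRN lnK ?posrE// ag bg !mulKf// gt_eqF.
Qed.

(* McShane extension of [- log g] from the generic points, where no zero of [p]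
   obstructs the axis-parallel paths. *)
Lemma log_factor (n M kappa : R) (x0 : E2 R) :
  (forall x, `|x| <= n -> `|A0 x| <= M) -> (forall x, `|x| <= n -> `|A1 x| <= M) ->
  `|x0| <= n -> generic x0 -> - logmod x0 <= kappa ->
  exists E : E2 R -> R,
    [/\ forall x, `|x| <= n -> 0 < E x <= expR (kappa + 4 * M * n),
        forall x, `|x| < n -> E x * a x = P x /\ E x * b x = Q x &
        forall x x', `|x| <= n -> `|x'| <= n -> `|E x' - E x| <=
          expR (kappa + 4 * M * n) * M * (`|x'.1 - x.1| + `|x'.2 - x.2|)].
Proof.
move=> h0 h1 nx0 gx0 hk.
have n0 : 0 <= n by exact: le_trans nx0.
have M0 : 0 <= M by exact: le_trans (h0 x0 nx0).
pose d (x y : E2 R) := `|x.1 - y.1| + `|x.2 - y.2|.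
have dtri x y z : d x z <= d x y + d y z.
  rewrite /d; have := ler_distD y.1 x.1 z.1; have := ler_distD y.2 x.2 z.2; lra.
have dC x y : d x y = d y x by rewrite /d distrC [X in _ + X]distrC.
(* The square of half-side [n] has diameter [4 * n] for the distance [d]: this is the origin of
   [4 * M * n] in the exponent. *)
have dn x y : `|x| <= n -> `|y| <= n -> d x y <= 4 * n.
  rewrite !prod_normE /= !ge_max => /andP[nx1 nx2] /andP[ny1 ny2].
  have := ler_normB x.1 y.1; have := ler_normB x.2 y.2; rewrite /d; lra.
have Llip x y : `|x| <= n -> `|y| <= n -> generic x -> generic y ->
    `|logmod y - logmod x| <= M * d y x by exact: logmod_lip.
pose S (x : E2 R) := [set - logmod w + M * d x w | w in [set w | `|w| <= n /\ generic w]].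
pose H x := inf (S x).
have lbS x y : `|x| <= n -> S x y -> - logmod x0 - M * d x x0 <= y.
  move=> nx [w [nw gw] <-]; have := Llip _ _ nw nx0 gw gx0.
  rewrite ler_norml => /andP[h _].
  have t : M * d w x0 <= M * d x w + M * d x x0.
    by rewrite -mulrDr (dC x w); apply: ler_wpM2l.
  by move: h; rewrite (dC x0 w); lra.
have S0 x : S x !=set0 by exists (- logmod x0 + M * d x x0); exists x0.
have infS x : `|x| <= n -> has_inf (S x).
  by move=> nx; split => //; exists (- logmod x0 - M * d x x0) => y; exact: lbS.
have Hle x : `|x| <= n -> H x <= - logmod x0 + M * d x x0.
  by move=> nx; apply: ge_inf; [exact: (infS x nx).2|exists x0].
have Hlip x y : `|x| <= n -> `|y| <= n -> H y <= H x + M * d y x.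
  move=> nx ny; rewrite -lerBlDr; apply: lb_le_inf => // _ [w [nw gw] <-].
  rewrite lerBlDr; apply: (@le_trans _ _ (- logmod w + M * d y w)).
    by apply: ge_inf; [exact: (infS y ny).2|exists w].
  by rewrite -addrA lerD2l -mulrDr ler_wpM2l// [X in _ <= X]addrC.
have Hgen x : `|x| <= n -> generic x -> H x = - logmod x.
  move=> nx gx; apply/eqP; rewrite eq_le; apply/andP; split.
    apply: ge_inf; first exact: (infS x nx).2.
    by exists x => //; rewrite /d !subrr normr0 addr0 mulr0 addr0.
  apply: lb_le_inf => // _ [w [nw gw] <-].
  have := Llip _ _ nw nx gw gx; rewrite ler_norml => /andP[h _]; lra.
have Hk x : `|x| <= n -> H x <= kappa + 4 * M * n.
  move=> nx; apply: (le_trans (Hle x nx)); apply: lerD => //.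
  by have := ler_wpM2l M0 (dn x x0 nx nx0); lra.
have lipE x y : `|x| <= n -> `|y| <= n ->
    `|expR (H y) - expR (H x)| <= expR (kappa + 4 * M * n) * M * d y x.
  move=> nx ny; apply: le_trans (expR_lip (Hk y ny) (Hk x nx)) _.
  rewrite -(mulrA (expR _)) ler_wpM2l ?expR_ge0// ler_norml.
  have h1' := Hlip x y nx ny; have := Hlip y x ny nx; rewrite [d x y]dC => h2'.
  by apply/andP; split; lra.
exists (fun x => expR (H x)); split.
- by move=> x nx; rewrite expR_gt0 ler_expR Hk.
- move=> x nx.
  (* Density argument: both sides are continuous, [E] being Lipschitz, so a failure at [x] would
     persist at a nearby generic point, where the identity is known. The strict bound [|x| < n]
     keeps that point inside the square. *)
  have key (f p : E2 R -> R) : continuous f -> continuous p ->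
      (forall w, `|w| <= n -> generic w -> expR (H w) * f w = p w) ->
      expR (H x) * f x = p x.
    move=> cf cp hg; apply: contrapT => /eqP; rewrite -subr_eq0 => ne.
    have cE : {for x, continuous (fun y => expR (H y))}.
      apply/cvgrPdist_lt => e e0; pose K := expR (kappa + 4 * M * n) * M * 2 + 1.
      have K0 : 0 < K by rewrite ltr_wpDl// !mulr_ge0// expR_ge0.
      have nb : \forall y \near x, `|x - y| < e / K /\ `|y| < n.
        apply: filterI; last exact: (cvgr_lt `|x| (@norm_continuous _ _ x) n nx).
        by have := nbhsx_ballx x (e / K) (divr_gt0 e0 K0); rewrite -ball_normE.
      apply: filterS nb => y [xy yn].
      apply: le_lt_trans (lipE y x (ltW yn) (ltW nx)) _.
      have dxy : d x y <= 2 * `|x - y|.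
        rewrite /d prod_normE /=.
        have : `|x.1 - y.1| <= Num.max `|x.1 - y.1| `|x.2 - y.2| by rewrite le_max lexx.
        have : `|x.2 - y.2| <= Num.max `|x.1 - y.1| `|x.2 - y.2| by rewrite le_max lexx orbT.
        by lra.
      rewrite ltr_pdivlMr// in xy.
      have := ler_wpM2l (mulr_ge0 (expR_ge0 (kappa + 4 * M * n)) M0) dxy.
      have : `|x - y| * K = expR (kappa + 4 * M * n) * M * (2 * `|x - y|) + `|x - y|.
        by rewrite /K; ring.
      have := normr_ge0 (x - y); lra.
    have cF : {for x, continuous (fun y => `|expR (H y) * f y - p y|)}.
      apply: cvg_norm; apply: cvgB; last exact: cp.
      by apply: cvgM => //; exact: cf.
    have nF : \forall y \near x, 0 < `|expR (H y) * f y - p y| /\ `|y| < n.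
      apply: filterI; last exact: (cvgr_lt `|x| (@norm_continuous _ _ x) n nx).
      by apply: (cvgr_gt _ cF); rewrite normr_gt0.
    have [e /= e0 eU] := (nbhs_ballP _ _).1 nF.
    have [t1 [/andP[t10 t1e] t1r t1s]] := avoid2 (r1 - x.1) (s1 - x.1) e0.
    have [t2 [/andP[t20 t2e] t2r t2s]] := avoid2 (r2 - x.2) (s2 - x.2) e0.
    have [] := eU (x.1 + t1, x.2 + t2).
      by split; rewrite /ball /= opprD addNKr normrN gtr0_norm.
    move=> F0 yn; move: F0; rewrite hg ?subrr ?normr0 ?ltxx//; first exact: ltW.
    split => /=; apply/eqP => h.
    - by move/eqP: t1r; apply; lra.
    - by move/eqP: t1s; apply; lra.
    - by move/eqP: t2r; apply; lra.
    - by move/eqP: t2s; apply; lra.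
  have cP : continuous P by exact: continuous_polyRe.
  have cQ : continuous Q by exact: continuous_polyIm.
  split; apply: key => //.
  - exact: Ck_continuous Ca.
  - by move=> w nw gw; rewrite Hgen//; have [] := logmod_generic gw.
  - exact: Ck_continuous Cb.
  - by move=> w nw gw; rewrite Hgen//; have [] := logmod_generic gw.
- by move=> x y nx ny; exact: lipE.
Qed.

End LogFactor.

(** * The Higgs field far from its zeros *)

Section OneDimEnergy.
Variable R : realType.
Local Notation mu := (@lebesgue_measure R).

(** With energy at most 1 / (128 s) on a segment of length 2s, the oscillation of [rho] is at most
    1/8, while [rho] reaches 3/4 somewhere: otherwise (rho^2 - 1)^2 would exceed 1/16 all along the
    segment. *)
Lemma sqrt_line_bound (rho drho eps : R -> R) (s : R) : 1 <= s ->
  (forall y : R, `|y| <= s -> is_derive y 1 rho (drho y)) ->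
  {within `[(- s), s], continuous drho} -> continuous eps ->
  (forall y, 0 <= rho y) ->
  (forall y, `|y| <= s -> drho y ^+ 2 <= eps y) ->
  (forall y, (rho y ^+ 2 - 1) ^+ 2 <= eps y) ->
  (\int[mu]_(y in `[(- s)%R, s]) (eps y)%:E <= (128^-1 / s)%:E)%E ->
  forall y, `|y| <= s -> 2^-1 <= rho y.
Proof.
move=> s1 dr cdr ceps rho0 dre re Ie.
have s0 : 0 < s by lra.
have itvE y : (y \in `[(- s), s]) = (`|y| <= s) by rewrite in_itv/= ler_norml.
have ieps : mu.-integrable `[(- s), s] (EFin \o eps).
  by apply: continuous_compact_integrable; [exact: segment_compact|exact: continuous_subspaceT].
have eps0 y : 0 <= eps y by apply: le_trans (re y); exact: sqr_ge0.
have Ie' : \int[mu]_(y in `[(- s), s]) eps y <= 128^-1 / s.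
  by rewrite -lee_fin /Rintegral fineK// (integrable_fin_num _ ieps).
have step1 a b : `|a| <= s -> `|b| <= s -> a <= b -> `|rho b - rho a| <= 8^-1.
  move=> ha hb ab.
  have [->|ne] := eqVneq a b; first by rewrite subrr normr0; lra.
  have {ne}lab : a < b by rewrite lt_neqAle ne ab.
  have sub y : y \in `[a, b] -> `|y| <= s.
    rewrite in_itv/= => /andP[ay yb]; move: ha hb; rewrite !ler_norml => /andP[? ?] /andP[? ?].
    by apply/andP; split; lra.
  have subi : `[a, b]%classic `<=` `[(- s), s]%classic.
    by move=> y yab; have := sub y yab; rewrite -itvE.
  have cw : {within `[a, b], continuous drho} by exact: continuous_subspaceW subi cdr.
  have crho y : `|y| <= s -> {for y, continuous rho}.
    by move=> ys; apply/differentiable_continuous/derivable1_diffP; have [] := dr y ys.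
  have fe : (\int[mu]_(x in `[a, b]) (drho x)%:E = (rho b)%:E - (rho a)%:E)%E.
    apply: continuous_FTC2 => //.
    - split.
      + move=> y yab; have [] // := dr y; apply: sub; apply: subset_itv_oo_cc yab.
      + by apply: cvg_at_right_filter; exact: crho.
      + by apply: cvg_at_left_filter; exact: crho.
    - move=> y yab; rewrite derive1E; have := dr y; move=> H.
      by have /@derive_val -> : is_derive y 1 rho (drho y) by apply: H; apply: sub; apply: subset_itv_oo_cc yab.
  have {}fe : \int[mu]_(x in `[a, b]) drho x = rho b - rho a by rewrite /Rintegral fe.
  have idr : mu.-integrable `[a, b] (EFin \o drho).
    by apply: continuous_compact_integrable => //; exact: segment_compact.
  have ie2 : mu.-integrable `[a, b] (EFin \o eps) 
    by apply: continuous_compact_integrable; [exact: segment_compact|exact: continuous_subspaceT].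
  have iabs : mu.-integrable `[a, b] (EFin \o (fun y => `|drho y|)).
    apply: continuous_compact_integrable; first exact: segment_compact.
    by move=> y; apply: cvg_norm; exact: cw.
  (* The weight in Young's inequality |rho'| <= dl / 2 + |rho'|^2 / (2 dl), chosen so that each of
     the two terms integrates to at most 1/16. *)
  pose dl := (16 * s)^-1.
  have ic : mu.-integrable `[a, b] (EFin \o (fun y => 2^-1 * dl)).
    by apply: continuous_compact_integrable; [exact: segment_compact|exact: continuous_subspaceT (@cst_continuous _ _ _)].
  have ie3 : mu.-integrable `[a, b] (EFin \o (fun y => (8 * s) * eps y)).
    exact: (integrableZl _ _ ie2).
  rewrite -fe; apply: le_trans (le_normr_Rintegral _ _) _ => //.
  have L : \int[mu]_(y in `[a, b]) `|drho y| <= \int[mu]_(y in `[a, b]) (2^-1 * dl + (8 * s) * eps y).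
    apply: le_Rintegral => //; first exact: (integrableD _ ic ie3).
    move=> y /= yab; have ys := sub y yab.
    have d0 : 0 < dl by rewrite invr_gt0 mulr_gt0.
    have E1 : 8 * s = 2^-1 * dl^-1 by rewrite /dl invrK; lra.
    rewrite E1 -mulrA -mulrDr.
    have h : `|drho y| ^+ 2 <= eps y by rewrite -normrX ger0_norm ?sqr_ge0// dre.
    have h2 : 0 <= dl^-1 * (`|drho y| - dl) ^+ 2 by rewrite mulr_ge0 ?sqr_ge0// invr_ge0 ltW.
    have h3 : dl^-1 * (`|drho y| - dl) ^+ 2 = dl^-1 * `|drho y| ^+ 2 - 2 * `|drho y| + dl.
      by field; rewrite gt_eqF.
    have h4 : dl^-1 * `|drho y| ^+ 2 <= dl^-1 * eps y by rewrite ler_wpM2l// invr_ge0 ltW.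
    by lra.
  apply: (le_trans L); rewrite RintegralD// RintegralZl// Rintegral_cst//=.
  rewrite lebesgue_measure_itv/= lte_fin lab /=.
  have L2 : \int[mu]_(y in `[a, b]) eps y <= 128^-1 / s.
    apply: le_trans Ie'; rewrite /Rintegral; apply: fine_le.
    - exact: (integrable_fin_num _ ie2).
    - exact: (integrable_fin_num _ ieps).
    - apply: ge0_subset_integral => //; first exact: (measurable_int _ ieps).
      by move=> y _; rewrite lee_fin.
  have L3 : (8 * s) * \int[mu]_(y in `[a, b]) eps y <= 16^-1.
    have := ler_wpM2l (ltW (mulr_gt0 (ltr0n R 8) s0)) L2.
    have -> : 8 * s * (128^-1 / s) = 16^-1 by field; rewrite gt_eqF.
    by [].
  have L4 : 2^-1 * dl * (b - a) <= 16^-1.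
    have ba : b - a <= 2 * s.
      move: ha hb; rewrite !ler_norml => /andP[? ?] /andP[? ?]; lra.
    have d0 : 0 <= 2^-1 * dl by rewrite mulr_ge0// invr_ge0 mulr_ge0// ltW.
    have := ler_wpM2l d0 ba.
    have -> : 2^-1 * dl * (2 * s) = 16^-1 by rewrite /dl; field; rewrite gt_eqF.
    by [].
  have -> : (8^-1 : R) = 16^-1 + 16^-1 by field.
  exact: lerD.
have [y0 [ny0 hy0]] : exists y0, `|y0| <= s /\ (rho y0 ^+ 2 - 1) ^+ 2 <= 16^-1.
  apply: contrapT => /forallNP h.
  have lb y : `|y| <= s -> 16^-1 <= eps y.
    move=> ys; apply: le_trans (re y); rewrite leNgt; apply/negP => lt.
    by apply: (h y); split => //; exact: ltW.
  have : \int[mu]_(y in `[(- s), s]) 16^-1 <= \int[mu]_(y in `[(- s), s]) eps y.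
    apply: le_Rintegral => //.
      by apply: continuous_compact_integrable; [exact: segment_compact|exact: continuous_subspaceT (@cst_continuous _ _ _)].
    by move=> y ys; apply: lb; rewrite -itvE.
  rewrite Rintegral_cst//= lebesgue_measure_itv/= lte_fin ifT/=; last lra.
  move=> /le_trans /(_ Ie').
  have h1 : 128^-1 / s <= 128^-1 by rewrite ler_pdivrMr//; lra.
  by lra.
have r0 : 3/4 <= rho y0.
  have := rho0 y0 => p0; rewrite leNgt; apply/negP => lt.
  have : rho y0 ^+ 2 < 9/16 by nra.
  by have := sqr_ge0 (rho y0); nra.
move=> y ny.
have : `|rho y - rho y0| <= 8^-1.
  by have [h|/ltW h] := leP y0 y; [exact: step1|rewrite distrC; exact: step1].
by rewrite ler_norml => /andP[h _]; lra.
Qed.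

Lemma ge0_integral_reflect (f : R -> \bar R) : measurable_fun setT f ->
  (forall x, (0 <= f x)%E) -> (\int[mu]_x f (- x)%R = \int[mu]_x f x)%E.
Proof.
move=> mf f0.
have h := @ge0_integral_pushforward _ _ (measurableTypeR R) (measurableTypeR R) R
  (-%R : _ -> measurableTypeR R) _ mu setT f.
rewrite -[LHS]/(\int[mu]_(x in (-%R : _ -> measurableTypeR R) @^-1` setT) (f \o -%R) x)%E.
rewrite -h//.
by apply: eq_measure_integral => A mA _; exact: lebesgue_measureN.
Qed.

(* Otherwise the integral would dominate that of [eta / s], which diverges. *)
Lemma small_values (J : R -> \bar R) (eta s0 : R) : measurable_fun setT J ->
  (forall x, (0 <= J x)%E) -> (\int[mu]_x J x < +oo)%E -> 0 < eta ->
  exists s, s0 <= s /\ (J s <= (eta / s)%:E)%E.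
Proof.
move=> mJ J0 fJ e0; apply: contrapT => /forallNP h.
pose t := Num.max s0 1.
have t0 : 0 < t by rewrite lt_max ltr01 orbT.
have lb s : t <= s -> ((eta / s)%:E <= J s)%E.
  rewrite ge_max => /andP[ts _]; rewrite leNgt; apply/negP => lt.
  by apply: (h s); split => //; exact: ltW.
have Jf : (\int[mu]_x J x)%E \is a fin_num by rewrite ge0_fin_numE// integral_ge0.
pose I := fine (\int[mu]_x J x)%E.
(* Chosen so that the integral of [eta / s] from [t] to [K] is exactly [I + 1]. *)
pose K := t * expR ((I + 1) / eta).
have I0 : 0 <= I by rewrite fine_ge0// integral_ge0.
have tK : t < K.
  rewrite /K -[ltLHS]mulr1 ltr_pM2l// expR_gt1 divr_gt0//; lra.
have pos y : y \in `[t, K] -> 0 < y.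
  by rewrite in_itv/= => /andP[ty _]; exact: lt_le_trans ty.
have dln (y : R) : 0 < y -> is_derive y 1 (fun z => eta * ln z) (eta / y).
  by move=> y0; have := is_derive1_ln y0 => d; apply: is_derive_eq; rewrite /GRing.scale.
have cl (y : R) : 0 < y -> {for y, continuous (fun z => eta * ln z)}.
  by move=> y0; apply: cvgM; [exact: cvg_cst|exact: continuous_ln].
have cv : {within `[t, K], continuous (fun x : R => eta / x)}.
  apply: continuous_in_subspaceT => y; rewrite inE /= => yt; have y0 := pos y yt.
  by apply: cvgM; [exact: cvg_cst|apply: cvgV; [rewrite gt_eqF|exact: cvg_id]].
have fe : (\int[mu]_(x in `[t, K]) (eta / x)%:E = (eta * ln K)%:E - (eta * ln t)%:E)%E.
  apply: (continuous_FTC2 (F := fun z => eta * ln z)) => //.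
  - split.
    + by move=> y yt; have [] := dln y (pos y (subset_itv_oo_cc yt)).
    + by apply: cvg_at_right_filter; exact: cl.
    + by apply: cvg_at_left_filter; apply: cl; exact: lt_trans tK.
  - move=> y yt; rewrite derive1E.
    by have /@derive_val -> := dln y (pos y (subset_itv_oo_cc yt)).
have : (\int[mu]_(x in `[t, K]) (eta / x)%:E <= \int[mu]_x J x)%E.
  apply: (@le_trans _ _ (\int[mu]_(x in `[t, K]) J x)%E).
    apply: ge0_le_integral => //.
    - by move=> y /= /pos y0; rewrite lee_fin divr_ge0// ltW.
    - apply/measurable_EFinP.
      exact: (@subspace_continuous_measurable_fun R `[t, K]%classic (fun x : R => eta / x)).
    - exact: measurable_funTS.
    - by move=> y /=; rewrite in_itv/= => /andP[ty _]; exact: lb.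
  by apply: ge0_subset_integral.
rewrite fe -(fineK Jf) -EFinB lee_fin -mulrBr -/I.
rewrite /K lnM ?posrE ?expR_gt0// expRK addrAC subrr add0r mulrCA divff ?gt_eqF// mulr1.
by lra.
Qed.

(** If [d] were negative, [f1], which vanishes at the minimum, would be negative just to its right,
    and the mean value theorem would put [f] below [f x] there. *)
Lemma second_derivative_test (f f1 : R -> R) (x d e : R) : 0 < e ->
  (forall t, `|t - x| < e -> is_derive t 1 f (f1 t)) -> is_derive x 1 f1 d ->
  (forall t, `|t - x| < e -> f x <= f t) -> 0 <= d.
Proof.
move=> e0 df df1 fmin; rewrite leNgt; apply/negP => d0.
have inI t : t \in `]x - e, x + e[ -> `|t - x| < e.
  by rewrite in_itv/= => /andP[h1 h2]; rewrite ltr_norml; apply/andP; split; lra.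
have f1x : f1 x = 0.
  have d1 : is_derive x 1 f (f1 x) by apply: df; rewrite subrr normr0.
  apply: (is_derive_unique d1).
  apply: (@derive1_at_min _ f (x - e) (x + e)); first lra.
  - by move=> t /inI te; have [] := df t te.
  - by rewrite in_itv/=; apply/andP; split; lra.
  - by move=> t /inI; exact: fmin.
have [dv dE] := df1.
have cv : (fun h => h^-1 *: (f1 (h *: 1 + x) - f1 x)) @ 0^' --> d.
  by rewrite -dE; exact: dv.
have /nbhs_ballP[r /= r0 hr] : nbhs (0 : R) (fun h => h != 0 -> h^-1 *: (f1 (h *: 1 + x) - f1 x) < 0).
  exact: (cvgr_lt _ cv).
pose t := Num.min (e / 2) (r / 2).
have t0 : 0 < t by rewrite lt_min !divr_gt0.
have te : t < e by rewrite gt_min; apply/orP; left; lra.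
have tr : t < r by rewrite gt_min; apply/orP; right; lra.
have neg y : x < y <= x + t -> f1 y < 0.
  move=> /andP[y1 y2]; have := hr (y - x); rewrite /ball/= sub0r normrN.
  have -> : `|y - x| < r = true by rewrite gtr0_norm; [lra|lra].
  have ne : y - x != 0 by lra.
  move=> /(_ isT ne); rewrite [_%:A]mulr1 subrK f1x subr0 pmulr_rlt0// invr_gt0; lra.
have [||c cI E] := @MVT _ f f1 x (x + t) ltac:(by lra).
- move=> y; rewrite in_itv/= => /andP[h1 h2]; apply: df; rewrite gtr0_norm; lra.
- apply: derivable_within_continuous => y; rewrite in_itv/= => /andP[h1 h2].
  by have [] := df y; rewrite ?ger0_norm//; lra.
have := fmin (x + t); rewrite addrAC subrr add0r gtr0_norm// => /(_ te).
have f1c : f1 c < 0.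
  by apply: neg; move: cI; rewrite in_itv/= => /andP[h1 h2]; apply/andP; split; lra.
have : f1 c * (x + t - x) < 0 by rewrite nmulr_rlt0//; lra.
by rewrite -E; lra.
Qed.

End OneDimEnergy.

(** [p1] to [p4] are the second derivatives of the logarithms of the squared distances to the two
    roots. They cancel in pairs because such logarithms are harmonic, and the sum of the two minimum
    conditions reduces to [0 <= u - 1]. *)
Lemma laplacian_contra (R : realFieldType) (d0 d1 p1 p2 p3 p4 u : R) :
  0 <= - 2 * d1 + p1 + p3 -> 0 <= 2 * d0 + p2 + p4 -> p1 + p2 = 0 ->
  p3 + p4 = 0 -> d1 - d0 = - (2^-1 * (u - 1)) -> u < 1 -> False.
Proof. by move=> *; lra. Qed.

Section FarField.
Variable R : realType.
Variables (a b A0 A1 : E2 R -> R) (r1 r2 s1 s2 : R) (g : E2 R -> R).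
Local Notation mu := (@lebesgue_measure R).
Let P := polyRe r1 r2 s1 s2.
Let Q := polyIm r1 r2 s1 s2.
Let N (x : E2 R) := distsq r1 r2 x * distsq s1 s2 x.
Let u := usq a b.

Hypothesis cfg : vortex_config a b A0 A1.
Hypothesis g0 : forall x, 0 < g x.
Hypothesis ag : forall x, a x = g x * P x.
Hypothesis bg : forall x, b x = g x * Q x.

Let uN x : u x = g x ^+ 2 * N x.
Proof. by rewrite /u /usq ag bg /P /Q /polyRe /polyIm /N /distsq; ring. Qed.

Let dist_ge0 p1 p2 (x : E2 R) : 0 <= distsq p1 p2 x.
Proof. by rewrite addr_ge0 ?sqr_ge0. Qed.

Let u_gt0 x : N x != 0 -> 0 < u x.
Proof.
move=> N0; rewrite uN mulr_gt0 ?exprn_gt0//.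
by rewrite lt_neqAle eq_sym N0 mulr_ge0.
Qed.

Let N_neq0 x : 0 < u x -> N x != 0.
Proof. by move=> u0; apply/eqP => N0; move: u0; rewrite uN N0 mulr0 ltxx. Qed.

Let dist_gt0 x : N x != 0 -> 0 < distsq r1 r2 x /\ 0 < distsq s1 s2 x.
Proof.
by rewrite /N mulf_eq0 negb_or => /andP[h1 h2]; split; rewrite lt_neqAle eq_sym dist_ge0 ?h1 ?h2.
Qed.

Let lnuE x : ln (u x) = 2 * logmod a b r1 r2 s1 s2 x + ln (N x).
Proof. by rewrite /logmod -/u -/(N x); field. Qed.

(** With [dlnu2], the gradient of log |phi|^2 off the roots: twice that of [logmod], which is given
    by the connection, plus that of log |p|^2. *)
Definition dlnu1 (x : E2 R) := - 2 * A1 x + 2 * (x.1 - r1) / distsq r1 r2 x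
  + 2 * (x.1 - s1) / distsq s1 s2 x.
Definition dlnu2 (x : E2 R) := 2 * A0 x + 2 * (x.2 - r2) / distsq r1 r2 x
  + 2 * (x.2 - s2) / distsq s1 s2 x.

Let ddist1 p1 p2 (x y : R) : is_derive x 1 (fun t => distsq p1 p2 (t, y)) (2 * (x - p1)).
Proof. by rewrite /distsq /=; apply: is_derive_eq; rewrite /GRing.scale/=; ring. Qed.
Let ddist2 p1 p2 (x y : R) : is_derive y 1 (fun t => distsq p1 p2 (x, t)) (2 * (y - p2)).
Proof. by rewrite /distsq /=; apply: is_derive_eq; rewrite /GRing.scale/=; ring. Qed.

Let d1lnu (x y : R) : N (x, y) != 0 ->
  is_derive x 1 (fun t => ln (u (t, y))) (dlnu1 (x, y)).
Proof.
move=> N0; have [h1 h2] := dist_gt0 N0.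
have dL := is_derive_logmod1 cfg g0 ag bg N0.
have e1 := ddist1 r1 r2 x y; have e2 := ddist1 s1 s2 x y.
have dN : is_derive x 1 (fun t => N (t, y))
   (2 * (x - r1) * distsq s1 s2 (x, y) + 2 * (x - s1) * distsq r1 r2 (x, y)).
  by apply: is_derive_eq; rewrite /GRing.scale/=; ring.
have dlN := @is_derive1_comp _ (@ln R) (fun t => N (t, y)) x _ _
   (is_derive1_ln (mulr_gt0 h1 h2)) dN.
have -> : (fun t => ln (u (t, y))) = (fun t => 2 * logmod a b r1 r2 s1 s2 (t, y) + (@ln R \o (fun t => N (t, y))) t).
  by apply/funext => t; rewrite lnuE.
apply: is_derive_eq; rewrite /GRing.scale/= /dlnu1 /N /=.
by field; rewrite !gt_eqF.
Qed.

Let d2lnu (x y : R) : N (x, y) != 0 ->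
  is_derive y 1 (fun t => ln (u (x, t))) (dlnu2 (x, y)).
Proof.
move=> N0; have [h1 h2] := dist_gt0 N0.
have dL := is_derive_logmod2 cfg g0 ag bg N0.
have e1 := ddist2 r1 r2 x y; have e2 := ddist2 s1 s2 x y.
have dN : is_derive y 1 (fun t => N (x, t))
   (2 * (y - r2) * distsq s1 s2 (x, y) + 2 * (y - s2) * distsq r1 r2 (x, y)).
  by apply: is_derive_eq; rewrite /GRing.scale/=; ring.
have dlN := @is_derive1_comp _ (@ln R) (fun t => N (x, t)) y _ _
   (is_derive1_ln (mulr_gt0 h1 h2)) dN.
have -> : (fun t => ln (u (x, t))) = (fun t => 2 * logmod a b r1 r2 s1 s2 (x, t) + (@ln R \o (fun t => N (x, t))) t).
  by apply/funext => t; rewrite lnuE.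
apply: is_derive_eq; rewrite /GRing.scale/= /dlnu2 /N /=.
by field; rewrite !gt_eqF.
Qed.

Let dquot1 p1 p2 (x y : R) : distsq p1 p2 (x, y) != 0 ->
  is_derive x 1 (fun t => 2 * (t - p1) / distsq p1 p2 (t, y))
    (2 / distsq p1 p2 (x, y) - 4 * (x - p1) ^+ 2 / distsq p1 p2 (x, y) ^+ 2).
Proof.
move=> n0; have e1 := ddist1 p1 p2 x y.
have e2 := is_deriveV (f := fun t => distsq p1 p2 (t, y)) n0.
have d : is_derive x 1 (fun t => (2 * (t - p1)) * (distsq p1 p2 (t, y))^-1)
   (2 / distsq p1 p2 (x, y) - 4 * (x - p1) ^+ 2 / distsq p1 p2 (x, y) ^+ 2).
  by apply: is_derive_eq; rewrite /GRing.scale/=; field.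
exact: d.
Qed.

Let dquot2 p1 p2 (x y : R) : distsq p1 p2 (x, y) != 0 ->
  is_derive y 1 (fun t => 2 * (t - p2) / distsq p1 p2 (x, t))
    (2 / distsq p1 p2 (x, y) - 4 * (y - p2) ^+ 2 / distsq p1 p2 (x, y) ^+ 2).
Proof.
move=> n0; have e1 := ddist2 p1 p2 x y.
have e2 := is_deriveV (f := fun t => distsq p1 p2 (x, t)) n0.
have d : is_derive y 1 (fun t => (2 * (t - p2)) * (distsq p1 p2 (x, t))^-1)
   (2 / distsq p1 p2 (x, y) - 4 * (y - p2) ^+ 2 / distsq p1 p2 (x, y) ^+ 2).
  by apply: is_derive_eq; rewrite /GRing.scale/=; field.
exact: d.
Qed.

Let cu : continuous u.
Proof.
have [[Ca Cb _ _] _ _ _ _] := cfg.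
have C : Ck 2 (fun x => a x * a x + b x * b x) := CkD (CkM Ca Ca) (CkM Cb Cb).
have -> : u = (fun x => a x * a x + b x * b x).
  by apply/funext => x; rewrite /u /usq !expr2.
exact: Ck_continuous C.
Qed.

(* [Delta log |phi|^2 = |phi|^2 - 1] away from the zeros. *)
Lemma no_interior_min (x : E2 R) (e : R) : 0 < e -> 0 < u x < 1 ->
  (forall z, `|z - x| < e -> u x <= u z) -> False.
Proof.
case: x => x y e0 /andP[u0 u1] umin.
have Npos z : `|z - (x, y)| < e -> N z != 0.
  by move=> /umin ze; apply: N_neq0; exact: lt_le_trans ze.
have N0 : N (x, y) != 0 by exact: N_neq0.
have [h1 h2] := dist_gt0 N0.
have [[_ _ CA0 CA1] _ _ B3 _] := cfg.
have dA1 := section_derive1 x y (Ck_le CA1); have dA0 := section_derive2 x y (Ck_le CA0).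
have n1 : distsq r1 r2 (x, y) != 0 by rewrite gt_eqF.
have n2 : distsq s1 s2 (x, y) != 0 by rewrite gt_eqF.
have q1 := dquot1 n1; have q2 := dquot1 n2; have q3 := dquot2 n1; have q4 := dquot2 n2.
have dd1 : is_derive x 1 (fun t => dlnu1 (t, y)) (- 2 * 'D_(1, 0) A1 (x, y)
   + (2 / distsq r1 r2 (x, y) - 4 * (x - r1) ^+ 2 / distsq r1 r2 (x, y) ^+ 2)
   + (2 / distsq s1 s2 (x, y) - 4 * (x - s1) ^+ 2 / distsq s1 s2 (x, y) ^+ 2)).
  rewrite /dlnu1 /=; apply: is_derive_eq; rewrite /GRing.scale/=; ring.
have dd2 : is_derive y 1 (fun t => dlnu2 (x, t)) (2 * 'D_(0, 1) A0 (x, y)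
   + (2 / distsq r1 r2 (x, y) - 4 * (y - r2) ^+ 2 / distsq r1 r2 (x, y) ^+ 2)
   + (2 / distsq s1 s2 (x, y) - 4 * (y - s2) ^+ 2 / distsq s1 s2 (x, y) ^+ 2)).
  rewrite /dlnu2 /=; apply: is_derive_eq; rewrite /GRing.scale/=; ring.
have in1 t : `|t - x| < e -> `|(t, y) - (x, y)| < e.
  by move=> te; rewrite prod_normE/= subrr normr0 gt_max te.
have in2 t : `|t - y| < e -> `|(x, t) - (x, y)| < e.
  by move=> te; rewrite prod_normE/= subrr normr0 gt_max te andbT.
have lnmin z : `|z - (x, y)| < e -> ln (u (x, y)) <= ln (u z).
  move=> ze; rewrite ler_ln ?posrE//; first exact: umin.
  by apply: lt_le_trans (umin _ ze).
have p1 := second_derivative_test (f := fun t => ln (u (t, y))) (f1 := fun t => dlnu1 (t, y)) e0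
  (fun t te => d1lnu (Npos _ (in1 t te))) dd1 (fun t te => lnmin _ (in1 t te)).
have p2 := second_derivative_test (f := fun t => ln (u (x, t))) (f1 := fun t => dlnu2 (x, t)) e0
  (fun t te => d2lnu (Npos _ (in2 t te))) dd2 (fun t te => lnmin _ (in2 t te)).
have S : 'D_(1, 0) A1 (x, y) - 'D_(0, 1) A0 (x, y) = - (2^-1 * (u (x, y) - 1)).
  by have := B3 (x, y); rewrite /u /usq => h; apply/eqP; rewrite -subr_eq0 opprK h.
have T1 : (2 / distsq r1 r2 (x, y) - 4 * (x - r1) ^+ 2 / distsq r1 r2 (x, y) ^+ 2)
    + (2 / distsq r1 r2 (x, y) - 4 * (y - r2) ^+ 2 / distsq r1 r2 (x, y) ^+ 2) = 0.
  have E : (y - r2) ^+ 2 = distsq r1 r2 (x, y) - (x - r1) ^+ 2 by rewrite /distsq /=; ring.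
  by rewrite E; field.
have T2 : (2 / distsq s1 s2 (x, y) - 4 * (x - s1) ^+ 2 / distsq s1 s2 (x, y) ^+ 2)
    + (2 / distsq s1 s2 (x, y) - 4 * (y - s2) ^+ 2 / distsq s1 s2 (x, y) ^+ 2) = 0.
  have E : (y - s2) ^+ 2 = distsq s1 s2 (x, y) - (x - s1) ^+ 2 by rewrite /distsq /=; ring.
  by rewrite E; field.
exact: laplacian_contra p1 p2 T1 T2 S u1.
Qed.

Let S1 := 1 + `|r1| + `|r2| + `|s1| + `|s2|.

Let far_N x : S1 <= `|x| -> N x != 0.
Proof.
have := normr_ge0 r1; have := normr_ge0 r2; have := normr_ge0 s1; have := normr_ge0 s2.
have := ler_norm r1; have := ler_norm r2; have := ler_norm s1; have := ler_norm s2.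
have := ler_norm (- r1); have := ler_norm (- r2); have := ler_norm (- s1); have := ler_norm (- s2).
rewrite !normrN prod_normE/= /S1 => ? ? ? ? ? ? ? ? ? ? ? ?; rewrite le_max /N /distsq.
have ne (t p : R) : S1 <= `|t| -> `|p| < S1 -> 0 < (t - p) ^+ 2.
  move=> tS pS; rewrite lt_neqAle sqr_ge0 andbT eq_sym sqrf_eq0 subr_eq0.
  by apply/eqP => tp; move: tS; rewrite tp leNgt pS.
have b1 : `|r1| < S1 by rewrite /S1; lra.
have b2 : `|r2| < S1 by rewrite /S1; lra.
have b3 : `|s1| < S1 by rewrite /S1; lra.
have b4 : `|s2| < S1 by rewrite /S1; lra.
rewrite -/S1 => /orP[xS|xS]; rewrite gt_eqF// mulr_gt0//.
- by rewrite ltr_pwDl ?sqr_ge0// ne.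
- by rewrite ltr_pwDl ?sqr_ge0// ne.
- by rewrite ltr_wpDl ?sqr_ge0// ne.
- by rewrite ltr_wpDl ?sqr_ge0// ne.
Qed.

Let dens := edens a b A0 A1.

Let dens_ge0 x : 0 <= dens x.
Proof. by rewrite /dens /edens !addr_ge0// sqr_ge0. Qed.

Let C1s : [/\ Ck 1 a, Ck 1 b, continuous A0 & continuous A1].
Proof.
have [[Ca Cb CA0 CA1] _ _ _ _] := cfg.
by split; [exact: Ck_le Ca|exact: Ck_le Cb|exact: Ck_continuous CA0|exact: Ck_continuous CA1].
Qed.

Let cdens : continuous dens.
Proof.
have [[Ca Cb CA0 CA1] _ _ _ _] := cfg.
pose v1 : E2 R := (1, 0); pose v2 : E2 R := (0, 1).
pose f1 (x : E2 R) := 'D_(1, 0) a x + A0 x * b x.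
pose f2 (x : E2 R) := 'D_(1, 0) b x - A0 x * a x.
pose f3 (x : E2 R) := 'D_(0, 1) a x + A1 x * b x.
pose f4 (x : E2 R) := 'D_(0, 1) b x - A1 x * a x.
pose f5 (x : E2 R) := a x * a x + b x * b x - 1.
have D1 : Ck 1 f1 := CkD (Ck_derive v1 Ca) (Ck_le (CkM CA0 Cb)).
have D2 : Ck 1 f2 := CkB (Ck_derive v1 Cb) (Ck_le (CkM CA0 Ca)).
have D3 : Ck 1 f3 := CkD (Ck_derive v2 Ca) (Ck_le (CkM CA1 Cb)).
have D4 : Ck 1 f4 := CkB (Ck_derive v2 Cb) (Ck_le (CkM CA1 Ca)).
have D5 : Ck 1 f5 := Ck_le (CkB (CkD (CkM Ca Ca) (CkM Cb Cb)) (Ck_cst _ 2%N 1)).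
have D : Ck 1 (fun x => f1 x * f1 x + f2 x * f2 x + f3 x * f3 x + f4 x * f4 x + f5 x * f5 x) :=
  CkD (CkD (CkD (CkD (CkM D1 D1) (CkM D2 D2)) (CkM D3 D3)) (CkM D4 D4)) (CkM D5 D5).
have -> : dens = (fun x => f1 x * f1 x + f2 x * f2 x + f3 x * f3 x + f4 x * f4 x + f5 x * f5 x).
  by apply/funext => x; rewrite /dens /edens /f1 /f2 /f3 /f4 /f5 !expr2.
exact: Ck_continuous D.
Qed.

(** The diamagnetic inequality |d|phi|| <= |D phi|: the connection term is orthogonal to phi. By
    Lagrange's identity the defect is the square of the imaginary part of conj(phi) D phi. *)
Lemma kato (a0 b0 a1 b1 A v : R) : 0 < v -> v = a0 ^+ 2 + b0 ^+ 2 ->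
  ((2 * Num.sqrt v)^-1 * (2 * (a0 * a1 + b0 * b1))) ^+ 2 <=
  (a1 + A * b0) ^+ 2 + (b1 - A * a0) ^+ 2.
Proof.
move=> v0 vE; have sv : Num.sqrt v ^+ 2 = v by rewrite sqr_sqrtr// ltW.
have s0 : 0 < Num.sqrt v by rewrite sqrtr_gt0.
have -> : ((2 * Num.sqrt v)^-1 * (2 * (a0 * a1 + b0 * b1))) ^+ 2 = (a0 * a1 + b0 * b1) ^+ 2 / v.
  by rewrite -[in RHS]sv; field; rewrite gt_eqF.
rewrite ler_pdivrMr// vE.
have -> : ((a1 + A * b0) ^+ 2 + (b1 - A * a0) ^+ 2) * (a0 ^+ 2 + b0 ^+ 2) =
  (a0 * a1 + b0 * b1) ^+ 2 + (a0 * (b1 - A * a0) - b0 * (a1 + A * b0)) ^+ 2 by ring.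
by rewrite lerDl sqr_ge0.
Qed.

Let sqrt_quarter (v : R) : 0 <= v -> 2^-1 <= Num.sqrt v -> 4^-1 <= v.
Proof.
move=> v0 h; rewrite -(sqr_sqrtr v0); have := ler_wpM2l (ltW (lt_le_trans (y := 2^-1) (x := 0) ltac:(by lra) h)) h.
rewrite -expr2; nra.
Qed.

Let five_squares (p1 p2 p3 p4 p5 : R) :
  p1 ^+ 2 + p2 ^+ 2 <= p1 ^+ 2 + p2 ^+ 2 + p3 ^+ 2 + p4 ^+ 2 + p5 ^+ 2 /\
  p3 ^+ 2 + p4 ^+ 2 <= p1 ^+ 2 + p2 ^+ 2 + p3 ^+ 2 + p4 ^+ 2 + p5 ^+ 2.
Proof.
have := (sqr_ge0 p1, sqr_ge0 p2, sqr_ge0 p3, sqr_ge0 p4, sqr_ge0 p5).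
by case=> [[[[? ?] ?] ?] ?]; split; lra.
Qed.

Let side1 (s x : R) : 1 <= s -> S1 <= s -> `|x| = s ->
  (\int[mu]_(y in `[(- s)%R, s]) (dens (x, y))%:E <= (128^-1 / s)%:E)%E ->
  forall y, `|y| <= s -> 4^-1 <= u (x, y).
Proof.
move=> s1' sS xs I y ys.
have [Ca Cb cA0 cA1] := C1s.
have up t : 0 < u (x, t).
  apply: u_gt0; apply: far_N; apply: le_trans sS _.
  by rewrite prod_normE/= le_max xs lexx.
apply: sqrt_quarter; first exact: ltW.
pose drho t := (2 * Num.sqrt (u (x, t)))^-1 *
   (2 * (a (x, t) * 'D_(0, 1) a (x, t) + b (x, t) * 'D_(0, 1) b (x, t))).
have snd_cont (f : E2 R -> R) : continuous f -> continuous (fun t => f (x, t)).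
  exact: continuous_section2.
apply: (@sqrt_line_bound R (fun t => Num.sqrt (u (x, t))) drho (fun t => dens (x, t)) s) => //.
- move=> t _; have d1 := section_derive2 x t Ca; have d2 := section_derive2 x t Cb.
  have du : is_derive t 1 (fun t => u (x, t))
    (2 * (a (x, t) * 'D_(0, 1) a (x, t) + b (x, t) * 'D_(0, 1) b (x, t))).
    by rewrite /u /usq; apply: is_derive_eq; rewrite /GRing.scale/=; ring.
  exact: (@is_derive1_comp _ Num.sqrt (fun t => u (x, t)) t _ _ (is_derive1_sqrt (up t)) du).
- apply: continuous_subspaceT => t; rewrite /drho.
  apply: cvgM.
    apply: cvgV; first by rewrite mulf_neq0// gt_eqF// sqrtr_gt0.
    apply: cvgMr; apply: (@continuous_comp _ _ _ (fun t => u (x, t)) Num.sqrt).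
      exact: (snd_cont _ cu).
    exact: sqrt_continuous.
  apply: cvgMr; apply: cvgD; apply: cvgM.
  + exact: (snd_cont _ (Ck_continuous Ca) t).
  + exact: (snd_cont _ (Ck_continuous (Ck_derive ((0, 1) : E2 R) Ca)) t).
  + exact: (snd_cont _ (Ck_continuous Cb) t).
  + exact: (snd_cont _ (Ck_continuous (Ck_derive ((0, 1) : E2 R) Cb)) t).
- exact: snd_cont.
- move=> t _; apply: le_trans (kato _ _ (A1 (x, t)) (up t) (erefl _)) _.
  exact: (five_squares _ _ _ _ _).2.
- move=> t; rewrite sqr_sqrtr; last exact: ltW.
  by rewrite /dens /edens lerDr !addr_ge0// sqr_ge0.
Qed.

Let side2 (s y : R) : 1 <= s -> S1 <= s -> `|y| = s ->
  (\int[mu]_(x in `[(- s)%R, s]) (dens (x, y))%:E <= (128^-1 / s)%:E)%E ->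
  forall x, `|x| <= s -> 4^-1 <= u (x, y).
Proof.
move=> s1' sS ys I x xs.
have [Ca Cb cA0 cA1] := C1s.
have up t : 0 < u (t, y).
  apply: u_gt0; apply: far_N; apply: le_trans sS _.
  by rewrite prod_normE/= le_max ys lexx orbT.
apply: sqrt_quarter; first exact: ltW.
pose drho t := (2 * Num.sqrt (u (t, y)))^-1 *
   (2 * (a (t, y) * 'D_(1, 0) a (t, y) + b (t, y) * 'D_(1, 0) b (t, y))).
have fst_cont (f : E2 R -> R) : continuous f -> continuous (fun t => f (t, y)).
  exact: continuous_section.
apply: (@sqrt_line_bound R (fun t => Num.sqrt (u (t, y))) drho (fun t => dens (t, y)) s) => //.
- move=> t _; have d1 := section_derive1 t y Ca; have d2 := section_derive1 t y Cb.
  have du : is_derive t 1 (fun t => u (t, y))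
    (2 * (a (t, y) * 'D_(1, 0) a (t, y) + b (t, y) * 'D_(1, 0) b (t, y))).
    by rewrite /u /usq; apply: is_derive_eq; rewrite /GRing.scale/=; ring.
  exact: (@is_derive1_comp _ Num.sqrt (fun t => u (t, y)) t _ _ (is_derive1_sqrt (up t)) du).
- apply: continuous_subspaceT => t; rewrite /drho.
  apply: cvgM.
    apply: cvgV; first by rewrite mulf_neq0// gt_eqF// sqrtr_gt0.
    apply: cvgMr; apply: (@continuous_comp _ _ _ (fun t => u (t, y)) Num.sqrt).
      exact: (fst_cont _ cu).
    exact: sqrt_continuous.
  apply: cvgMr; apply: cvgD; apply: cvgM.
  + exact: (fst_cont _ (Ck_continuous Ca) t).
  + exact: (fst_cont _ (Ck_continuous (Ck_derive ((1, 0) : E2 R) Ca)) t).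
  + exact: (fst_cont _ (Ck_continuous Cb) t).
  + exact: (fst_cont _ (Ck_continuous (Ck_derive ((1, 0) : E2 R) Cb)) t).
- exact: fst_cont.
- move=> t _; apply: le_trans (kato _ _ (A0 (t, y)) (up t) (erefl _)) _.
  exact: (five_squares _ _ _ _ _).1.
- move=> t; rewrite sqr_sqrtr; last exact: ltW.
  by rewrite /dens /edens lerDr !addr_ge0// sqr_ge0.
Qed.

(** By Fubini the energy carried by a vertical or horizontal line is an integrable function of its
    position. [J s] adds the four lines at [s] and [- s], so [small_values] yields arbitrarily large
    [s] for which every side satisfies the hypothesis of [sqrt_line_bound]. *)
Let good_square (s0 : R) : exists s, s0 <= s /\ forall x, `|x| = s -> 4^-1 <= u x.
Proof.
have [_ _ _ _ Efin] := cfg; rewrite -/dens in Efin.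
pose f (x : measurableTypeR R * measurableTypeR R) : \bar R := (dens (id2 x))%:E.
have mf : measurable_fun setT f.
  by apply/measurable_EFinP; exact: (continuous_measurable2 cdens).
have f0 x : (0 <= f x)%E by rewrite lee_fin.
have [V [mV V0 VI subV]] : exists V : R -> \bar R, [/\ measurable_fun setT V,
    forall x, (0 <= V x)%E, (\int[mu]_x V x < +oo)%E &
    forall s t, (\int[mu]_(y in `[(- s)%R, s]) (dens (t, y))%:E <= V t)%E].
  exists (fubini_F mu f); split.
  - exact: measurable_fun_fubini_tonelli_F.
  - by move=> x; apply: integral_ge0.
  - by rewrite -(fubini_tonelli1 (m1 := mu) (m2 := mu) f mf f0).
  - move=> s t; rewrite /fubini_F; apply: ge0_subset_integral => //.
    + exact: (measurable_fun_pair2 t mf).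
    + by move=> *; rewrite lee_fin.
have [H [mH H0 HI subH]] : exists H : R -> \bar R, [/\ measurable_fun setT H,
    forall x, (0 <= H x)%E, (\int[mu]_x H x < +oo)%E &
    forall s t, (\int[mu]_(x in `[(- s)%R, s]) (dens (x, t))%:E <= H t)%E].
  exists (fubini_G mu f); split.
  - exact: measurable_fun_fubini_tonelli_G.
  - by move=> x; apply: integral_ge0.
  - by rewrite -(fubini_tonelli2 (m1 := mu) (m2 := mu) f mf f0).
  - move=> s t; rewrite /fubini_G; apply: ge0_subset_integral => //.
    + exact: (measurable_fun_pair1 t mf).
    + by move=> *; rewrite lee_fin.
have mN : measurable_fun setT (-%R : R -> R) by exact: oppr_measurable.
have mV' : measurable_fun setT (fun x : R => V (- x)%R) by exact: (measurableT_comp mV mN).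
have mH' : measurable_fun setT (fun x : R => H (- x)%R) by exact: (measurableT_comp mH mN).
pose J (s : R) := ((V s + V (- s)%R) + (H s + H (- s)%R))%E.
have mJ : measurable_fun setT J by apply: emeasurable_funD; apply: emeasurable_funD.
have J0 s : (0 <= J s)%E by rewrite /J !adde_ge0.
have JI : (\int[mu]_x J x < +oo)%E.
  rewrite ge0_integralD//; [|by move=> *; rewrite adde_ge0|exact: emeasurable_funD
    |by move=> *; rewrite adde_ge0|exact: emeasurable_funD].
  rewrite !ge0_integralD// (ge0_integral_reflect mV V0) (ge0_integral_reflect mH H0).
  by apply: lte_add_pinfty; apply: lte_add_pinfty; (exact: VI || exact: HI).
have e128 : 0 < 128^-1 :> R by rewrite invr_gt0.
have [s [s0s Js]] := small_values (Num.max s0 (Num.max 1 S1)) mJ J0 JI e128.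
move: s0s; rewrite !ge_max => /and3P[s0s s1s Ss].
have sp : 0 < s by lra.
exists s; split => // -[x y]; rewrite prod_normE /=.
have JV t : `|t| = s -> (V t <= J s)%E.
  rewrite /J; have [t0|t0] := ger0P t => <-.
    by rewrite -addeA leeDl// !adde_ge0.
  by rewrite opprK [(V _ + V t)%E]addeC -addeA leeDl// !adde_ge0.
have JH t : `|t| = s -> (H t <= J s)%E.
  rewrite /J; have [t0|t0] := ger0P t => <-; rewrite addeC.
    by rewrite -addeA leeDl// !adde_ge0.
  by rewrite opprK [(H _ + H t)%E]addeC -addeA leeDl// !adde_ge0.
(* In the maximum norm the larger coordinate decides whether the point lies on a vertical or a
   horizontal side. *)
have [yx|xy] := leP `|y| `|x|.
  move=> xs; apply: (side1 s1s Ss xs); last by rewrite -xs.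
  exact: le_trans (subV s x) (le_trans (JV x xs) Js).
move=> ys; apply: (side2 s1s Ss ys); last by rewrite -ys ltW.
exact: le_trans (subH s y) (le_trans (JH y ys) Js).
Qed.

(** The constant [m] is the smaller of 1/4 and the minimum of |phi|^2 on the inner square
    [|x| = S1], hence independent of the outer square, which is chosen after [x]. A minimum below
    [m] over the region between the two squares would be interior, against [no_interior_min]. *)
Lemma far_field : exists S m : R, 0 < m /\ forall x, S <= `|x| -> m <= usq a b x.
Proof.
have S1p : 0 < S1 by rewrite /S1 !ltr_wpDr.
have cn : continuous (fun x : E2 R => `|x|) by move=> x; exact: norm_continuous.
have cmpt (p q : R) : compact [set x : E2 R | p <= `|x| /\ `|x| <= q].
  have -> : [set x : E2 R | p <= `|x| /\ `|x| <= q] = cball (R * R)%type q `&` [set x | p <= `|x|].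
    by apply/seteqP; split => x /= [].
  apply: compact_closedI; first exact: ((tame2 R).2 q).1.
  by apply: (@preimage_closed _ _ (fun x : E2 R => `|x|) [set t | p <= t]); [move=> x _; exact: cn|exact: closed_ge].
have evt (p q : R) : 0 <= p -> p <= q -> exists c, (p <= `|c| /\ `|c| <= q) /\
    forall x, p <= `|x| -> `|x| <= q -> u c <= u x.
  move=> p0 pq.
  have ne : [set x : E2 R | p <= `|x| /\ `|x| <= q] !=set0.
    by exists (p, 0); rewrite /= prod_normE/= normr0 ger0_norm// (max_idPl p0).
  have [c cK cmin] := compact_EVT_min ne (cmpt p q) (continuous_subspaceT cu).
  exists c; split; first by rewrite inE in cK.
  by move=> x px xq; apply: cmin; rewrite inE.
have [c0 [[c01 c02] c0min]] := evt S1 S1 (ltW S1p) (lexx _).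
have uc0 : 0 < u c0 by apply: u_gt0; apply: far_N.
pose m := Num.min 4^-1 (u c0).
exists S1, m; split; first by rewrite lt_min uc0 andbT.
move=> x xS; rewrite -/u.
have [s [sx sb]] := good_square (Num.max `|x| (S1 + 1)).
move: sx; rewrite ge_max => /andP[xs Ss].
have Ss' : S1 <= s by lra.
have [c [[cS cs] cmin]] := evt S1 s (ltW S1p) Ss'.
apply: le_trans (cmin x xS xs); rewrite leNgt; apply/negP => ucm.
have [uc4 ucc] : u c < 4^-1 /\ u c < u c0.
  by move: ucm; rewrite lt_min => /andP.
have cS' : S1 < `|c|.
  rewrite lt_neqAle cS andbT; apply/eqP => E.
  by move: ucc; rewrite ltNge c0min// -E.
have cs' : `|c| < s.
  rewrite lt_neqAle cs andbT; apply/eqP => E.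
  by move: uc4; rewrite ltNge sb.
pose e := Num.min (`|c| - S1) (s - `|c|).
apply: (@no_interior_min c e).
- by rewrite lt_min !subr_gt0 cS' cs'.
- rewrite u_gt0/=; last exact: far_N.
  lra.
move=> z; rewrite lt_min => /andP[z1 z2]; apply: cmin.
- have := lerB_dist c z; rewrite distrC => h; lra.
- have := lerB_dist z c => h; lra.
Qed.

End FarField.

(** * Lipschitz bounds from bounded weak derivatives *)

Lemma sigma_finite_leb2 (R : realType) : sigma_finite setT (leb2 R).
Proof.
exists (fun n : nat => @id2 R @^-1` cball (R * R)%type n%:R).
  apply/seteqP; split => // x _; exists (Num.truncn `|id2 x|).+1 => //=.
  by rewrite /cball/= ltW// truncnS_gt.
move=> n; split; first exact: (tame_measurable_ball (tame2 R)).
exact: ((tame2 R).2 n%:R).2.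
Qed.

(* [leb2] is only declared as a measure; Fubini on [leb3] needs it sigma-finite. *)
Definition sleb2 (R : realType) :
  set (measurableTypeR R * measurableTypeR R)%type -> \bar R := leb2 R.
HB.instance Definition _ (R : realType) := isMeasure.Build _ _ R (@sleb2 R)
  (@measure0 _ _ _ (leb2 R)) (@measure_ge0 _ _ _ (leb2 R))
  (@measure_semi_sigma_additive _ _ _ (leb2 R)).
HB.instance Definition _ (R : realType) :=
  @Measure_isSigmaFinite.Build _ _ R (@sleb2 R) (@sigma_finite_leb2 R).

Section WeakLipschitz.
Variable R : realType.
Local Notation mu := (@lebesgue_measure R).
Local Notation leb2 := (leb2 R).
Local Notation leb3 := (leb3 R).

Lemma Rintegral_tensor3 (f1 f2 f3 : R -> R) : csupp f1 -> csupp f2 -> csupp f3 ->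
  \int[leb3]_x (f1 (id3 x).1.1 * f2 (id3 x).1.2 * f3 (id3 x).2) =
  \int[mu]_x f1 x * \int[mu]_x f2 x * \int[mu]_x f3 x.
Proof.
move=> c1 c2 c3.
have c12 : csupp (fun x : E2 R => f1 x.1 * f2 x.2) by exact: csupp_tensor.
have c123 : csupp (fun x : E3 R => f1 x.1.1 * f2 x.1.2 * f3 x.2).
  exact: (csupp_tensor c12 c3).
have i1 := csupp_integrable (tame1 R) c1; have i2 := csupp_integrable (tame1 R) c2.
have i3 := csupp_integrable (tame1 R) c3.
have i12 := csupp_integrable (tame2 R) c12.
have i123 := csupp_integrable (tame3 R) c123.
have h12 := @Rintegral_tensor R _ _ _ _ mu mu f1 f2 i1 i2 i12.
have h := @Rintegral_tensor R _ _ _ _ (@sleb2 R) mu (fun x => f1 (id2 x).1 * f2 (id2 x).2) f3 i12 i3 i123.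
have h12' : \int[@sleb2 R]_x (f1 (id2 x).1 * f2 (id2 x).2) = \int[mu]_x f1 x * \int[mu]_x f2 x.
  exact: h12.
by rewrite -h12'; exact: h.
Qed.

Let lip_arith (Fx Fx' eta BK Z P1 P2 : R) :
  (Fx - eta) * Z <= P1 -> P1 <= (Fx + eta) * Z ->
  (Fx' - eta) * Z <= P2 -> P2 <= (Fx' + eta) * Z ->
  - (BK * Z) <= P1 - P2 -> P1 - P2 <= BK * Z ->
  `|Fx * Z - Fx' * Z| <= (2 * eta + BK) * Z.
Proof. by move=> *; rewrite ler_norml; apply/andP; split; lra. Qed.

(** [Psi] is a kernel whose derivative is a bump [p1] near [x] minus a bump [p2] near [x'] of equal
    mass [Z]. Testing with it compares the averages of [f] near the two points, and the difference
    is at most [B] times the L^1 norm of [Psi]. [eta] accounts for the oscillation of [f] on the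
    bumps. *)
Lemma weak_lip_core (j : 'I_3) (f g Psi p1 p2 : E3 R -> R) (B K Z eta : R) (x x' : E3 R) :
  0 <= B -> continuous f -> weak_deriv (@id3 R) leb3 setT (e3 R j) f g ->
  {ae leb3, forall y, `|g (id3 y)| <= B} -> test_fun setT Psi ->
  (forall y, 'D_(e3 R j) Psi y = p1 y - p2 y) -> csupp p1 -> csupp p2 ->
  (forall y, 0 <= p1 y) -> (forall y, 0 <= p2 y) ->
  \int[leb3]_y p1 (id3 y) = Z -> \int[leb3]_y p2 (id3 y) = Z -> 0 < Z ->
  \int[leb3]_y `|Psi (id3 y)| <= K * Z ->
  (forall y, p1 y != 0 -> `|f y - f x| <= eta) ->
  (forall y, p2 y != 0 -> `|f y - f x'| <= eta) ->
  `|f x - f x'| <= 2 * eta + B * K.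
Proof.
move=> B0 cf [_ lg wd] gB tPsi dPsi cp1 cp2 p10 p20 I1 I2 Z0 IK n1 n2.
have cPsi := test_fun_csupp tPsi.
have ip1 := csupp_integrable (tame3 R) cp1; have ip2 := csupp_integrable (tame3 R) cp2.
have cfp1 := csuppM cf cp1; have cfp2 := csuppM cf cp2.
have ifp1 := csupp_integrable (tame3 R) cfp1; have ifp2 := csupp_integrable (tame3 R) cfp2.
have igP := loc_integrable_csupp (tame3 R) lg cPsi.
have iP := csupp_integrable (tame3 R) cPsi.
have bnd (p : E3 R -> R) (z : E3 R) : csupp p -> (forall y, 0 <= p y) ->
    leb3.-integrable setT (fun y => (p (id3 y))%:E) ->
    leb3.-integrable setT (fun y => (f (id3 y) * p (id3 y))%:E) ->
    \int[leb3]_y p (id3 y) = Z ->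
    (forall y, p y != 0 -> `|f y - f z| <= eta) ->
    (f z - eta) * Z <= \int[leb3]_y (f (id3 y) * p (id3 y)) <= (f z + eta) * Z.
  move=> cp p0 ip ifp IZ nz; rewrite -IZ -!RintegralZl//; apply/andP; split.
  - apply: le_Rintegral => //; first exact: (integrableZl _ _ ip).
    move=> y _; have [->|ne] := eqVneq (p (id3 y)) 0; first by rewrite !mulr0.
    by rewrite ler_wpM2r//; have := nz _ ne; rewrite ler_distl => /andP[].
  - apply: le_Rintegral => //; first exact: (integrableZl _ _ ip).
    move=> y _; have [->|ne] := eqVneq (p (id3 y)) 0; first by rewrite !mulr0.
    by rewrite ler_wpM2r//; have := nz _ ne; rewrite ler_distl => /andP[].
have /andP[l1 u1] := bnd p1 x cp1 p10 ip1 ifp1 I1 n1.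
have /andP[l2 u2] := bnd p2 x' cp2 p20 ip2 ifp2 I2 n2.
have E : \int[leb3]_y (f (id3 y) * p1 (id3 y)) - \int[leb3]_y (f (id3 y) * p2 (id3 y)) =
   - \int[leb3]_y (g (id3 y) * Psi (id3 y)).
  rewrite -RintegralB//; have := wd _ tPsi; rewrite preimage_setT => <-.
  by apply: eq_Rintegral => y _; rewrite dPsi mulrBr.
have G : `|\int[leb3]_y (g (id3 y) * Psi (id3 y))| <= B * K * Z.
  rewrite -mulrA.
  apply: le_trans (le_normr_Rintegral _ _) _ => //.
  apply: le_trans (ler_wpM2l B0 IK).
  have iaP : leb3.-integrable setT (fun y => (`|Psi (id3 y)|)%:E).
    exact: (integrable_abse iP).
  rewrite -RintegralZl//; apply: fine_le.
  - exact: (integrable_fin_num _ (integrable_abse igP)).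
  - exact: (integrable_fin_num _ (integrableZl _ B iaP)).
  apply: ae_ge0_le_integral => //.
  - exact: (measurable_int _ (integrable_abse igP)).
  - by move=> y _; rewrite lee_fin mulr_ge0.
  - exact: (measurable_int _ (integrableZl _ B iaP)).
  - by apply: filterS gB => y gy _; rewrite lee_fin normrM ler_wpM2r.
move: G; rewrite -[X in `|X|]opprK -E normrN ler_norml => /andP[g1 g2].
rewrite -(ler_pM2r Z0); have -> : `|f x - f x'| * Z = `|f x * Z - f x' * Z|.
  by rewrite -mulrBl normrM (gtr0_norm Z0).
exact: (lip_arith l1 u1 l2 u2 g1 g2).
Qed.

Lemma csupp_norm (f : R -> R) : csupp f -> csupp (fun x => `|f x|).
Proof.
move=> [cf [n fn]]; split; first by move=> x; exact: cvg_norm (cf x).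
by exists n => x /fn ->; rewrite normr0.
Qed.

Section Tensor3.
Variables F G K : R -> R.
Definition tensor3 (y : E3 R) : R := F y.1.1 * G y.1.2 * K y.2.

Lemma csupp_tensor3 : csupp F -> csupp G -> csupp K -> csupp tensor3.
Proof. by move=> cF cG cK; exact: (csupp_tensor (csupp_tensor cF cG) cK). Qed.

Lemma Ck_tensor3 : Ck 1 F -> Ck 1 G -> Ck 1 K -> Ck 1 tensor3.
Proof.
move=> CF CG CK.
have C1 : Ck 1 (fun y : E2 R => F y.1 * G y.2) := CkM (Ck_fst _ CF) (Ck_snd _ CG).
exact: (CkM (Ck_fst _ C1) (Ck_snd _ CK)).
Qed.

Lemma derive_tensor3 (v y : E3 R) : Ck 1 F -> Ck 1 G -> Ck 1 K ->
  'D_v tensor3 y = 'D_(v.1.1) F y.1.1 * G y.1.2 * K y.2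
    + F y.1.1 * 'D_(v.1.2) G y.1.2 * K y.2 + F y.1.1 * G y.1.2 * 'D_(v.2) K y.2.
Proof.
move=> CF CG CK.
have dF : derivable (fun y : E3 R => F y.1.1) y v := Ck_derivable CF.
have dG : derivable (fun y : E3 R => G y.1.2) y v := Ck_derivable CG.
have dK : derivable (fun y : E3 R => K y.2) y v := Ck_derivable CK.
rewrite (deriveM (derivableM dF dG) dK) (deriveM dF dG) /GRing.scale/=.
have -> : 'D_v (fun y : E3 R => F y.1.1) y = 'D_(v.1.1) F y.1.1 by [].
have -> : 'D_v (fun y : E3 R => G y.1.2) y = 'D_(v.1.2) G y.1.2 by [].
have -> : 'D_v (fun y : E3 R => K y.2) y = 'D_(v.2) K y.2 by [].
rewrite [X in X * _](_ : _ = F y.1.1 * G y.1.2) //; ring.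
Qed.

End Tensor3.

Section Kernels.
Variable w : R.
Hypothesis w0 : 0 < w.

Let daff (a s t : R) : is_derive t 1 (fun t => s + (t - a) / w) w^-1.
Proof. by apply: is_derive_eq; rewrite /GRing.scale/=; ring. Qed.
Let daffN (a s t : R) : is_derive t 1 (fun t => s - (t - a) / w) (- w^-1).
Proof. by apply: is_derive_eq; rewrite /GRing.scale/=; ring. Qed.

(** [ramp a - ramp (a + h)] is a plateau whose derivative is a unit bump near [a] minus a unit bump
    near [a + h]. [hat] localises the transverse variables; its mass is kept as a factor of [Z]
    instead of being normalised. The summand [0] gives the argument the shape of [daff]. *)
Definition ramp (a t : R) : R := step (0 + (t - a) / w).
Definition dramp (a t : R) : R := dstep (0 + (t - a) / w) / w.
Definition hat (a t : R) : R := step (1 + (t - a) / w) * step (1 - (t - a) / w).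

Lemma is_derive_ramp (a t : R) : is_derive t 1 (ramp a) (dramp a t).
Proof.
exact: (@is_derive1_comp _ (@step R) (fun t => 0 + (t - a) / w) t _ _ (is_derive_step _) (daff a 0 t)).
Qed.

Lemma continuous_dramp (a : R) : continuous (dramp a).
Proof.
move=> t; apply: cvgMl.
apply: (@continuous_comp _ _ _ (fun t => 0 + (t - a) / w) (@dstep R)).
  exact: (is_derive_continuous (daff a 0)).
exact: continuous_dstep.
Qed.

Lemma Ck_ramp (a : R) : Ck 1 (ramp a).
Proof. exact: (Ck1_R (is_derive_ramp a) (@continuous_dramp a)). Qed.

Lemma dramp_ge0 a t : 0 <= dramp a t.
Proof. by rewrite divr_ge0 ?dstep_ge0// ltW. Qed.

Lemma dramp_supp a t : dramp a t != 0 -> a <= t <= a + w.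
Proof.
move=> h; apply/andP; split; rewrite leNgt; apply/negP => lt; move/eqP: h; apply.
- rewrite /dramp dstep0 ?mul0r// add0r pmulr_lle0 ?invr_gt0//; lra.
- rewrite /dramp dstep1 ?mul0r// add0r ler_pdivlMr//; lra.
Qed.

Lemma csupp_dramp a : csupp (dramp a).
Proof.
split; first exact: continuous_dramp.
exists (`|a| + w) => t; rewrite lter_normr => h; apply/eqP/negPn/negP => /dramp_supp /andP[h1 h2].
by have := ler_norm a; have := ler_norm (- a); rewrite normrN; case/orP: h => h; lra.
Qed.

Lemma Rintegral_dramp a : \int[mu]_t dramp a t = 1.
Proof.
have -> : \int[mu]_t dramp a t = \int[mu]_(t in `[a, a + w]) dramp a t.
  rewrite [RHS]Rintegral_mkcond; apply: eq_Rintegral => t _.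
  rewrite patchE; case: ifPn => //; rewrite notin_setE /= in_itv/= => h.
  by apply/eqP/negPn/negP => /dramp_supp.
rewrite /Rintegral (FTC2_R _ (is_derive_ramp a) (@continuous_dramp a)); last by have := w0; lra.
rewrite /ramp step1 ?step0 ?subr0//.
- by rewrite subrr mul0r addr0.
- by rewrite add0r addrAC subrr add0r divff// gt_eqF.
Qed.

Lemma Ck_hat (a : R) : Ck 1 (hat a).
Proof.
have d1 (t : R) := @is_derive1_comp _ (@step R) (fun t => 1 + (t - a) / w) t _ _ (is_derive_step _) (daff a 1 t).
have d2 (t : R) := @is_derive1_comp _ (@step R) (fun t => 1 - (t - a) / w) t _ _ (is_derive_step _) (daffN a 1 t).
apply: CkM; [apply: (Ck1_R d1)|apply: (Ck1_R d2)] => t; apply: cvgMl.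
- apply: (@continuous_comp _ _ _ (fun t => 1 + (t - a) / w) (@dstep R)).
    exact: (is_derive_continuous (daff a 1)).
  exact: continuous_dstep.
- apply: (@continuous_comp _ _ _ (fun t => 1 - (t - a) / w) (@dstep R)).
    exact: (is_derive_continuous (daffN a 1)).
  exact: continuous_dstep.
Qed.

Lemma hat_ge0 a t : 0 <= hat a t.
Proof. by rewrite mulr_ge0 ?step_ge0. Qed.

Lemma hat_supp a t : hat a t != 0 -> `|t - a| <= w.
Proof.
move=> h; rewrite leNgt; apply/negP; rewrite lter_normr => /orP[lt|lt]; move/eqP: h; apply.
- by rewrite /hat [X in _ * X]step0 ?mulr0// subr_le0 ler_pdivlMr// mul1r ltW.
- rewrite /hat step0 ?mul0r//.
  have : (t - a) / w <= -1 by rewrite ler_pdivrMr//; lra.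
  by lra.
Qed.

Lemma csupp_hat a : csupp (hat a).
Proof.
split; first exact: Ck_continuous (Ck_hat a).
exists (`|a| + w) => t h; apply/eqP/negPn/negP => /hat_supp.
by have := lerB_dist t a; lra.
Qed.

Lemma Rintegral_hat_gt0 a : 0 < \int[mu]_t hat a t.
Proof.
have ih := csupp_integrable (tame1 R) (csupp_hat a).
rewrite lt_neqAle Rintegral_ge0 ?andbT; last by move=> t _; exact: hat_ge0.
apply/eqP => /esym I0.
have : (\int[mu]_t `|(hat a t)%:E| = 0)%E.
  under eq_integral do rewrite gee0_abs ?lee_fin ?hat_ge0//.
  move: I0; rewrite /Rintegral => /eqP.
  rewrite fine_eq0 ?(integrable_fin_num _ ih)//.
  by move=> /eqP.
move=> /(ae_eq_integral_abs mu measurableT (measurable_int _ ih)) ae0.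
have {}ae0 : {ae mu, forall t, hat a t = 0} by apply: filterS ae0 => t /(_ I) [].
have [t [/andP[t1 t2] t0]] := ae_lebesgue_dense (a := a) (b := a + w) ltac:(by have := w0; lra) ae0.
move/eqP: t0; apply/negP; rewrite gt_eqF// mulr_gt0// step_gt0//.
- have : 0 <= (t - a) / w by rewrite divr_ge0 ?ltW// subr_gt0.
  by lra.
- have : (t - a) / w < 1 by rewrite ltr_pdivrMr//; have := w0; lra.
  by lra.
Qed.

Lemma csupp_plateau (a h : R) : 0 <= h -> csupp (fun t => ramp a t - ramp (a + h) t).
Proof.
move=> h0; have w0' := w0; split.
  by move=> t; apply: cvgB; exact: (Ck_continuous (Ck_ramp _)).
exists (`|a| + h + w) => t; rewrite lter_normr => ht.
have := ler_norm a; have := ler_norm (- a); rewrite normrN => a1 a2.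
case/orP: ht => ht; rewrite /ramp.
- by rewrite !step1 ?subrr// add0r ler_pdivlMr// mul1r; lra.
- by rewrite !step0 ?subrr// add0r pmulr_lle0 ?invr_gt0//; lra.
Qed.

Lemma Rintegral_plateau (a h : R) : 0 <= h ->
  \int[mu]_t `|ramp a t - ramp (a + h) t| <= h + w.
Proof.
move=> h0; have w0' := w0; have ip := csupp_integrable (tame1 R) (csupp_plateau a h0).
have -> : \int[mu]_t `|ramp a t - ramp (a + h) t| =
    \int[mu]_(t in `[a, a + h + w]) `|ramp a t - ramp (a + h) t|.
  rewrite [RHS]Rintegral_mkcond; apply: eq_Rintegral => t _.
  rewrite patchE; case: ifPn => //; rewrite notin_setE /= in_itv/= => /negP.
  rewrite negb_and -!ltNge => /orP[ht|ht]; rewrite /ramp.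
  - by rewrite !step0 ?subrr ?normr0// add0r pmulr_lle0 ?invr_gt0//; lra.
  - by rewrite !step1 ?subrr ?normr0// add0r ler_pdivlMr// mul1r; lra.
have ic : mu.-integrable `[a, a + h + w] (EFin \o (fun=> 1)).
  by apply: continuous_compact_integrable; [exact: segment_compact|exact: continuous_subspaceT (@cst_continuous _ _ _)].
have ia : mu.-integrable `[a, a + h + w] (EFin \o (fun t => `|ramp a t - ramp (a + h) t|)).
  apply: continuous_compact_integrable; first exact: segment_compact.
  apply: continuous_subspaceT => t; apply: cvg_norm.
  by case: (csupp_plateau a h0) => + _; apply.
have : \int[mu]_(t in `[a, a + h + w]) `|ramp a t - ramp (a + h) t| <= \int[mu]_(t in `[a, a + h + w]) 1.
  apply: le_Rintegral => // t _; rewrite ler_norml /ramp.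
  have := step_ge0 (0 + (t - a) / w); have := step_le1 (0 + (t - a) / w).
  have := step_ge0 (0 + (t - (a + h)) / w); have := step_le1 (0 + (t - (a + h)) / w).
  by move=> *; apply/andP; split; lra.
move=> /le_trans; apply; rewrite Rintegral_cst//= mul1r lebesgue_measure_itv/= lte_fin.
by case: ifP => _ /=; lra.
Qed.

Lemma derive_plateau (a h t : R) :
  'D_1 (fun t => ramp a t - ramp (a + h) t) t = dramp a t - dramp (a + h) t.
Proof.
have d1 := is_derive_ramp a t; have d2 := is_derive_ramp (a + h) t.
exact: (@derive_val _ _ _ _ _ _ _ (is_deriveB d1 d2)).
Qed.

End Kernels.

Lemma continuous_nbhs_E3 (f : E3 R -> R) (x : E3 R) (eta : R) :
  continuous f -> 0 < eta -> exists2 r, 0 < r & forall y : E3 R,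
    `|y.1.1 - x.1.1| < r -> `|y.1.2 - x.1.2| < r -> `|y.2 - x.2| < r ->
    `|f y - f x| <= eta.
Proof.
move=> cf eta0.
have := @cvgr_dist_lt _ _ _ (nbhs x) _ f (f x) (cf x) _ eta0.
move=> /(_ _)/nbhs_ballP [r /= r0 hr]; exists r => // y h1 h2 h3.
rewrite distrC; apply/ltW/hr; split; first split; rewrite /ball/= distrC//.
Qed.

Lemma derive_zero_dir (f : R -> R) (t : R) : 'D_0 f t = 0.
Proof. exact: derive0. Qed.

(** The kernel is a plateau along [e3 R j] times hats of width [w] in the other two directions. Its
    L^1 norm is at most [h + w] times the mass of a bump, so the constant tends to [B * h] as [w]
    shrinks. *)
Lemma weak_lip (j : 'I_3) (f g : E3 R -> R) (B a b c h : R) : (j < 2)%N ->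
  0 <= B -> 0 <= h -> continuous f -> weak_deriv (@id3 R) leb3 setT (e3 R j) f g ->
  {ae leb3, forall y, `|g (id3 y)| <= B} ->
  `|f (a, b, c) - f ((a, b, c) + h *: e3 R j)| <= B * h.
Proof.
move=> j2 B0 h0 cf wfg gB; apply/ler_addgt0Pr => e e0.
(* Makes [2 * eta + B * w] at most [e] as soon as [w <= eta]. *)
pose eta := e / (2 + B).
have B2 : 0 < 2 + B by lra.
have eta0 : 0 < eta by rewrite divr_gt0.
have [r1 r10 hr1] := continuous_nbhs_E3 (a, b, c) cf eta0.
have [r2 r20 hr2] := continuous_nbhs_E3 ((a, b, c) + h *: e3 R j) cf eta0.
pose w := Num.min (Num.min r1 r2 / 2) eta.
have rr : 0 < Num.min r1 r2 by rewrite lt_min r10.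
have w0 : 0 < w by rewrite lt_min eta0 divr_gt0.
have wr1 : w < r1.
  have : w <= Num.min r1 r2 / 2 by rewrite /w ge_min lexx.
  have : Num.min r1 r2 <= r1 by rewrite ge_min lexx.
  by lra.
have wr2 : w < r2.
  have : w <= Num.min r1 r2 / 2 by rewrite /w ge_min lexx.
  have : Num.min r1 r2 <= r2 by rewrite ge_min lexx orbT.
  by lra.
have we : w <= eta by rewrite /w ge_min lexx orbT.
suff : `|f (a, b, c) - f ((a, b, c) + h *: e3 R j)| <= 2 * eta + B * (h + w).
  move=> /le_trans; apply.
  have : B * w <= B * eta by rewrite ler_wpM2l.
  have : eta * (2 + B) = e by rewrite /eta divfK// gt_eqF.
  by lra.
pose H (t : R) := hat w t; pose P (t : R) (s : R) := ramp w t s - ramp w (t + h) s.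
have CP t : Ck 1 (P t) := CkB (Ck_ramp w t) (Ck_ramp w (t + h)).
have CH t : Ck 1 (H t) := Ck_hat w t.
have cP t : csupp (P t) := csupp_plateau w0 t h0.
have cH t : csupp (H t) := csupp_hat w0 t.
have cd t : csupp (dramp w t) := csupp_dramp w0 t.
have IP t : \int[mu]_s `|P t s| <= h + w := Rintegral_plateau w0 t h0.
have Id t : \int[mu]_s dramp w t s = 1 := Rintegral_dramp w0 t.
have IH t : 0 < \int[mu]_s H t s := Rintegral_hat_gt0 w0 t.
have nH t : \int[mu]_s `|H t s| = \int[mu]_s H t s.
  by apply: eq_Rintegral => s _; rewrite ger0_norm// hat_ge0.
have supp (k1 k2 k3 : R) (y : E3 R) (r : R) (p1 p2 p3 : R -> R) : w < r ->
   (forall t, p1 t != 0 -> `|t - k1| <= w) -> (forall t, p2 t != 0 -> `|t - k2| <= w) ->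
   (forall t, p3 t != 0 -> `|t - k3| <= w) ->
   tensor3 p1 p2 p3 y != 0 -> [/\ `|y.1.1 - k1| < r, `|y.1.2 - k2| < r & `|y.2 - k3| < r].
  move=> wr h1 h2 h3; rewrite /tensor3 !mulf_eq0 !negb_or => /andP[/andP[/h1 ? /h2 ?] /h3 ?].
  by split; apply: le_lt_trans wr.
have sd t s : dramp w t s != 0 -> `|s - t| <= w.
  move=> /(dramp_supp w0) /andP[h1 h2]; rewrite ler_distl h2 andbT.
  by apply: le_trans h1; rewrite gerBl ltW.
have sh t s : H t s != 0 -> `|s - t| <= w by exact: hat_supp.
have dg t s : 0 <= dramp w t s := dramp_ge0 w0 t s.
have hg t s : 0 <= H t s := hat_ge0 w t s.
case: (eqVneq j 0) => j0.
- have ej : e3 R j = (1, 0, 0) by rewrite j0.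
  apply: (@weak_lip_core j f g (tensor3 (P a) (H b) (H c))
    (tensor3 (dramp w a) (H b) (H c)) (tensor3 (dramp w (a + h)) (H b) (H c)) B _
    ((\int[mu]_s H b s) * (\int[mu]_s H c s))) => //.
  + exact: (csupp_test_fun (tame3 R) (Ck_tensor3 (CP a) (CH b) (CH c)) (csupp_tensor3 (cP a) (cH b) (cH c))).
  + move=> y; rewrite (derive_tensor3 _ _ (CP a) (CH b) (CH c)) ej/= !derive_zero_dir derive_plateau.
    by rewrite /tensor3; ring.
  + exact: (csupp_tensor3 (cd a) (cH b) (cH c)).
  + exact: (csupp_tensor3 (cd (a + h)) (cH b) (cH c)).
  + by move=> y; rewrite /tensor3; apply: mulr_ge0; [apply: mulr_ge0|]; (exact: dg || exact: hg).
  + by move=> y; rewrite /tensor3; apply: mulr_ge0; [apply: mulr_ge0|]; (exact: dg || exact: hg).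
  + by rewrite (Rintegral_tensor3 (cd a) (cH b) (cH c)) Id mul1r.
  + by rewrite (Rintegral_tensor3 (cd (a + h)) (cH b) (cH c)) Id mul1r.
  + by rewrite mulr_gt0.
  + have -> : \int[leb3]_y `|tensor3 (P a) (H b) (H c) (id3 y)| =
       \int[leb3]_y (`|P a (id3 y).1.1| * `|H b (id3 y).1.2| * `|H c (id3 y).2|).
      by apply: eq_Rintegral => y _; rewrite !normrM.
    rewrite (Rintegral_tensor3 (csupp_norm (cP a)) (csupp_norm (cH b)) (csupp_norm (cH c))) !nH -mulrA.
    by rewrite ler_wpM2r// ltW// mulr_gt0.
  + move=> y /(supp _ _ _ _ _ _ _ _ wr1 (sd a) (sh b) (sh c)) [? ? ?]; exact: hr1.
  + move=> y /(supp _ _ _ _ _ _ _ _ wr2 (sd (a + h)) (sh b) (sh c)) [? ? ?].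
    by apply: hr2 => //; rewrite ej/= /GRing.scale/= ?mulr1 ?mulr0 ?addr0.
- have j1 : j = 1.
    by apply/val_inj => /=; case: j j2 j0 {wfg hr2} => [[|[|m]] //= ? ? ?].
  have ej : e3 R j = (0, 1, 0) by rewrite j1.
  apply: (@weak_lip_core j f g (tensor3 (H a) (P b) (H c))
    (tensor3 (H a) (dramp w b) (H c)) (tensor3 (H a) (dramp w (b + h)) (H c)) B _
    ((\int[mu]_s H a s) * (\int[mu]_s H c s))) => //.
  + exact: (csupp_test_fun (tame3 R) (Ck_tensor3 (CH a) (CP b) (CH c)) (csupp_tensor3 (cH a) (cP b) (cH c))).
  + move=> y; rewrite (derive_tensor3 _ _ (CH a) (CP b) (CH c)) ej/= !derive_zero_dir derive_plateau.
    by rewrite /tensor3; ring.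
  + exact: (csupp_tensor3 (cH a) (cd b) (cH c)).
  + exact: (csupp_tensor3 (cH a) (cd (b + h)) (cH c)).
  + by move=> y; rewrite /tensor3; apply: mulr_ge0; [apply: mulr_ge0|]; (exact: dg || exact: hg).
  + by move=> y; rewrite /tensor3; apply: mulr_ge0; [apply: mulr_ge0|]; (exact: dg || exact: hg).
  + by rewrite (Rintegral_tensor3 (cH a) (cd b) (cH c)) Id mulr1.
  + by rewrite (Rintegral_tensor3 (cH a) (cd (b + h)) (cH c)) Id mulr1.
  + by rewrite mulr_gt0.
  + have -> : \int[leb3]_y `|tensor3 (H a) (P b) (H c) (id3 y)| =
       \int[leb3]_y (`|H a (id3 y).1.1| * `|P b (id3 y).1.2| * `|H c (id3 y).2|).
      by apply: eq_Rintegral => y _; rewrite !normrM.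
    rewrite (Rintegral_tensor3 (csupp_norm (cH a)) (csupp_norm (cP b)) (csupp_norm (cH c))) !nH.
    rewrite mulrAC [X in _ <= X]mulrC.
    by rewrite ler_wpM2l// ltW// mulr_gt0.
  + move=> y /(supp _ _ _ _ _ _ _ _ wr1 (sh a) (sd b) (sh c)) [? ? ?]; exact: hr1.
  + move=> y /(supp _ _ _ _ _ _ _ _ wr2 (sh a) (sd (b + h)) (sh c)) [? ? ?].
    by apply: hr2 => //; rewrite ej/= /GRing.scale/= ?mulr1 ?mulr0 ?addr0.
Qed.

End WeakLipschitz.

Lemma continuous_pairl (X Y : topologicalType) (y : Y) :
  continuous (fun x : X => (x, y)).
Proof. by move=> x; apply: cvg_pair => //=; exact: cvg_cst. Qed.

Lemma continuous_pairr (X Y : topologicalType) (x : X) :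
  continuous (fun y : Y => (x, y)).
Proof. by move=> y; apply: cvg_pair => //=; exact: cvg_cst. Qed.

(** * Pointwise consequences of the Sobolev norms *)

Section SobolevBounds.
Variable R : realType.
Local Notation mu := (@lebesgue_measure R).
Local Notation leb3 := (leb3 R).

Lemma Re_le_normc (z : R[i]) : `|complex.Re z| <= Normc.normc z.
Proof.
case: z => a b /=; rewrite -sqrtr_sqr ler_wsqrtr// lerDl sqr_ge0 //.
Qed.

Lemma Im_le_normc (z : R[i]) : `|complex.Im z| <= Normc.normc z.
Proof.
case: z => a b /=; rewrite -sqrtr_sqr ler_wsqrtr// lerDr sqr_ge0 //.
Qed.

Lemma W_le_ge0 k (v : E3 R -> R[i]) B : W_le k v B -> (0 <= B)%E.
Proof.
have h0 : (ess_sup leb3 (fun x => (Normc.normc (v (id3 x)))%:E) <= B)%E -> (0 <= B)%E.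
  move=> /ess_supP h; rewrite leNgt; apply/negP => B0.
  have : {ae leb3, forall y, (fun _ => 1) (id3 y) <= (0 : R)}.
      apply: filterS h => y /le_lt_trans /(_ B0); rewrite lte_fin => h1.
    have := le_trans (normr_ge0 _) (Re_le_normc (v (id3 y))).
    by rewrite leNgt h1.
  move=> /(@ae_leb3_continuous R (fun _ => 1) 0 (0, 0, 0)).
  by rewrite ler10 => h'; apply: notF; apply: h'; exact: cvg_cst.
by case: k => [|k] [_ _ /h0].
Qed.

Lemma W_le_mono k (v : E3 R -> R[i]) B B' : (B <= B')%E -> W_le k v B -> W_le k v B'.
Proof.
move=> BB; elim: k v => [|k IH] v [m1 m2 es h]; split => //;
  do ?[exact: le_trans es BB].
by move=> j; have [g [wg Wg]] := h j; exists g; split => //; exact: IH.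
Qed.

Lemma W_le_ae k (v : E3 R -> R[i]) (B : R) : W_le k v B%:E ->
  {ae leb3, forall y, Normc.normc (v (id3 y)) <= B}.
Proof.
by case: k => [|k] [_ _ /ess_supP h _]; apply: filterS h => y; rewrite lee_fin.
Qed.

Lemma W_le_bound (v : E3 R -> R[i]) (B : R) (x : E3 R) : W_le 1 v B%:E ->
  continuous (fun x => complex.Re (v x)) -> continuous (fun x => complex.Im (v x)) ->
  `|complex.Re (v x)| <= B /\ `|complex.Im (v x)| <= B.
Proof.
move=> /W_le_ae h cr ci; split.
- apply: (@ae_leb3_continuous R (fun x => `|complex.Re (v x)|)).
    by apply: cvg_norm; exact: cr.
  by apply: filterS h => y /(le_trans (Re_le_normc _)).
- apply: (@ae_leb3_continuous R (fun x => `|complex.Im (v x)|)).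
    by apply: cvg_norm; exact: ci.
  by apply: filterS h => y /(le_trans (Im_le_normc _)).
Qed.

Lemma plane_lip (f : E3 R -> R) (B : R) :
  (forall (j : 'I_3) a b c h, (j < 2)%N -> 0 <= h ->
     `|f (a, b, c) - f ((a, b, c) + h *: e3 R j)| <= B * h) ->
  forall a b a' b' c, `|f (a', b', c) - f (a, b, c)| <= B * (`|a' - a| + `|b' - b|).
Proof.
move=> h a b a' b' c.
have h1 s s' u : `|f (s', u, c) - f (s, u, c)| <= B * `|s' - s|.
  wlog ss : s s' / s <= s'.
    move=> hw; have [/hw//|/ltW ss] := leP s s'.
    by rewrite distrC (distrC s'); exact: hw.
  have := h 0 s u c (s' - s) erefl.
  rewrite subr_ge0 => /(_ ss); rewrite distrC (ger0_norm (x := s' - s)) ?subr_ge0//.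
  suff -> : (s, u, c) + (s' - s) *: e3 R 0 = (s', u, c) :> E3 R by [].
  by congr (_, _, _); rewrite /= /GRing.scale/= ?mulr1 ?mulr0 ?addr0 ?subrKC.
have h2 s u u' : `|f (s, u', c) - f (s, u, c)| <= B * `|u' - u|.
  wlog uu : u u' / u <= u'.
    move=> hw; have [/hw//|/ltW uu] := leP u u'.
    by rewrite distrC (distrC u'); exact: hw.
  have := h 1 s u c (u' - u) erefl.
  rewrite subr_ge0 => /(_ uu); rewrite distrC (ger0_norm (x := u' - u)) ?subr_ge0//.
  suff -> : (s, u, c) + (u' - u) *: e3 R 1 = (s, u', c) :> E3 R by [].
  by congr (_, _, _); rewrite /= /GRing.scale/= ?mulr1 ?mulr0 ?addr0 ?subrKC.
have := h1 a a' b'; have := h2 a b b'.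
have := ler_normD (f (a', b', c) - f (a, b', c)) (f (a, b', c) - f (a, b, c)).
by rewrite addrA subrK mulrDr; lra.
Qed.

Lemma W_le_lip (v : E3 R -> R[i]) (B : R) : W_le 1 v B%:E ->
  continuous (fun x => complex.Re (v x)) -> continuous (fun x => complex.Im (v x)) ->
  forall a b a' b' c,
    `|complex.Re (v (a', b', c)) - complex.Re (v (a, b, c))|
      <= B * (`|a' - a| + `|b' - b|) /\
    `|complex.Im (v (a', b', c)) - complex.Im (v (a, b, c))|
      <= B * (`|a' - a| + `|b' - b|).
Proof.
move=> Wv cr ci a b a' b' c.
have B0 : 0 <= B by have := W_le_ge0 Wv; rewrite lee_fin.
case: Wv => _ _ _ h; split.
- apply: (@plane_lip (fun x => complex.Re (v x))) => j a1 b1 c1 s j2 s0.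
  have [g [[wr _] /(@W_le_ae 0) gB]] := h j.
  apply: (@weak_lip R j (fun x => complex.Re (v x)) _ B a1 b1 c1 s j2 B0 s0 cr wr).
  by apply: filterS gB => y /(le_trans (Re_le_normc _)).
- apply: (@plane_lip (fun x => complex.Im (v x))) => j a1 b1 c1 s j2 s0.
  have [g [[_ wi] /(@W_le_ae 0) gB]] := h j.
  apply: (@weak_lip R j (fun x => complex.Im (v x)) _ B a1 b1 c1 s j2 B0 s0 ci wi).
  by apply: filterS gB => y /(le_trans (Im_le_normc _)).
Qed.

Lemma W_le_S k (v : E3 R -> R[i]) B : W_le k.+1 v B -> W_le k v B.
Proof.
elim: k v => [|k IH] v; first by case.
case=> m1 m2 es h; split => // j.
by have [g [wg /IH Wg]] := h j; exists g.
Qed.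

Lemma Wnorm_ge0 k (v : E3 R -> R[i]) : (0 <= Wnorm k v)%E.
Proof. by apply: le_ereal_inf_tmp => B /W_le_ge0. Qed.

(** The margin between [B] and [B'] avoids asking whether the infimum defining [Wnorm] is
    attained. *)
Lemma Wnorm_lt k (v : E3 R -> R[i]) (B B' : R) :
  (Wnorm k v <= B%:E)%E -> B < B' -> W_le k v B'%:E.
Proof.
move=> h BB'; have /ereal_inf_lt [x Wx xB] : (Wnorm k v < B'%:E)%E.
  by apply: le_lt_trans h _; rewrite lte_fin.
exact: (W_le_mono (ltW xB) Wx).
Qed.

Lemma LinfW_dense (tau : R) (v : E4 R -> R[i]) k (B : R) (t1 t2 : R) : (LinfW tau k v <= B%:E)%E ->
  0 <= t1 -> t1 < t2 -> t2 <= tau ->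
  exists t, t1 < t < t2 /\ (Wnorm k (fun x => v (x, t)) <= B%:E)%E.
Proof.
move=> /ess_supP h t10 t12 t2t.
have [t [tt ht]] := ae_lebesgue_dense t12 h; exists t; split => //.
move: ht; rewrite patchE ifT// inE/= in_itv/=.
by move/andP: tt => [l1 l2]; rewrite (le_lt_trans t10 l1) (lt_le_trans l2 t2t).
Qed.

Lemma LinfW_ge0 (tau : R) (v : E4 R -> R[i]) k : 0 < tau -> (0 <= LinfW tau k v)%E.
Proof.
move=> tau0; rewrite leNgt; apply/negP => /lt_le_trans h.
have h' : (LinfW tau k v <= 0%:E)%E by rewrite ltW//; exact: (h 0%E).
have /ess_supP : (LinfW tau k v <= LinfW tau k v)%E by [].
move=> /(ae_lebesgue_dense tau0) [t [tt ht]].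
move: ht; rewrite leNgt => /negP; apply.
apply: h; rewrite patchE; case: ifP => _ //; exact: Wnorm_ge0.
Qed.

(** On the line the hypothesis bounds the sum of a spatial and a time-derivative norm; nonnegativity
    of the second isolates the first. *)
Lemma LinfW_dt_ge0 (tau : R) (v : E4 R -> R[i]) k : 0 < tau -> (0 <= LinfW_dt tau k v)%E.
Proof.
by move=> tau0; apply: le_ereal_inf_tmp => _ [w _ <-]; exact: (@LinfW_ge0 tau w k tau0).
Qed.

Section Time.
Variables (tau : R) (v : E4 R -> R[i]).

Hypothesis cr : forall p, slab tau p -> {for p, continuous (fun s => complex.Re (v s))}.
Hypothesis ci : forall p, slab tau p -> {for p, continuous (fun s => complex.Im (v s))}.

(** At almost every time the slice has the Sobolev bound, hence the pointwise bounds. If one of them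
    failed at [t], it would fail by continuity just after [t], and such an interval contains good
    times. *)
Lemma LinfW_bounds (B B' : R) : (LinfW tau 2 v <= B%:E)%E -> B < B' ->
  forall t, 0 < t < tau -> forall a b c,
  [/\ `|complex.Re (v (a, b, c, t))| <= B', `|complex.Im (v (a, b, c, t))| <= B',
      forall a' b', `|complex.Re (v (a', b', c, t)) - complex.Re (v (a, b, c, t))|
        <= B' * (`|a' - a| + `|b' - b|) &
      forall a' b', `|complex.Im (v (a', b', c, t)) - complex.Im (v (a, b, c, t))|
        <= B' * (`|a' - a| + `|b' - b|)].
Proof.
move=> hB BB' t /andP[t0 tt] a b c.
have good s : 0 < s < tau -> (Wnorm 2 (fun x => v (x, s)) <= B%:E)%E ->
    forall a b c,
  [/\ `|complex.Re (v (a, b, c, s))| <= B', `|complex.Im (v (a, b, c, s))| <= B',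
      forall a' b', `|complex.Re (v (a', b', c, s)) - complex.Re (v (a, b, c, s))|
        <= B' * (`|a' - a| + `|b' - b|) &
      forall a' b', `|complex.Im (v (a', b', c, s)) - complex.Im (v (a, b, c, s))|
        <= B' * (`|a' - a| + `|b' - b|)].
  move=> hs /(Wnorm_lt) /(_ BB') /W_le_S W1 a1 b1 c1.
  have sec (f : E4 R -> R) : (forall p, slab tau p -> {for p, continuous f}) ->
      continuous (fun x : E3 R => f (x, s)).
    move=> cf x; apply: (@continuous_comp _ _ _ (fun x : E3 R => (x, s)) f).
      exact: continuous_pairl.
    exact: cf.
  have cr' := sec _ cr; have ci' := sec _ ci.
  have [r1 r2] := W_le_bound (a1, b1, c1) W1 cr' ci'.
  split => // a' b'.
  - by have [] := W_le_lip W1 cr' ci' a1 b1 a' b' c1.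
  - by have [] := W_le_lip W1 cr' ci' a1 b1 a' b' c1.
have lim (K : R) (P : forall s : R, R) :
   {for t, continuous P} -> (forall s, 0 < s < tau ->
     (Wnorm 2 (fun x => v (x, s)) <= B%:E)%E -> P s <= K) -> P t <= K.
  move=> cP hP; rewrite leNgt; apply/negP => Kt.
  have : \forall s \near t, K < P s by exact: (cvgr_gt (P t) cP).
  case/nbhs_ballP => r /= r0 hr.
  have [s [/andP[s1 s2] hs]] := @LinfW_dense tau v 2 B t (Num.min (t + r) tau) hB (ltW t0)
     ltac:(by rewrite lt_min tt ltrDl r0) ltac:(by rewrite ge_min lexx orbT).
  move: s2; rewrite lt_min => /andP[s2 s3].
  have /hr : ball t r s by rewrite /ball/= distrC dist_lt//; lra.
  by apply/negP; rewrite -leNgt; apply: hP => //; rewrite s3 (lt_trans t0).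
have ct (f : E4 R -> R) (x : E3 R) : (forall p, slab tau p -> {for p, continuous f}) ->
    {for t, continuous (fun s => f (x, s))}.
  move=> cf; apply: (@continuous_comp _ _ _ (fun s : R => (x, s)) f).
    exact: continuous_pairr.
  by apply: cf; rewrite /slab/= t0.
split.
- apply: (lim _ (fun s => `|complex.Re (v (a, b, c, s))|)).
    exact: (cvg_norm (ct (fun s => complex.Re (v s)) (a, b, c) cr)).
  by move=> s hs hW; have [] := good s hs hW a b c.
- apply: (lim _ (fun s => `|complex.Im (v (a, b, c, s))|)).
    exact: (cvg_norm (ct (fun s => complex.Im (v s)) (a, b, c) ci)).
  by move=> s hs hW; have [] := good s hs hW a b c.
- move=> a' b'.
  apply: (lim _ (fun s => `|complex.Re (v (a', b', c, s)) - complex.Re (v (a, b, c, s))|)).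
    exact: (cvg_norm (cvgB (ct (fun s => complex.Re (v s)) (a', b', c) cr)
      (ct (fun s => complex.Re (v s)) (a, b, c) cr))).
  by move=> s hs hW; have [] := good s hs hW a b c.
- move=> a' b'.
  apply: (lim _ (fun s => `|complex.Im (v (a', b', c, s)) - complex.Im (v (a, b, c, s))|)).
    exact: (cvg_norm (cvgB (ct (fun s => complex.Im (v s)) (a', b', c) ci)
      (ct (fun s => complex.Im (v s)) (a, b, c) ci))).
  by move=> s hs hW; have [] := good s hs hW a b c.
Qed.

End Time.

End SobolevBounds.

(** * Zeros of perturbed quadratic polynomials *)

Section Modulus.
Variable R : realType.
Implicit Types z w : R[i].
Local Notation N := (@Normc.normc R).

Lemma normcB_le z w : N (z - w) <= N z + N w.
Proof. by rewrite -(normcN w); exact: le_normcD. Qed.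

Lemma normcB_sym z w : N (z - w) = N (w - z).
Proof. by rewrite -normcN opprB. Qed.

Lemma normc_ge0 z : 0 <= N z.
Proof. by case: z => a b; exact: sqrtr_ge0. Qed.

Lemma normc_sqr z : N z ^+ 2 = complex.Re z ^+ 2 + complex.Im z ^+ 2.
Proof. by case: z => a b /=; rewrite sqr_sqrtr// addr_ge0 ?sqr_ge0. Qed.

Lemma normcX2 z : N (z ^+ 2) = N z ^+ 2.
Proof. by rewrite !expr2 Normc.normcM. Qed.

Lemma normcR (x : R) : N x%:C = `|x|.
Proof. by rewrite /= expr0n/= addr0 sqrtr_sqr. Qed.

Lemma normc_le_abs z : N z <= `|complex.Re z| + `|complex.Im z|.
Proof.
rewrite -(@ler_pXn2r _ 2) ?nnegrE ?normc_ge0 ?addr_ge0// normc_sqr.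
rewrite -(real_normK (num_real (complex.Re z))) -(real_normK (num_real (complex.Im z))).
have := mulr_ge0 (normr_ge0 (complex.Re z)) (normr_ge0 (complex.Im z)).
by rewrite sqrrD; lra.
Qed.

Lemma normc_dist z w : `|N z - N w| <= N (z - w).
Proof.
have h1 := le_normcD (z - w : Rcomplex R) w; have h2 := le_normcD (w - z : Rcomplex R) z.
rewrite ler_norml; apply/andP; split; move: h1 h2; rewrite !subrK (normcB_sym w z); lra.
Qed.

(** * Zeros near 0 of a small Lipschitz perturbation of w + w^2 *)

Section Quadratic.
Variable G : R[i] -> R[i].
Hypothesis G_small : forall w, N w <= 8^-1 -> N (G w) <= 64^-1.
Hypothesis G_lip : forall w w', N w <= 8^-1 -> N w' <= 8^-1 ->
  N (G w - G w') <= 8^-1 * N (w - w').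
Local Notation F w := (w + w ^+ 2 + G w).

Let sqr_lip w w' : N w <= 8^-1 -> N w' <= 8^-1 ->
  N (w ^+ 2 - w' ^+ 2) <= 4^-1 * N (w - w').
Proof.
move=> h h'; rewrite subr_sqr Normc.normcM mulrC ler_wpM2r ?normc_ge0//.
by apply: le_trans (le_normcD _ _) _; lra.
Qed.

(** A zero satisfies w = - w^2 - G w, so |w| <= 1/64 + 1/64. The zero-free annulus between radii
    1/32 and 1/8 is what later confines the lifts. *)
Lemma quad_small w : N w <= 8^-1 -> F w = 0 -> N w <= 32^-1.
Proof.
move=> h E; have -> : w = - (w ^+ 2) - G w.
  by apply/eqP; rewrite -subr_eq0 -E; apply/eqP; ring.
apply: le_trans (normcB_le _ _) _; rewrite normcN normcX2.
have := G_small h; have : N w ^+ 2 <= 8^-1 ^+ 2.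
  by rewrite ler_pXn2r ?nnegrE ?normc_ge0// invr_ge0 ler0n.
by lra.
Qed.

(** On the disc w^2 and G have Lipschitz constants 1/4 and 1/8, so [F] differs from the identity by
    a contraction and |F w| controls the distance to a zero. This yields both uniqueness of the zero
    and its continuity in a parameter. *)
Lemma quad_dist w w' : N w <= 8^-1 -> N w' <= 8^-1 -> F w' = 0 ->
  N (w - w') <= 2 * N (F w).
Proof.
move=> h h' E.
have : N (w - w') <= N (F w) + N (w ^+ 2 - w' ^+ 2) + N (G w - G w').
  have -> : w - w' = F w - F w' - (w ^+ 2 - w' ^+ 2) - (G w - G w') by ring.
  rewrite E subr0; apply: le_trans (normcB_le _ _) _; rewrite lerD2r.
  exact: normcB_le.
have := sqr_lip h h'; have := G_lip h h'; have := normc_ge0 (F w); lra.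
Qed.

(* A minimiser of [|F|] over a compact box is a zero, since replacing w by
   [- w^2 - G w] contracts [|F|]. *)
Lemma quad_zero : exists w, N w <= 8^-1 /\ F w = 0.
Proof.
pose z (x : E2 R) : R[i] := x.1 +i* x.2.
(* The square of half-side 1/16 fits between two discs: it lies in the disc of radius 1/8, where [G]
   is controlled, and contains the one of radius 1/32, where the improved point [w'] lies. *)
have box x : cball (R * R)%type 16^-1 x -> N (z x) <= 8^-1.
  rewrite /cball/= prod_normE/= ge_max => /andP[h1 h2].
  by apply: le_trans (normc_le_abs (z x)) _; rewrite /z/=; lra.
have zlip x y : N (z x - z y) <= 2 * `|x - y|.
  apply: le_trans (normc_le_abs (z x - z y)) _; rewrite /z/= prod_normE/=.
  have : `|x.1 - y.1| <= Num.max `|x.1 - y.1| `|x.2 - y.2| by rewrite le_max lexx.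
  have : `|x.2 - y.2| <= Num.max `|x.1 - y.1| `|x.2 - y.2| by rewrite le_max lexx orbT.
  by lra.
pose f x := N (F (z x)).
have flip x y : cball (R * R)%type 16^-1 x -> cball (R * R)%type 16^-1 y ->
    `|f x - f y| <= 4 * `|x - y|.
  move=> hx hy; apply: le_trans (normc_dist _ _) _.
  have -> : F (z x) - F (z y) = (z x - z y) + (z x ^+ 2 - z y ^+ 2) + (G (z x) - G (z y)) by ring.
  have := le_normcD ((z x - z y) + (z x ^+ 2 - z y ^+ 2) : Rcomplex R) (G (z x) - G (z y)).
  have := le_normcD (z x - z y : Rcomplex R) (z x ^+ 2 - z y ^+ 2).
  have := sqr_lip (box _ hx) (box _ hy); have := G_lip (box _ hx) (box _ hy).
  have := zlip x y; have := normc_ge0 (z x - z y); lra.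
have cf : {within cball (R * R)%type 16^-1, continuous f}.
  apply/subspace_continuousP => x Kx; apply/cvgrPdist_le => e e0; near=> y.
  apply: le_trans (flip _ _ Kx _) _; first by near: y; exact: withinT.
  rewrite mulrC -ler_pdivlMr//.
  have : ball x (e / 4) y.
    by near: y; apply: cvg_within; apply: nbhsx_ballx; rewrite divr_gt0.
  by case; rewrite /ball/= prod_normE/= ge_max => /ltW -> /ltW ->.
have ne : cball (R * R)%type (16^-1 : R) !=set0.
  by exists 0; rewrite /cball/= normr0 invr_ge0.
have [x xK xmin] := compact_EVT_min ne ((tame2 R).2 16^-1).1 cf.
move: xK; rewrite inE => xK; exists (z x); split; first exact: box.
set w := z x; have hw := box _ xK.
pose w' : R[i] := - w ^+ 2 - G w.
have hw' : N w' <= 32^-1.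
  apply: le_trans (normcB_le _ _) _; rewrite normcN normcX2.
  have := G_small hw; have : N w ^+ 2 <= 8^-1 ^+ 2.
    by rewrite ler_pXn2r ?nnegrE ?normc_ge0// invr_ge0 ler0n.
  by lra.
have hw'8 : N w' <= 8^-1 by lra.
have w'K : cball (R * R)%type 16^-1 (complex.Re w', complex.Im w').
  rewrite /cball/= prod_normE/= ge_max; apply/andP; split.
  - by have := Re_le_normc w'; lra.
  - by have := Im_le_normc w'; lra.
have zw' : z (complex.Re w', complex.Im w') = w' by rewrite /z/=; case: (w').
have := xmin (complex.Re w', complex.Im w'); rewrite inE => /(_ w'K).
rewrite /f zw' -/w => m1.
(* The correction from w to w' has size |F w|, and F w' = (w'^2 - w^2) + (G w' - G w) is at most 3/8
   of it; minimality of |F w| then forces F w = 0. *)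
have Fw : N (w' - w) = N (F w).
  by rewrite normcB_sym; congr N; rewrite /w'; ring.
have : N (F w') <= N (w' ^+ 2 - w ^+ 2) + N (G w' - G w).
  have -> : F w' = (w' ^+ 2 - w ^+ 2) + (G w' - G w) by rewrite {1}/w'; ring.
  exact: le_normcD.
have := sqr_lip hw'8 hw; have := G_lip hw'8 hw; rewrite Fw => a1 a2 a3.
by apply: Normc.eq0_normc; apply/le_anti; rewrite normc_ge0 andbT; lra.
Unshelve. all: by end_near. Qed.

End Quadratic.

End Modulus.

Lemma continuous_dist (R : realType) (f : R -> R) (t e : R) :
  {for t, continuous f} -> 0 < e ->
  exists2 d, 0 < d & forall u, `|u - t| < d -> `|f u - f t| < e.
Proof.
move=> cf e0; have := @cvgr_dist_lt _ _ _ (nbhs t) _ f (f t) cf _ e0.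
move=> /(_ _)/nbhs_ballP [d /= d0 hd]; exists d => // u ut.
by rewrite distrC; apply: hd; rewrite /ball/= distrC.
Qed.

(** * Continuous lifts of a single zero along the path *)

Section Lift.
Variables (R : realType) (Phi : E4 R -> R[i]) (Gam : R -> E2 R) (t0 t1 : R)
  (c s : R -> R[i]) (sg R0 E0 : R) (E : R -> R[i] -> R).
Local Notation N := (@Normc.normc R).
Local Notation H t z := (at_point Phi z (Gam t)).
Local Notation eta t z := ((E t z)%:C * H t z - (z - c t) * (z - c t + s t)).
Local Notation I t := (t0 <= t <= t1).

Hypothesis t01 : t0 <= t1.
Hypothesis sg0 : 0 < sg.
Hypothesis cr : continuous (fun t => complex.Re (c t)).
Hypothesis ci : continuous (fun t => complex.Im (c t)).
Hypothesis Ns : forall t, N (s t) = sg.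
Hypothesis hR : forall t, I t -> N (c t) + sg <= R0.
Hypothesis hE : forall t z, I t -> N z <= R0 -> 0 < E t z <= E0.
Hypothesis eta_small : forall t z, I t -> N z <= R0 -> N (eta t z) <= sg ^+ 2 / 64.
Hypothesis eta_lip : forall t z z', I t -> N z <= R0 -> N z' <= R0 ->
  N (eta t z - eta t z') <= sg / 8 * N (z - z').
Hypothesis Hcont : forall t z e, I t -> 0 < e -> exists2 d, 0 < d &
  forall t', I t' -> `|t' - t| < d -> N (H t' z - H t z) < e.

Let s0 t : s t != 0.
Proof.
apply/eqP => s00; have := Ns t; rewrite s00 Normc.normc0 => h.
by move: sg0; rewrite -h ltxx.
Qed.

Let inR t z : I t -> N (z - c t) <= sg / 8 -> N z <= R0.
Proof.
move=> It h; have := hR It; have := le_normcD (z - c t : Rcomplex R) (c t).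
by rewrite subrK; have := sg0; lra.
Qed.

(** The substitution z = c + s w, with s the separation of the two approximate roots, sends c to 0
    and c - s to -1, and turns E H / s^2 into w + w^2 + G. *)
Let G t w : R[i] := eta t (c t + s t * w) / s t ^+ 2.

Let inG t w : I t -> N w <= 8^-1 -> N (c t + s t * w) <= R0.
Proof.
move=> It h; apply: (@inR t) => //; rewrite addrC addKr Normc.normcM Ns.
by rewrite ler_pM2l.
Qed.

Let G_small t w : I t -> N w <= 8^-1 -> N (G t w) <= 64^-1.
Proof.
move=> It h; rewrite /G Normc.normcM Normc.normcV normcX2 Ns ler_pdivrMr ?exprn_gt0//.
by rewrite [leRHS]mulrC; apply: eta_small => //; exact: inG.
Qed.

Let G_lip t w w' : I t -> N w <= 8^-1 -> N w' <= 8^-1 ->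
  N (G t w - G t w') <= 8^-1 * N (w - w').
Proof.
move=> It h h'; rewrite /G -mulrBl Normc.normcM Normc.normcV normcX2 Ns.
rewrite ler_pdivrMr ?exprn_gt0//.
apply: le_trans (eta_lip It (inG It h) (inG It h')) _.
have -> : c t + s t * w - (c t + s t * w') = s t * (w - w') by ring.
by rewrite Normc.normcM Ns; lra.
Qed.

Let FE t w : w + w ^+ 2 + G t w = (E t (c t + s t * w))%:C * H t (c t + s t * w) / s t ^+ 2.
Proof.
rewrite /G; set h := _%:C * _; field; exact: s0.
Qed.

Let Fzero t z : H t z = 0 ->
  let w := (z - c t) / s t in w + w ^+ 2 + G t w = 0.
Proof.
move=> Hz w; rewrite FE; have -> : c t + s t * w = z by rewrite mulrC divfK ?subrKC.
by rewrite Hz mulr0 mul0r.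
Qed.

Let Nw t z (k : R) : N (z - c t) <= sg * k -> N ((z - c t) / s t) <= k.
Proof. by rewrite Normc.normcM Normc.normcV Ns ler_pdivrMr// mulrC. Qed.

Lemma disc_zero t : I t -> exists z, N (z - c t) <= sg / 8 /\ H t z = 0.
Proof.
move=> It; have [w [hw Fw]] := quad_zero (fun w => @G_small t w It) (fun w w' => @G_lip t w w' It).
exists (c t + s t * w); split.
  by rewrite addrC addKr Normc.normcM Ns ler_pM2l.
move/eqP: Fw; rewrite FE !mulf_eq0 invr_eq0 expf_eq0/= (negbTE (s0 t)) orbF.
case/orP => [|/eqP//]; have /andP[E_gt0 _] := hE It (inG It hw).
by move=> /eqP [/eqP]; rewrite gt_eqF.
Qed.

Lemma disc_small t z : I t -> N (z - c t) <= sg / 8 -> H t z = 0 ->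
  N (z - c t) <= sg / 32.
Proof.
move=> It h Hz; have := quad_small (fun w => @G_small t w It) (Nw h) (Fzero Hz).
by rewrite Normc.normcM Normc.normcV Ns ler_pdivrMr// mulrC.
Qed.

Lemma disc_dist t z z' : I t -> N (z - c t) <= sg / 8 -> N (z' - c t) <= sg / 8 ->
  H t z' = 0 -> N (z - z') <= 2 * E0 / sg * N (H t z).
Proof.
move=> It h h' Hz.
have := quad_dist (fun w w' => @G_lip t w w' It) (Nw h) (Nw h') (Fzero Hz).
rewrite FE -mulrBl; have -> : c t + s t * ((z - c t) / s t) = z.
  by rewrite mulrC divfK ?subrKC.
have -> : z - c t - (z' - c t) = z - z' by ring.
rewrite !Normc.normcM !Normc.normcV normcX2 Ns normcR ler_pdivrMr//.
have /andP[E_gt0 EE0] := hE It (inR It h).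
rewrite gtr0_norm// => /le_trans; apply.
have -> : 2 * (E t z * N (H t z) / sg ^+ 2) * sg = 2 / sg * N (H t z) * E t z.
  by field; rewrite gt_eqF.
have -> : 2 * E0 / sg * N (H t z) = 2 / sg * N (H t z) * E0 by ring.
by rewrite ler_wpM2l// mulr_ge0 ?normc_ge0// divr_ge0// ltW.
Qed.

Lemma disc_unique t z z' : I t -> N (z - c t) <= sg / 8 -> N (z' - c t) <= sg / 8 ->
  H t z = 0 -> H t z' = 0 -> z = z'.
Proof.
move=> It h h' Hz Hz'; have := disc_dist It h h' Hz'; rewrite Hz Normc.normc0 mulr0 => le0.
have /Normc.eq0_normc /eqP : N (z - z') = 0 by apply/le_anti; rewrite le0 normc_ge0.
by rewrite subr_eq0 => /eqP.
Qed.

(** The zero in the disc is chosen separately at each [t]; continuity is a consequence of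
    [disc_dist]. The old zero [zeta t] is tested in the new equation at [t'], so continuity of [H]
    in the parameter at a fixed point suffices. *)
Lemma lift_exists z1 : N (z1 - c t0) <= sg / 8 -> H t0 z1 = 0 ->
  exists zeta, zero_lift Phi t0 t1 Gam z1 zeta /\
    forall t, I t -> N (zeta t - c t) <= sg / 8.
Proof.
move=> h1 Hz1.
have ex t : exists z, I t -> N (z - c t) <= sg / 8 /\ H t z = 0.
  have [It|nI] := boolP (I t); last by exists 0.
  by have [z hz] := disc_zero It; exists z.
have [zeta hz] := choice ex.
have E00 : 0 <= E0.
  have It0 : I t0 by rewrite lexx t01.
  by have /andP[h h'] := hE It0 (inR It0 h1); exact: le_trans (ltW h) h'.
have cz t e : I t -> 0 < e -> exists2 d, 0 < d & forall t', I t' -> `|t' - t| < d ->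
    N (zeta t - zeta t') <= e.
  move=> It e0; have [zt Ht] := hz t It.
  have Ke : 0 < e / (2 * E0 / sg + 1).
    by rewrite divr_gt0// ltr_wpDl// divr_ge0 ?mulr_ge0// ltW.
  have [d1 d10 hd1] := Hcont (zeta t) It Ke.
  have sg32 : 0 < sg / 32 by rewrite divr_gt0.
  have [d2 d20 hd2] := continuous_dist (@cr t) sg32.
  have [d3 d30 hd3] := continuous_dist (@ci t) sg32.
  exists (Num.min d1 (Num.min d2 d3)); first by rewrite !lt_min d10 d20.
  move=> t' It'; rewrite !lt_min => /and3P[a1 a2 a3].
  have [zt' Ht'] := hz t' It'.
  (* The zero at [t] is within sg / 32 of its centre and the centre moves by at most sg / 16, so the
     old zero still lies in the disc of radius sg / 8 around the new centre. *)
  have cc : N (c t - c t') <= sg / 16.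
    apply: le_trans (normc_le_abs _) _; rewrite !raddfB.
    have := hd2 t' a2; have := hd3 t' a3; rewrite distrC => b2; rewrite distrC => b3.
    by move: b2 b3; lra.
  have zt2 : N (zeta t - c t') <= sg / 8.
    have := disc_small It zt Ht.
    have := le_normcD (zeta t - c t : Rcomplex R) (c t - c t'); rewrite addrA subrK.
    by have := sg0; lra.
  apply: le_trans (disc_dist It' zt2 zt' Ht') _.
  have := ltW (hd1 t' It' a1); rewrite Ht subr0 => hH.
  apply: le_trans (ler_wpM2l _ hH) _; first by rewrite divr_ge0 ?mulr_ge0// ltW.
  rewrite mulrCA -[leRHS]mulr1 ler_pM2l// ler_pdivrMr ?mul1r ?lerDl//.
  by rewrite ltr_wpDl// divr_ge0 ?mulr_ge0// ltW.
have within_part (f : R[i] -> R) : (forall z w, `|f z - f w| <= N (z - w)) ->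
    {within `[t0, t1], continuous (fun t => f (zeta t))}.
  move=> fN; apply/subspace_continuousP => t It.
  have {}It : I t by move: It; rewrite /= in_itv.
  apply/cvgrPdist_le => e e0; have [d d0 hd] := cz t e It e0.
  near=> t'; apply: le_trans (fN _ _) _; apply: hd.
    by have : `[t0, t1]%classic t' by [near: t'; exact: withinT]; rewrite /= in_itv.
  have : ball t d t' by near: t'; apply: cvg_within; exact: nbhsx_ballx.
  by rewrite /ball/= distrC.
exists zeta; split; last by move=> t /hz [].
split.
- by apply: within_part => z w; rewrite -raddfB; exact: Re_le_normc.
- by apply: within_part => z w; rewrite -raddfB; exact: Im_le_normc.
- have It0 : I t0 by rewrite lexx t01.
  by have [h Hz] := hz t0 It0; exact: (disc_unique It0).
- by move=> t /hz [].
Unshelve. all: by end_near. Qed.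

(* A lift cannot cross the annulus [sg / 32 < |z - c| <= sg / 8]. *)
Lemma lift_confined z1 zeta : N (z1 - c t0) <= sg / 8 ->
  zero_lift Phi t0 t1 Gam z1 zeta -> forall t, I t -> N (zeta t - c t) <= sg / 8.
Proof.
move=> h1 [zr zi zt0 Hz] t /andP[t0t tt1]; rewrite leNgt; apply/negP => far.
pose f u := (complex.Re (zeta u) - complex.Re (c u)) ^+ 2
  + (complex.Im (zeta u) - complex.Im (c u)) ^+ 2.
have fE u : f u = N (zeta u - c u) ^+ 2 by rewrite normc_sqr !raddfB.
have sub : `[t0, t] `<=` `[t0, t1].
  by move=> u /=; rewrite !in_itv/= => /andP[-> /le_trans]; apply.
have cf : {within `[t0, t], continuous f}.
  have zr' := continuous_subspaceW sub zr; have zi' := continuous_subspaceW sub zi.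
  have cr' : {within `[t0, t], continuous (fun u => complex.Re (c u))} := continuous_subspaceT cr.
  have ci' : {within `[t0, t], continuous (fun u => complex.Im (c u))} := continuous_subspaceT ci.
  move=> u; apply: cvgD; rewrite expr2; apply: cvgM; apply: cvgB;
    (exact: zr' || exact: zi' || exact: cr' || exact: ci').
have It0 : I t0 by rewrite lexx t01.
have Hz1 : H t0 z1 = 0 by rewrite -zt0; exact: Hz.
have small := disc_small It0 h1 Hz1.
(* The radius sg / 16 lies in the forbidden annulus; a lift that left the disc would attain it by
   the intermediate value theorem, contradicting [disc_small]. *)
have f0 : f t0 <= (sg / 16) ^+ 2.
  rewrite fE zt0 ler_pXn2r ?nnegrE ?normc_ge0//; last by rewrite divr_ge0// ltW.
  by have := sg0; lra.
have ft : (sg / 16) ^+ 2 <= f t.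
  rewrite fE ler_pXn2r ?nnegrE ?normc_ge0//; last by rewrite divr_ge0// ltW.
  by have := sg0; lra.
have [|u] := IVT t0t cf (v := (sg / 16) ^+ 2); first by rewrite ge_min f0 le_max ft orbT.
rewrite in_itv/= fE => /andP[t0u ut] /eqP.
rewrite eqrXn2 ?normc_ge0// ?divr_ge0 ?ltW// => /eqP Nu.
have Iu : I u by rewrite t0u (le_trans ut).
have := disc_small Iu _ (Hz u Iu); rewrite Nu => h.
by have := sg0; have := h ltac:(by have := sg0; lra); lra.
Qed.

Lemma lift_unique z1 zeta zeta' : N (z1 - c t0) <= sg / 8 ->
  zero_lift Phi t0 t1 Gam z1 zeta -> zero_lift Phi t0 t1 Gam z1 zeta' ->
  forall t, I t -> zeta' t = zeta t.
Proof.
move=> h1 L L' t It; have [_ _ _ Hz] := L; have [_ _ _ Hz'] := L'.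
by apply: (disc_unique It); [exact: lift_confined L' _ It|exact: lift_confined L _ It
  |exact: Hz'|exact: Hz].
Qed.

End Lift.

(** * Bounds uniform in the moduli *)

Section CompactBounds.
Variables (R : realType) (T : topologicalType).

Lemma compact_bound (f : T -> R) (K : set T) : compact K -> continuous f ->
  exists M, 0 <= M /\ forall x, K x -> `|f x| <= M.
Proof.
move=> cK cf.
have cfK : compact (f @` K).
  by apply: continuous_compact => //; exact: continuous_subspaceT.
have [M [_ hM]] := compact_bounded cfK.
exists (`|M| + 1); split; first by rewrite addr_ge0.
move=> x Kx; apply: (hM (`|M| + 1)); last by exists x.
by have := ler_norm M; lra.
Qed.

Lemma compact_pos_lower (f : T -> R) (K : set T) : compact K -> continuous f ->
  (forall x, K x -> 0 < f x) -> exists m, 0 < m /\ forall x, K x -> m <= f x.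
Proof.
move=> cK cf fp; have [[x0 Kx0]|/nonemptyPn K0] := pselect (K !=set0).
  have [c + hc] := compact_EVT_min (ex_intro _ x0 Kx0) cK (continuous_subspaceT cf).
  rewrite inE => Kc; exists (f c); split; first exact: fp.
  by move=> x Kx; apply: hc; rewrite inE.
by exists 1; split => // x; rewrite K0.
Qed.

End CompactBounds.

Section Family.
Variable R : realType.
Local Notation M2 := 'rV[R]_4.
Local Notation N := (@Normc.normc R).
Variables (phi : M2 -> E2 R -> R[i]) (A : M2 -> 'I_2 -> E2 R -> R).
Hypothesis fam : vortex_family phi A.

(** The quadratic formula, with Cauchy's bound: a root with |w| > 1 satisfies |w|^2 <= (|q1| + |q2|)
    |w|. *)
Lemma vpoly_roots (q : M2) : exists r s : R[i],
  (forall z, vpoly q z = (z - r) * (z - s)) /\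
  N r <= 1 + N (cq1 q) + N (cq2 q) /\ N s <= 1 + N (cq1 q) + N (cq2 q).
Proof.
pose D := cq1 q ^+ 2 - 4 * cq2 q; pose S := sqrtc D.
pose r := (- cq1 q + S) / 2; pose s := (- cq1 q - S) / 2.
have rs z : vpoly q z = (z - r) * (z - s).
  have SS : S ^+ 2 = cq1 q ^+ 2 - 4 * cq2 q := sqr_sqrtc D.
  have -> : (z - r) * (z - s) = z ^+ 2 + cq1 q * z + (cq1 q ^+ 2 - S ^+ 2) / 4.
    by rewrite /r /s; field.
  by rewrite SS /vpoly; field.
have bound w : vpoly q w = 0 -> N w <= 1 + N (cq1 q) + N (cq2 q).
  move=> w0; rewrite leNgt; apply/negP => lt.
  have n1 := normc_ge0 (cq1 q); have n2 := normc_ge0 (cq2 q).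
  have w1 : 1 < N w by lra.
  have : N w * N w <= (N (cq1 q) + N (cq2 q)) * N w.
    have -> : N w * N w = N (cq1 q * w + cq2 q).
      rewrite -Normc.normcM -(normcN (_ + _)); congr N; apply/eqP.
      by rewrite -subr_eq0 opprK addrA -w0 /vpoly expr2.
    apply: le_trans (le_normcD _ _) _; rewrite Normc.normcM mulrDl lerD2l.
    by rewrite ler_peMr// ltW.
  rewrite ler_pM2r; last by lra.
  by lra.
exists r, s; split => //; split; apply: bound; rewrite rs subrr ?mul0r ?mulr0//.
Qed.

Lemma family_factor (q : M2) (r s : R[i]) :
  (forall z, vpoly q z = (z - r) * (z - s)) ->
  exists g : E2 R -> R, [/\ forall x, 0 < g x,
    forall x, complex.Re (phi q x) = g x *
      polyRe (complex.Re r) (complex.Im r) (complex.Re s) (complex.Im s) x &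
    forall x, complex.Im (phi q x) = g x *
      polyIm (complex.Re r) (complex.Im r) (complex.Re s) (complex.Im s) x].
Proof.
move=> rs; have [H _] := fam; have [_ _ [f hf]] := H q.
pose h (x : E2 R) := Num.sqrt (1 + normsq (vpoly q (x.1 +i* x.2))).
have h0 x : 0 < h x by rewrite sqrtr_gt0 ltr_pwDl// normsqE addr_ge0 ?sqr_ge0.
have E x : phi q x = (f x / h x)%:C * ((x.1 +i* x.2 - r) * (x.1 +i* x.2 - s)).
  have [_ ->] := hf x; rewrite -rs mulrAC rmorphM/= fmorphV//.
exists (fun x => f x / h x); split => x.
- by have [f0 _] := hf x; rewrite divr_gt0.
- by rewrite E /polyRe; case: r {rs E} => r1 r2; case: s => s1 s2 /=; ring.
- by rewrite E /polyIm; case: r {rs E} => r1 r2; case: s => s1 s2 /=; ring.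
Qed.

(** With [X] above all the roots, [(X, X)] is a generic point common to all moduli in a compact set.
    Each coordinate difference is at most 2X, whence 8 X^2. *)
Lemma distsq_far (X : R) (w : R[i]) : 0 < X -> N w <= X - 1 ->
  [/\ X != complex.Re w, X != complex.Im w,
    0 < distsq (complex.Re w) (complex.Im w) (X, X) &
    distsq (complex.Re w) (complex.Im w) (X, X) <= 8 * X ^+ 2].
Proof.
move=> X0 wX; have := le_trans (Re_le_normc w) wX; have := le_trans (Im_le_normc w) wX.
rewrite !ler_norml => /andP[i1 i2] /andP[e1 e2].
have sq (v : R) : - (X - 1) <= v -> v <= X - 1 -> (X - v) ^+ 2 <= 4 * X ^+ 2.
  move=> v1 v2; have -> : 4 * X ^+ 2 = (2 * X) ^+ 2 by rewrite exprMn -natrX.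
  by rewrite ler_pXn2r ?nnegrE//; lra.
split; [by rewrite gt_eqF//; lra|by rewrite gt_eqF//; lra| |].
- by rewrite /distsq ltr_wpDr ?sqr_ge0// exprn_gt0//=; lra.
- by rewrite /distsq/=; have := sq _ e1 e2; have := sq _ i1 i2; lra.
Qed.

Lemma continuous_usq (x : E2 R) :
  continuous (fun q : M2 => usq (fun x => complex.Re (phi q x)) (fun x => complex.Im (phi q x)) x).
Proof.
have [_ [sR sI _]] := fam; have cR := (sR 0%N).1; have cI := (sI 0%N).1.
have sec (f : E2 R * M2 -> R) : continuous f -> continuous (fun q => f (x, q)).
  move=> cf q; apply: (@continuous_comp _ _ _ (fun q => (x, q)) f); last exact: cf.
  exact: continuous_pairr.
move=> q; have hR := sec _ cR q; have hI := sec _ cI q.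
exact: (cvgD (cvgM hR hR) (cvgM hI hI)).
Qed.

(** The estimates of [log_factor] depend on q only through the size of the connection on a square
    and a bound for - log g at one base point. Both are uniform by compactness, since the fields are
    jointly continuous in x and q. *)
Lemma uniform_gauge (K : set M2) (R0 : R) : compact K -> exists E0 L : R,
  [/\ 0 < E0, 0 <= L & forall q, K q -> exists E : R[i] -> R,
    [/\ forall z, N z <= R0 -> 0 < E z <= E0,
        forall z, N z <= R0 -> (E z)%:C * phi q (complex.Re z, complex.Im z) = vpoly q z &
        forall z z', N z <= R0 -> N z' <= R0 -> `|E z - E z'| <= L * N (z - z')]].
Proof.
move=> cK; have hb i := compact_bound cK (@coord_continuous R 1 4 0 i).
have [Q0 [Q00 hQ0]] := hb 0; have [Q1 [Q10 hQ1]] := hb 1.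
have [Q2 [Q20 hQ2]] := hb 2; have [Q3 [Q30 hQ3]] := hb 3.
pose Qb := 1 + (Q0 + Q1 + Q2 + Q3).
have Qb1 : 1 <= Qb by rewrite /Qb; lra.
pose X := 2 + 4 * Qb.
have rootX (q : M2) (r : R[i]) : K q -> N r <= 1 + N (cq1 q) + N (cq2 q) -> N r <= X - 1.
  move=> Kq /le_trans; apply.
  have := normc_le_abs (cq1 q); have := normc_le_abs (cq2 q); rewrite /cq1 /cq2 /=.
  have := hQ0 q Kq; have := hQ1 q Kq; have := hQ2 q Kq; have := hQ3 q Kq.
  by rewrite /X /Qb; lra.
pose x0 : E2 R := (X, X).
(* The summand [X] puts the base point in the square; the 1 keeps the disc of radius [R0] strictly
   inside, as the identity E phi = p of [log_factor] requires. *)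
pose n := `|R0| + X + 1.
have X0 : 0 < X by rewrite /X; lra.
have nx0 : `|x0| <= n.
  by rewrite prod_normE/= ge_max !gtr0_norm// !andbb /n; have := normr_ge0 R0; lra.
have [_ [_ _ sA]] := fam.
have cA b := (sA b 0%N).1.
have cKn : compact (cball (R * R)%type n `*` K).
  by apply: compact_setX => //; exact: ((tame2 R).2 n).1.
have [M0 [M00 hM0]] := compact_bound cKn (cA 0).
have [M1 [M10 hM1]] := compact_bound cKn (cA 1).
pose M := M0 + M1.
have u_pos q : K q -> 0 < usq (fun x => complex.Re (phi q x)) (fun x => complex.Im (phi q x)) x0.
  move=> Kq; have [r [s [rs [Nr Ns]]]] := vpoly_roots q.
  have [g [g0 ag bg]] := family_factor rs.
  have rX := rootX _ _ Kq Nr; have sX := rootX _ _ Kq Ns.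
  have -> : usq (fun x => complex.Re (phi q x)) (fun x => complex.Im (phi q x)) x0 =
     g x0 ^+ 2 * (distsq (complex.Re r) (complex.Im r) x0 * distsq (complex.Re s) (complex.Im s) x0).
    by rewrite /usq ag bg /polyRe /polyIm /distsq; ring.
  have [_ _ f1 _] := distsq_far X0 rX; have [_ _ f2 _] := distsq_far X0 sX.
  by rewrite !mulr_gt0 ?exprn_gt0.
have [m [m0 hm]] := compact_pos_lower cK (@continuous_usq x0) u_pos.
(* At the base point - log g is half of log |p|^2 - log |phi|^2, where |p|^2 <= 64 X^4 by
   [distsq_far] and |phi|^2 >= m by compactness. *)
pose kappa := 2^-1 * (ln (64 * X ^+ 4) - ln m).
pose E0 := expR (kappa + 4 * M * n).
have M_ge0 : 0 <= M by rewrite addr_ge0.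
exists E0, (E0 * M * 2); split; first exact: expR_gt0.
  by rewrite !mulr_ge0// expR_ge0.
move=> q Kq; have [r [s [rs [Nr Ns]]]] := vpoly_roots q.
have [g [g0 ag bg]] := family_factor rs.
have rX := rootX _ _ Kq Nr; have sX := rootX _ _ Kq Ns.
have hA0 x : `|x| <= n -> `|A q 0 x| <= M.
  by move=> xn; apply: le_trans (hM0 (x, q) (conj xn Kq)) _; rewrite lerDl.
have hA1 x : `|x| <= n -> `|A q 1 x| <= M.
  by move=> xn; apply: le_trans (hM1 (x, q) (conj xn Kq)) _; rewrite lerDr.
have [f1 f2 f3 f4] := distsq_far X0 rX; have [f5 f6 f7 f8] := distsq_far X0 sX.
have gen : generic (complex.Re r) (complex.Im r) (complex.Re s) (complex.Im s) x0 by split.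
have hk : - logmod (fun x => complex.Re (phi q x)) (fun x => complex.Im (phi q x))
    (complex.Re r) (complex.Im r) (complex.Re s) (complex.Im s) x0 <= kappa.
  rewrite /logmod /kappa -mulrN ler_pM2l ?invr_gt0// opprB lerB//.
  - rewrite ler_ln ?posrE ?mulr_gt0 ?exprn_gt0//.
    have -> : 64 * X ^+ 4 = (8 * X ^+ 2) * (8 * X ^+ 2) by ring.
    by rewrite ler_pM// ltW.
  - by rewrite ler_ln ?posrE ?hm// u_pos.
have [E [hE1 hE2 hE3]] := log_factor (vortex_family_config q fam) g0 ag bg hA0 hA1 nx0 gen hk.
have zn (z : R[i]) : N z <= R0 -> `|((complex.Re z, complex.Im z) : E2 R)| < n.
  move=> zR; have Rn : R0 < n.
    by rewrite /n -addrA; apply: le_lt_trans (ler_norm R0) _; rewrite ltrDl addr_gt0.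
  rewrite prod_normE/= gt_max; apply/andP; split; apply: le_lt_trans Rn; apply: le_trans zR.
  - exact: Re_le_normc.
  - exact: Im_le_normc.
exists (fun z => E (complex.Re z, complex.Im z)); split.
- by move=> z /zn /ltW /hE1.
- move=> z zR; have [e1 e2] := hE2 _ (zn z zR).
  move: e1 e2; rewrite /= rs; case: (phi q _) => a b /= e1 e2.
  apply/eqP; rewrite eq_complex /=; apply/andP; split; apply/eqP.
  + transitivity (E (complex.Re z, complex.Im z) * a); first by ring.
    rewrite e1 /polyRe; case: z {zR e1 e2} => z1 z2.
    by case: (r) => ? ?; case: (s) => ? ? /=; ring.
  + transitivity (E (complex.Re z, complex.Im z) * b); first by ring.
    rewrite e2 /polyIm; case: z {zR e1 e2} => z1 z2.
    by case: (r) => ? ?; case: (s) => ? ? /=; ring.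
- move=> z z' zR zR'; apply: le_trans (hE3 _ _ (ltW (zn _ zR')) (ltW (zn _ zR))) _.
  rewrite -[leRHS]mulrA ler_wpM2l ?mulr_ge0 ?expR_ge0//=.
  rewrite -!raddfB mulr_natl mulr2n; apply: lerD; [exact: Re_le_normc|exact: Im_le_normc].
Qed.

End Family.

(** * The loop around a double root *)

Lemma continuous_pair (X Y Z : topologicalType) (f : X -> Y) (g : X -> Z) (x : X) :
  {for x, continuous f} -> {for x, continuous g} ->
  {for x, continuous (fun u => (f u, g u))}.
Proof. by move=> cf cg; apply: cvg_pair. Qed.

Section FirstOrder.
Variable R : realType.

Lemma continuous_dist2 (f : E2 R -> R) (y : E2 R) (e : R) :
  {for y, continuous f} -> 0 < e -> exists2 d, 0 < d & forall x : E2 R,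
    `|x.1 - y.1| < d -> `|x.2 - y.2| < d -> `|f x - f y| < e.
Proof.
move=> cf e0; have := @cvgr_dist_lt _ _ _ (nbhs y) _ f (f y) cf _ e0.
move=> /(_ _)/nbhs_ballP [d /= d0 hd]; exists d => // x h1 h2.
by rewrite distrC; apply: hd; split; rewrite /ball/= distrC.
Qed.

Lemma is_derive_section1 (u : E2 R -> R) (x y d : R) :
  is_derive (x, y) (d3 R) u d -> is_derive x 1 (fun t => u (t, y)) d.
Proof.
move=> du; have [h1 h2] := derive_section u y 1 x.
apply: DeriveDef; first by apply/h1; exact: ex_derive.
by rewrite h2; exact: derive_val.
Qed.

Lemma is_derive_section2 (u : E2 R -> R) (x y d : R) :
  is_derive (x, y) (dt R) u d -> is_derive y 1 (fun t => u (x, t)) d.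
Proof.
move=> du; have [h1 h2] := derive_section2 u x 1 y.
apply: DeriveDef; first by apply/h1; exact: ex_derive.
by rewrite h2; exact: derive_val.
Qed.

Lemma MVT_affine (f df : R -> R) (a h k e : R) :
  (forall x, `|x - a| <= `|h| -> is_derive x 1 f (df x)) ->
  (forall x, `|x - a| <= `|h| -> `|df x - k| <= e) ->
  `|f (a + h) - f a - h * k| <= e * `|h|.
Proof.
move=> dff dfb.
have near x : Num.min a (a + h) <= x <= Num.max a (a + h) -> `|x - a| <= `|h|.
  by case: (leP a (a + h)) => ah /andP[h1 h2]; rewrite ler_norml;
    [rewrite ger0_norm; [apply/andP; split|]|rewrite ltr0_norm; [apply/andP; split|]]; lra.
have dg (x : R) : Num.min a (a + h) <= x <= Num.max a (a + h) ->
    is_derive x 1 (fun t => f t - k * t) (df x - k).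
  move=> /near /dff d; apply: is_derive_eq; rewrite /GRing.scale/=; ring.
have bg x : Num.min a (a + h) <= x <= Num.max a (a + h) -> `|df x - k| <= e.
  by move=> /near /dfb.
have := MVT_bound dg bg; rewrite [a + h - a]addrAC subrr add0r.
by congr (`| _ | <= _); ring.
Qed.

(** Continuity of the partial derivatives gives differentiability: the mean value theorem is applied
    along a horizontal and a vertical segment. *)
Lemma first_order (u u1 u2 : E2 R -> R) (y0 : E2 R) (r0 : R) : 0 < r0 ->
  (forall y : E2 R, `|y.1 - y0.1| < r0 -> `|y.2 - y0.2| < r0 ->
     is_derive y (d3 R) u (u1 y) /\ is_derive y (dt R) u (u2 y)) ->
  {for y0, continuous u1} -> {for y0, continuous u2} ->
  forall e, 0 < e -> exists2 d, 0 < d & forall h1 h2, `|h1| < d -> `|h2| < d ->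
    `|u (y0.1 + h1, y0.2 + h2) - u y0 - (h1 * u1 y0 + h2 * u2 y0)|
      <= e * (`|h1| + `|h2|).
Proof.
move=> r00 du c1 c2 e e0.
have [d1 d10 hd1] := continuous_dist2 c1 e0.
have [d2 d20 hd2] := continuous_dist2 c2 e0.
exists (Num.min r0 (Num.min d1 d2)); first by rewrite !lt_min r00 d10.
move=> h1 h2; rewrite !lt_min => /and3P[a1 a2 a3] /and3P[b1 b2 b3].
have Y : y0.2 + h2 - y0.2 = h2 by rewrite addrAC subrr add0r.
have s1 : `|u (y0.1 + h1, y0.2 + h2) - u (y0.1, y0.2 + h2) - h1 * u1 y0| <= e * `|h1|.
  apply: (@MVT_affine (fun t => u (t, y0.2 + h2)) (fun t => u1 (t, y0.2 + h2))) => x hx.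
  - apply: is_derive_section1; have := du (x, y0.2 + h2); rewrite /= Y.
    by move=> /(_ (le_lt_trans hx a1) b1) [].
  - by apply/ltW/hd1; rewrite /= ?Y//; exact: le_lt_trans hx _.
have s2 : `|u (y0.1, y0.2 + h2) - u (y0.1, y0.2) - h2 * u2 y0| <= e * `|h2|.
  apply: (@MVT_affine (fun t => u (y0.1, t)) (fun t => u2 (y0.1, t))) => x hx.
  - apply: is_derive_section2; have := du (y0.1, x); rewrite /= subrr normr0.
    by move=> /(_ r00 (le_lt_trans hx b1)) [].
  - by apply/ltW/hd2; rewrite /= ?subrr ?normr0//; exact: le_lt_trans hx _.
have -> : u y0 = u (y0.1, y0.2) by congr u; case: (y0).
rewrite mulrDr; apply: le_trans (lerD s1 s2); apply: le_trans (ler_normD _ _).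
by rewrite le_eqVlt; apply/orP; left; apply/eqP; congr (`|_|); ring.
Qed.

End FirstOrder.

(** Were the determinant zero, [(- b1, b2)] and [(- a1, a2)] would be coefficients of vanishing
    combinations; all four entries would then be 0, which contradicts independence. *)
Lemma lin_indep_det (R : realType) (a1 a2 b1 b2 : R) :
  lin_indep2 (a2 +i* b2) (a1 +i* b1) -> a1 * b2 - a2 * b1 != 0.
Proof.
move=> indep; apply/eqP => det0.
have comb (k l : R) : k * a2 + l * a1 = 0 -> k * b2 + l * b1 = 0 -> k = 0 /\ l = 0.
  move=> e1 e2; apply: indep; apply/eqP; rewrite eq_complex; apply/andP.
  split; apply/eqP => /=; [rewrite -[RHS]e1|rewrite -[RHS]e2]; ring.
have [b10 b20] : - b1 = 0 /\ b2 = 0.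
  by apply: comb; [rewrite -det0; ring|ring].
have [a10 a20] : - a1 = 0 /\ a2 = 0.
  by apply: comb; [ring|rewrite -[RHS]oppr0 -det0; ring].
have [/eqP] : (1 : R) = 0 /\ (0 : R) = 0.
  by apply: comb; rewrite ?a20 ?b20; ring.
by rewrite oner_eq0.
Qed.

(** Cramer's rule for the right-hand side (cos 2a, sin 2a), written with products of cos a and sin
    a. Since 2a makes one full turn over the interval from 0 to pi, the solution closes up. *)
Lemma circle_preimage (R : realType) (a1 a2 b1 b2 : R) : a1 * b2 - a2 * b1 != 0 ->
  exists (kap : R) (H1 H2 : R -> R), [/\ 0 < kap, continuous H1, continuous H2,
    H1 pi = H1 0 /\ H2 pi = H2 0 &
    forall a, [/\ `|H1 a| <= kap, `|H2 a| <= kap,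
      H1 a * a1 + H2 a * a2 = cos a ^+ 2 - sin a ^+ 2 &
      H1 a * b1 + H2 a * b2 = 2 * (cos a * sin a)]].
Proof.
set det := _ - _ => det0.
pose C2 a := cos a ^+ 2 - sin a ^+ 2 : R; pose S2 a := 2 * (cos a * sin a) : R.
have CS a : C2 a ^+ 2 + S2 a ^+ 2 = 1.
  transitivity ((cos a ^+ 2 + sin a ^+ 2) ^+ 2 : R); first by rewrite /C2 /S2; ring.
  by rewrite cos2Dsin2 expr1n.
have C1 a : `|C2 a| <= 1.
  rewrite -(@ler_pXn2r _ 2) ?nnegrE ?ler01 ?normr_ge0// real_normK ?num_real//.
  by rewrite expr1n -(CS a) lerDl sqr_ge0.
have S1 a : `|S2 a| <= 1.
  rewrite -(@ler_pXn2r _ 2) ?nnegrE ?ler01 ?normr_ge0// real_normK ?num_real//.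
  by rewrite expr1n -(CS a) lerDr sqr_ge0.
pose K := `|a1| + `|a2| + `|b1| + `|b2|.
have lin x y a : `|x| + `|y| <= K -> `|(x * C2 a - y * S2 a) / det| <= K / `|det| + 1.
  move=> xy; rewrite normrM normfV.
  have : `|x * C2 a - y * S2 a| / `|det| <= K / `|det|.
    rewrite ler_pM2r ?invr_gt0 ?normr_gt0//; apply: le_trans xy.
    apply: le_trans (ler_normB _ _) _; rewrite (normrM x) (normrM y).
    by apply: lerD; rewrite ler_piMr.
  by move=> /le_trans; apply; rewrite lerDl.
have cc := @continuous_cos R; have cs := @continuous_sin R.
exists (K / `|det| + 1), (fun a => (b2 * C2 a - a2 * S2 a) / det),
  (fun a => ((- b1) * C2 a - (- a1) * S2 a) / det).
have cC : continuous C2 by move=> a; exact: (cvgB (cvgM (cc a) (cc a)) (cvgM (cs a) (cs a))).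
have kc (k a : R) : {for a, continuous (fun=> k)} by exact: cvg_cst.
have cS : continuous S2 by move=> a; exact: (cvgM (kc 2 a) (cvgM (cc a) (cs a))).
have Cpi : C2 pi = C2 0 by rewrite /C2 cospi sinpi cos0 sin0 sqrrN.
have Spi : S2 pi = S2 0 by rewrite /S2 sinpi sin0 !mulr0.
split.
- by rewrite ltr_wpDl// divr_ge0// !addr_ge0.
- move=> a; exact: (cvgM (cvgB (cvgM (kc b2 a) (cC a)) (cvgM (kc a2 a) (cS a))) (kc _ a)).
- move=> a; exact: (cvgM (cvgB (cvgM (kc _ a) (cC a)) (cvgM (kc _ a) (cS a))) (kc _ a)).
- by rewrite Cpi Spi.
move=> a; split.
- by apply: lin; rewrite /K; have := normr_ge0 a1; have := normr_ge0 b1; lra.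
- by apply: lin; rewrite /K !normrN; have := normr_ge0 a2; have := normr_ge0 b2; lra.
- by rewrite -/(C2 a) /det; field; exact: det0.
- by rewrite -/(S2 a) /det; field; exact: det0.
Qed.

Section Loop.
Variables (R : realType) (T : R) (q : E2 R -> 'rV[R]_4).
Local Notation N := (@Normc.normc R).
Local Notation Om := [set y : E2 R | 0 < y.2 < T].

Hypothesis q_C1 : forall y, Om y -> [/\ {for y, continuous q},
  derivable q y (d3 R) /\ {for y, continuous (fun s => 'D_(d3 R) q s)} &
  derivable q y (dt R) /\ {for y, continuous (fun s => 'D_(dt R) q s)}].

Let ReD (y : E2 R) := q y 0 0 ^+ 2 - q y 0 1 ^+ 2 - 4 * q y 0 2.
Let ImD (y : E2 R) := 2 * (q y 0 0 * q y 0 1) - 4 * q y 0 3.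
Let dRe (v : E2 R) (y : E2 R) := 2 * (q y 0 0 * ('D_v q y) 0 0)
  - 2 * (q y 0 1 * ('D_v q y) 0 1) - 4 * ('D_v q y) 0 2.
Let dIm (v : E2 R) (y : E2 R) := 2 * (q y 0 0 * ('D_v q y) 0 1 + q y 0 1 * ('D_v q y) 0 0)
  - 4 * ('D_v q y) 0 3.

Let ReDE y : complex.Re (discr q y) = ReD y.
Proof.
have E4 : (4 : R[i]) = (4 : R)%:C by rewrite rmorph_nat.
by rewrite /discr /cq1 /cq2 /ReD E4 expr2 /=; ring.
Qed.

Let ImDE y : complex.Im (discr q y) = ImD y.
Proof.
have E4 : (4 : R[i]) = (4 : R)%:C by rewrite rmorph_nat.
by rewrite /discr /cq1 /cq2 /ImD E4 expr2 /=; ring.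
Qed.

Let coord (v y : E2 R) (i : 'I_4) : derivable q y v ->
  is_derive y v (fun s => q s 0 i) (('D_v q y) 0 i).
Proof.
move=> dq; apply: DeriveDef; first exact: (derivable_mxP q y v).1 dq 0 i.
by rewrite (derive_mx dq) mxE.
Qed.

Let dReD (v y : E2 R) : derivable q y v -> is_derive y v ReD (dRe v y).
Proof.
move=> dq; have d0 := coord 0 dq; have d1 := coord 1 dq; have d2 := coord 2 dq.
by rewrite /ReD; apply: is_derive_eq; rewrite /dRe /GRing.scale/=; ring.
Qed.

Let dImD (v y : E2 R) : derivable q y v -> is_derive y v ImD (dIm v y).
Proof.
move=> dq; have d0 := coord 0 dq; have d1 := coord 1 dq; have d3 := coord 3 dq.
by rewrite /ImD; apply: is_derive_eq; rewrite /dIm /GRing.scale/=; ring.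
Qed.

Let entry (f : E2 R -> 'rV[R]_4) (y : E2 R) (i : 'I_4) :
  {for y, continuous f} -> {for y, continuous (fun s => f s 0 i)}.
Proof.
move=> cf; apply: (@continuous_comp _ _ _ f (fun M : 'rV[R]_4 => M 0 i)) => //.
exact: coord_continuous.
Qed.

Let cdRe (v y : E2 R) : {for y, continuous q} ->
  {for y, continuous (fun s => 'D_v q s)} -> {for y, continuous (dRe v)}.
Proof.
move=> cq cd; have e0 := @entry _ _ 0 cq; have e1 := @entry _ _ 1 cq.
have f0 := @entry _ _ 0 cd; have f1 := @entry _ _ 1 cd; have f2 := @entry _ _ 2 cd.
have k2 : {for y, continuous (fun=> 2 : R)} by exact: cvg_cst.
have k4 : {for y, continuous (fun=> 4 : R)} by exact: cvg_cst.
exact: (cvgB (cvgB (cvgM k2 (cvgM e0 f0)) (cvgM k2 (cvgM e1 f1))) (cvgM k4 f2)).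
Qed.

Let cdIm (v y : E2 R) : {for y, continuous q} ->
  {for y, continuous (fun s => 'D_v q s)} -> {for y, continuous (dIm v)}.
Proof.
move=> cq cd; have e0 := @entry _ _ 0 cq; have e1 := @entry _ _ 1 cq.
have f0 := @entry _ _ 0 cd; have f1 := @entry _ _ 1 cd; have f3 := @entry _ _ 3 cd.
have k2 : {for y, continuous (fun=> 2 : R)} by exact: cvg_cst.
have k4 : {for y, continuous (fun=> 4 : R)} by exact: cvg_cst.
exact: (cvgB (cvgM k2 (cvgD (cvgM e0 f1) (cvgM e1 f0))) (cvgM k4 f3)).
Qed.

Definition circ (sg a : R) : R[i] := sg%:C * (cos a +i* sin a).

Lemma normc_circ sg a : 0 < sg -> N (circ sg a) = sg.
Proof.
by move=> sg0; rewrite Normc.normcM normcR gtr0_norm//= cos2Dsin2 sqrtr1 mulr1.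
Qed.

(* [gam] is the image of a small circle around 0 under the inverse of the
   differential of [discr q]. *)
Lemma discr_loop (T0 delta : R) (y0 : E2 R) : T0 < T -> 0 < delta -> 0 < y0.2 < T0 ->
  discr q y0 = 0 ->
  lin_indep2 (derC (dt R) (discr q) y0) (derC (d3 R) (discr q) y0) ->
  exists (sg : R) (gam : R -> E2 R), [/\ 0 < sg,
    continuous gam, gam pi = gam 0 &
    forall a, [/\ `|(gam a).1 - y0.1| < delta, `|(gam a).2 - y0.2| < delta,
       0 < (gam a).2 < T0 & N (discr q (gam a) - circ sg a ^+ 2) <= sg ^+ 2 / 64]].
Proof.
move=> TT de0 /andP[y00 y0T] D0 indep.
have Om0 : Om y0 by rewrite /= y00 (lt_trans y0T).
have [cq0 [dq3 c3] [dqt ct]] := q_C1 Om0.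
have der (v : E2 R) : derivable q y0 v ->
    derC v (discr q) y0 = dRe v y0 +i* dIm v y0.
  move=> dv; rewrite /derC; congr (_ +i* _).
  - rewrite (_ : (fun y => _) = ReD); last by apply/funext => y; exact: ReDE.
    by have := dReD dv => ?; exact: derive_val.
  - rewrite (_ : (fun y => _) = ImD); last by apply/funext => y; exact: ImDE.
    by have := dImD dv => ?; exact: derive_val.
move: indep; rewrite (der _ dq3) (der _ dqt).
set a1 := dRe (d3 R) y0; set a2 := dRe (dt R) y0.
set b1 := dIm (d3 R) y0; set b2 := dIm (dt R) y0 => indep.
have [kap [H1 [H2 [kap0 cH1 cH2 [H1pi H2pi] HH]]]] := circle_preimage (lin_indep_det indep).
(* With both increments bounded by sg^2 kap, this precision leaves a remainder of at most sg^2 / 128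
   in each of the real and imaginary parts of D, together sg^2 / 64. *)
have e0 : 0 < (256 * kap)^-1 by rewrite invr_gt0; exact: mulr_gt0 (ltr0Sn R 255) kap0.
pose r0 := Num.min y0.2 (T - y0.2).
have r00 : 0 < r0 by rewrite lt_min y00 subr_gt0 (lt_trans y0T).
have inOm (y : E2 R) : `|y.2 - y0.2| < r0 -> Om y.
  rewrite lt_min !ltr_norml => /andP[/andP[h1 _] /andP[_ h2]].
  by rewrite /=; apply/andP; split; lra.
have [d1 d10 hd1] := @first_order R ReD (dRe (d3 R)) (dRe (dt R)) y0 r0 r00
  (fun y _ h => conj (dReD (let: And3 _ (conj h _) _ := q_C1 (inOm y h) in h))
     (dReD (let: And3 _ _ (conj h _) := q_C1 (inOm y h) in h)))
  (cdRe cq0 c3) (cdRe cq0 ct) _ e0.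
have [d2 d20 hd2] := @first_order R ImD (dIm (d3 R)) (dIm (dt R)) y0 r0 r00
  (fun y _ h => conj (dImD (let: And3 _ (conj h _) _ := q_C1 (inOm y h) in h))
     (dImD (let: And3 _ _ (conj h _) := q_C1 (inOm y h) in h)))
  (cdIm cq0 c3) (cdIm cq0 ct) _ e0.
pose rho := Num.min (Num.min d1 d2) (Num.min delta (Num.min y0.2 (T0 - y0.2))).
have rho0 : 0 < rho by rewrite !lt_min d10 d20 de0 y00 subr_gt0.
(* The bound by 1 gives sg^2 kap <= sg kap, and the second bound makes this less than [rho], so all
   increments stay in the admissible window. *)
pose sg := Num.min 1 (rho / (2 * kap)).
have sg0 : 0 < sg by rewrite lt_min ltr01 divr_gt0// mulr_gt0.
have sg1 : sg <= 1 by rewrite ge_min lexx.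
have sgr : sg * kap < rho.
  have : sg <= rho / (2 * kap) by rewrite ge_min lexx orbT.
  rewrite ler_pdivlMr ?mulr_gt0// => h.
  by have := mulr_gt0 sg0 kap0; lra.
pose h1 a := sg ^+ 2 * H1 a; pose h2 a := sg ^+ 2 * H2 a.
have sg2 : 0 < sg ^+ 2 by rewrite exprn_gt0.
have h1k a : `|h1 a| <= sg ^+ 2 * kap.
  by have [h _ _ _] := HH a; rewrite normrM gtr0_norm// ler_pM2l.
have h2k a : `|h2 a| <= sg ^+ 2 * kap.
  by have [_ h _ _] := HH a; rewrite normrM gtr0_norm// ler_pM2l.
have sgk : sg ^+ 2 * kap < rho.
  apply: le_lt_trans sgr; rewrite ler_wpM2r ?(ltW kap0)//.
  by rewrite expr2 ler_piMr// ltW.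
have hr1 a : `|h1 a| < rho := le_lt_trans (h1k a) sgk.
have hr2 a : `|h2 a| < rho := le_lt_trans (h2k a) sgk.
have [rd1 rd2 rde ry rT] : [/\ rho <= d1, rho <= d2, rho <= delta, rho <= y0.2 & rho <= T0 - y0.2].
  by split; rewrite /rho !ge_min lexx ?orbT.
exists sg, (fun a => (y0.1 + h1 a, y0.2 + h2 a)); split => //.
- move=> a; have kc (k : R) : {for a, continuous (fun=> k)} by exact: cvg_cst.
  have g1 : {for a, continuous (fun a => y0.1 + h1 a)}.
    exact: (cvgD (kc _) (cvgM (kc _) (cH1 a))).
  have g2 : {for a, continuous (fun a => y0.2 + h2 a)}.
    exact: (cvgD (kc _) (cvgM (kc _) (cH2 a))).
  exact: (@continuous_pair R R R _ _ a g1 g2).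
- by rewrite /h1 /h2 H1pi H2pi.
move=> a; have win : 0 < y0.2 + h2 a < T0.
  have := lt_le_trans (hr2 a) ry; have := lt_le_trans (hr2 a) rT.
  rewrite !ltr_norml => /andP[_ u] /andP[l _].
  by rewrite -ltrBrDl u andbT -ltrBlDl sub0r l.
split => //.
- by rewrite [ltLHS]/= [y0.1 + _]addrC addrK; exact: lt_le_trans rde.
- by rewrite [ltLHS]/= [y0.2 + _]addrC addrK; exact: lt_le_trans rde.
have e1 := hd1 _ _ (lt_le_trans (hr1 a) rd1) (lt_le_trans (hr2 a) rd1).
have e2 := hd2 _ _ (lt_le_trans (hr1 a) rd2) (lt_le_trans (hr2 a) rd2).
have RD0 : ReD y0 = 0 by rewrite -ReDE D0.
have ID0 : ImD y0 = 0 by rewrite -ImDE D0.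
move: e1 e2; rewrite RD0 ID0 !subr0 -/a1 -/a2 -/b1 -/b2 => e1 e2.
have [_ _ l1 l2] := HH a.
have L1 : h1 a * a1 + h2 a * a2 = sg ^+ 2 * (cos a ^+ 2 - sin a ^+ 2).
  by rewrite -l1 /h1 /h2; ring.
have L2 : h1 a * b1 + h2 a * b2 = sg ^+ 2 * (2 * (cos a * sin a)).
  by rewrite -l2 /h1 /h2; ring.
have small : (256 * kap)^-1 * (`|h1 a| + `|h2 a|) <= sg ^+ 2 / 128.
  have -> : sg ^+ 2 / 128 = (256 * kap)^-1 * (sg ^+ 2 * kap + sg ^+ 2 * kap).
    by field; rewrite gt_eqF.
  by rewrite ler_pM2l// lerD.
have Re_sub (z w : R[i]) : complex.Re (z - w) = complex.Re z - complex.Re w := raddfB _ _ _.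
have Im_sub (z w : R[i]) : complex.Im (z - w) = complex.Im z - complex.Im w := raddfB _ _ _.
apply: le_trans (normc_le_abs _) _; rewrite Re_sub Im_sub.
have -> : complex.Re (circ sg a ^+ 2) = sg ^+ 2 * (cos a ^+ 2 - sin a ^+ 2).
  by rewrite /circ expr2 /=; ring.
have -> : complex.Im (circ sg a ^+ 2) = sg ^+ 2 * (2 * (cos a * sin a)).
  by rewrite /circ expr2 /=; ring.
move: e1 e2; rewrite L1 L2 -ReDE -ImDE => /le_trans /(_ small) e1 /le_trans /(_ small) e2.
by have -> : sg ^+ 2 / 64 = sg ^+ 2 / 128 + sg ^+ 2 / 128 by [field]; exact: lerD.
Qed.

End Loop.

(** * Exchange of the zeros *)

Section Monodromy.
Variables (R : realType) (phi : 'rV[R]_4 -> E2 R -> R[i]) (Phi : E4 R -> R[i])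
  (Gam : R -> E2 R) (p : R -> 'rV[R]_4) (sg R0 E0 L B : R)
  (er : R -> R[i] -> R[i]) (E : R -> R[i] -> R).
Local Notation N := (@Normc.normc R).
Local Notation H a z := (at_point Phi z (Gam a)).
Local Notation I a := (0 <= a <= pi).

Hypothesis sg0 : 0 < sg.
Hypothesis p_cont : forall i, continuous (fun a => p a 0 i).
Hypothesis p_loop : p pi = p 0.
Hypothesis p_discr : forall a,
  N (cq1 (p a) ^+ 2 - 4 * cq2 (p a) - circ sg a ^+ 2) <= sg ^+ 2 / 64.
Hypothesis p_R0 : forall a, I a -> N (cq1 (p a)) + 2 * sg <= R0.
Hypothesis HE : forall a z, I a -> H a z = phi (p a) (complex.Re z, complex.Im z) + er a z.
Hypothesis E_bnd : forall a z, I a -> N z <= R0 -> 0 < E a z <= E0.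
Hypothesis E_phi : forall a z, I a -> N z <= R0 ->
  (E a z)%:C * phi (p a) (complex.Re z, complex.Im z) = vpoly (p a) z.
Hypothesis E_lip : forall a z z', I a -> N z <= R0 -> N z' <= R0 ->
  `|E a z - E a z'| <= L * N (z - z').
Hypothesis er_bnd : forall a z, I a -> N (er a z) <= 2 * B.
Hypothesis er_lip : forall a z z', I a -> N (er a z - er a z') <= 4 * B * N (z - z').
Hypothesis B_small : 256 * E0 * B <= sg ^+ 2.
Hypothesis B_small' : 32 * (E0 + L) * B <= sg.
Hypothesis Hcont : forall a z e, I a -> 0 < e -> exists2 d, 0 < d &
  forall a', I a' -> `|a' - a| < d -> N (H a' z - H a z) < e.
Hypothesis zeros_R0 : forall z, H 0 z = 0 -> N z <= R0.

Let I0 : (0 : R) <= 0 <= @pi R. Proof. by rewrite lexx pi_ge0. Qed.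
Let Ipi : (0 : R) <= pi <= @pi R. Proof. by rewrite lexx pi_ge0. Qed.

Section Sheet.
Variable k : R.
Hypothesis k1 : k ^+ 2 = 1.

(** The values 1 and -1 of [k] select the two approximate roots: [c a] is the selected one and
    [c a - s a] the other. *)
Let s a : R[i] := k%:C * circ sg a.
Let c a : R[i] := (- cq1 (p a) + s a) / 2.
Let eta a z : R[i] := (E a z)%:C * H a z - (z - c a) * (z - c a + s a).

Let Nk : N k%:C = 1.
Proof.
rewrite normcR; apply/eqP; rewrite -(@eqrXn2 _ 2) ?normr_ge0 ?ler01//.
by rewrite real_normK ?num_real// k1 expr1n.
Qed.

Let Ns a : N (s a) = sg.
Proof. by rewrite Normc.normcM Nk mul1r normc_circ. Qed.

Let N2 : N 2 = 2.
Proof. by have -> : (2 : R[i]) = (2 : R)%:C by [rewrite rmorph_nat]; rewrite normcR gtr0_norm. Qed.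
Let N4 : N 4 = 4.
Proof. by have -> : (4 : R[i]) = (4 : R)%:C by [rewrite rmorph_nat]; rewrite normcR gtr0_norm. Qed.

Let k1C : k%:C ^+ 2 = 1 :> R[i].
Proof. by rewrite -rmorphXn k1. Qed.

(** Completing the square, p differs from (z - c)(z - c + s) by the constant - (D - circ^2) / 4,
    where D is the discriminant. Hence the perturbation is the rescaled error plus a term that does
    not depend on z and drops out of the Lipschitz estimate. *)
Let etaE a z : I a -> N z <= R0 -> eta a z =
  (E a z)%:C * er a z - (cq1 (p a) ^+ 2 - 4 * cq2 (p a) - circ sg a ^+ 2) / 4.
Proof.
move=> Ia zR; rewrite /eta HE// mulrDr E_phi// /vpoly.
have -> : circ sg a ^+ 2 = s a ^+ 2.
  transitivity (k%:C ^+ 2 * circ sg a ^+ 2); first by rewrite k1C mul1r.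
  by rewrite /s; ring.
by rewrite /c; field.
Qed.

(** The discriminant contributes sg^2 / 256 and the error at most 2 E0 B <= sg^2 / 128; the sum is
    3/256 of sg^2, below the allowed 4/256. *)
Let eta_small a z : I a -> N z <= R0 -> N (eta a z) <= sg ^+ 2 / 64.
Proof.
move=> Ia zR; rewrite etaE//; set d := _ / 4.
have hd : N d <= sg ^+ 2 / 256.
  rewrite /d Normc.normcM Normc.normcV N4 ler_pdivrMr//; apply: le_trans (p_discr a) _.
  by have := sqr_ge0 sg; lra.
apply: le_trans (normcB_le _ _) _; rewrite Normc.normcM normcR.
have /andP[Ep EE] := E_bnd Ia zR; rewrite gtr0_norm//.
have : E a z * N (er a z) <= E0 * (2 * B).
  by apply: ler_pM; rewrite ?normc_ge0 ?(ltW Ep) ?er_bnd.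
by have := B_small; have := sqr_ge0 sg; lra.
Qed.

(** Product rule: E0 times 4 B from the variation of the error, plus L times 2 B from that of E, at
    most 4 (E0 + L) B, which [B_small'] bounds by sg / 8. *)
Let eta_lip a z z' : I a -> N z <= R0 -> N z' <= R0 ->
  N (eta a z - eta a z') <= sg / 8 * N (z - z').
Proof.
move=> Ia zR zR'; rewrite !etaE//.
set d := _ / 4.
have -> : (E a z)%:C * er a z - d - ((E a z')%:C * er a z' - d) =
    (E a z)%:C * (er a z - er a z') + (E a z - E a z')%:C * er a z'.
  by rewrite rmorphB /=; ring.
apply: le_trans (le_normcD _ _) _; rewrite !Normc.normcM !normcR.
have /andP[Ep EE] := E_bnd Ia zR; rewrite gtr0_norm//.
have h1 : E a z * N (er a z - er a z') <= E0 * (4 * B * N (z - z')).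
  by apply: ler_pM; rewrite ?normc_ge0 ?(ltW Ep) ?er_lip.
have h2 : `|E a z - E a z'| * N (er a z') <= L * N (z - z') * (2 * B).
  by apply: ler_pM; rewrite ?normc_ge0 ?er_bnd ?E_lip.
have h3 := ler_wpM2r (normc_ge0 (z - z')) B_small'.
have LB : 0 <= L * N (z - z') * (2 * B).
  by apply: le_trans h2; rewrite mulr_ge0 ?normc_ge0.
by lra.
Qed.

Let c_R0 a : I a -> N (c a) + sg <= R0.
Proof.
move=> Ia; have := p_R0 Ia; rewrite /c Normc.normcM Normc.normcV N2.
have := le_normcD (- cq1 (p a) : Rcomplex R) (s a); rewrite normcN Ns.
by have := normc_ge0 (cq1 (p a)); have := sg0; lra.
Qed.

Let cRe a : complex.Re (c a) = 2^-1 * (- p a 0 0 + k * (sg * cos a)).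
Proof.
have -> : c a = (2^-1 : R)%:C * (- cq1 (p a) + s a).
  by rewrite /c mulrC; congr (_ * _); rewrite fmorphV rmorph_nat.
by rewrite /s /circ /cq1 /=; ring.
Qed.

Let cIm a : complex.Im (c a) = 2^-1 * (- p a 0 1 + k * (sg * sin a)).
Proof.
have -> : c a = (2^-1 : R)%:C * (- cq1 (p a) + s a).
  by rewrite /c mulrC; congr (_ * _); rewrite fmorphV rmorph_nat.
by rewrite /s /circ /cq1 /=; ring.
Qed.

Let cr : continuous (fun a => complex.Re (c a)).
Proof.
rewrite (_ : (fun a => _) = (fun a => 2^-1 * (- p a 0 0 + k * (sg * cos a)))); last first.
  by apply/funext => a; exact: cRe.
move=> a; have kc (h : R) : {for a, continuous (fun=> h)} by exact: cvg_cst.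
have hp : {for a, continuous (fun a => p a 0 0)} by exact: p_cont.
have ht : {for a, continuous (fun a : R => cos a)} by exact: continuous_cos.
exact: (cvgM (kc _) (cvgD (cvgN hp) (cvgM (kc _) (cvgM (kc _) ht)))).
Qed.

Let ci : continuous (fun a => complex.Im (c a)).
Proof.
rewrite (_ : (fun a => _) = (fun a => 2^-1 * (- p a 0 1 + k * (sg * sin a)))); last first.
  by apply/funext => a; exact: cIm.
move=> a; have kc (h : R) : {for a, continuous (fun=> h)} by exact: cvg_cst.
have hp : {for a, continuous (fun a => p a 0 1)} by exact: p_cont.
have ht : {for a, continuous (fun a : R => sin a)} by exact: continuous_sin.
exact: (cvgM (kc _) (cvgD (cvgN hp) (cvgM (kc _) (cvgM (kc _) ht)))).
Qed.

Lemma sheet_zero : exists z, H 0 z = 0.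
Proof.
by have [z [_ Hz]] := disc_zero sg0 Ns c_R0 E_bnd eta_small eta_lip I0; exists z.
Qed.

Lemma sheet_prod z : H 0 z = 0 -> N (z - c 0) * N (z - c 0 + s 0) <= sg ^+ 2 / 64.
Proof.
move=> Hz; have := eta_small I0 (zeros_R0 Hz).
by rewrite /eta Hz mulr0 sub0r normcN Normc.normcM.
Qed.

Lemma sheet_lift z1 : H 0 z1 = 0 -> N (z1 - c 0) <= sg / 8 ->
  exists zeta, [/\ zero_lift Phi 0 pi Gam z1 zeta,
    (forall zeta', zero_lift Phi 0 pi Gam z1 zeta' ->
       forall a, I a -> zeta' a = zeta a) & zeta pi <> zeta 0].
Proof.
move=> Hz near1.
have [zeta [lz conf]] := lift_exists (pi_ge0 R) sg0 cr ci Ns c_R0 E_bnd eta_small eta_lip Hcont near1 Hz.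
exists zeta; split => //.
- move=> zeta' lz' a Ia.
  exact: (lift_unique (pi_ge0 R) sg0 cr ci Ns c_R0 E_bnd eta_small eta_lip near1 lz lz' Ia).
move=> same; have n0 := conf 0 I0; have npi := conf pi Ipi.
(* Over the loop [circ] changes sign while q returns to its value, so the centre moves by exactly
   sg. A zero staying within sg / 8 of the centre cannot come back to where it started. *)
have cc : c 0 - c pi = (k * sg)%:C.
  have s_pi : s pi = - s 0.
    by rewrite /s /circ cospi sinpi cos0 sin0 -mulrN -mulrN; congr (_ * (_ * _));
      apply/eqP; rewrite eq_complex /= oppr0 !eqxx.
  have s_0 : s 0 = (k * sg)%:C.
    rewrite /s /circ cos0 sin0 rmorphM; congr (_ * _).
    exact: mulr1.
  by rewrite /c s_pi p_loop -s_0; field.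
have : N (c 0 - c pi) = sg by rewrite cc rmorphM Normc.normcM Nk mul1r normcR gtr0_norm.
have -> : c 0 - c pi = (zeta pi - c pi) - (zeta 0 - c 0) by rewrite same; ring.
have := normcB_le (zeta pi - c pi) (zeta 0 - c 0); have := sg0; lra.
Qed.

End Sheet.

(** By [sheet_prod] the distances of a zero to the two approximate roots have product at most (sg /
    8)^2, so one of them is at most sg / 8 and the corresponding sheet provides the lift. *)
Lemma monodromy : (exists z, H 0 z = 0) /\
  forall z1, H 0 z1 = 0 -> exists zeta, [/\ zero_lift Phi 0 pi Gam z1 zeta,
    (forall zeta', zero_lift Phi 0 pi Gam z1 zeta' ->
       forall a, I a -> zeta' a = zeta a) & zeta pi <> zeta 0].
Proof.
split; first exact: (@sheet_zero 1 (expr1n _ _)).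
move=> z1 Hz; have zR := zeros_R0 Hz.
pose cp := (- cq1 (p 0) + (1 : R)%:C * circ sg 0) / 2.
pose cm := (- cq1 (p 0) + (-1 : R)%:C * circ sg 0) / 2.
have prod : N (z1 - cp) * N (z1 - cm) <= (sg / 8) * (sg / 8).
  have -> : z1 - cm = z1 - cp + (1 : R)%:C * circ sg 0.
    by rewrite /cp /cm rmorphN rmorph1; field.
  have h : N (z1 - cp) * N (z1 - cp + (1 : R)%:C * circ sg 0) <= sg ^+ 2 / 64.
    exact: (@sheet_prod 1 (expr1n _ _) z1 Hz).
  by apply: le_trans h _; lra.
have [np|fp] := leP (N (z1 - cp)) (sg / 8).
  exact: (@sheet_lift 1 (expr1n _ _)).
apply: (@sheet_lift (-1)) => //; first by rewrite sqrrN expr1n.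
rewrite leNgt; apply/negP => fm; move: prod; apply/negP; rewrite -ltNge.
by apply: ltr_pM => //; rewrite divr_ge0// ltW.
Qed.

End Monodromy.

(** * Choice of the constants and of epsilon *)

Section Reconnection.
Variables (R : realType) (phi : 'rV[R]_4 -> E2 R -> R[i])
  (calA : 'rV[R]_4 -> 'I_2 -> E2 R -> R) (T T0 eps1 C : R)
  (q : E2 R -> 'rV[R]_4) (Phi : R -> E4 R -> R[i]).
Local Notation N := (@Normc.normc R).
Local Notation Om := [set y : E2 R | 0 < y.2 < T].
Local Notation err eps := (Phi_error phi q Phi eps).

Hypothesis fam : vortex_family phi calA.
Hypothesis T0T : T0 < T.
Hypothesis eps1_gt0 : 0 < eps1.
Hypothesis q_C1 : forall y, Om y -> [/\ {for y, continuous q},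
  derivable q y (d3 R) /\ {for y, continuous (fun s => 'D_(d3 R) q s)} &
  derivable q y (dt R) /\ {for y, continuous (fun s => 'D_(dt R) q s)}].
Hypothesis Phi_cont : forall eps, 0 < eps < eps1 -> forall p, slab (T0 / eps) p ->
  {for p, continuous (fun s => complex.Re (Phi eps s))} /\
  {for p, continuous (fun s => complex.Im (Phi eps s))}.
Hypothesis Phi_err : forall eps, 0 < eps < eps1 ->
  (LinfW (T0 / eps) 2 (err eps) <= (C * eps ^+ 2)%:E)%E.

Let pull_cont eps (f : E2 R * 'rV[R]_4 -> R) (p : E4 R) : 0 < eps < eps1 ->
  slab (T0 / eps) p -> continuous f ->
  {for p, continuous (fun s : E4 R => f (s.1.1, q (eps * s.1.2, eps * s.2)))}.
Proof.
move=> /andP[e0 _] /andP[p0 pT] cf.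
have c11 : {for p, continuous (fun s : E4 R => s.1.1)}.
  by apply: (@continuous_comp _ _ _ fst fst); exact: cvg_fst.
have c12 : {for p, continuous (fun s : E4 R => s.1.2)}.
  by apply: (@continuous_comp _ _ _ fst snd); [exact: cvg_fst|exact: cvg_snd].
have c2 : {for p, continuous (fun s : E4 R => s.2)} by exact: cvg_snd.
have k : {for p, continuous (fun _ : E4 R => eps)} by exact: cvg_cst.
have m12 : {for p, continuous (fun s : E4 R => eps * s.1.2)} by exact: (cvgM k c12).
have m2 : {for p, continuous (fun s : E4 R => eps * s.2)} by exact: (cvgM k c2).
apply: (@continuous_comp _ _ _ (fun s : E4 R => (s.1.1, q (eps * s.1.2, eps * s.2))) f);
  last exact: cf.
apply: continuous_pair => //.
apply: (@continuous_comp _ _ _ (fun s : E4 R => (eps * s.1.2, eps * s.2)) q).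
  exact: continuous_pair.
have [] // := @q_C1 (eps * p.1.2, eps * p.2) _.
rewrite /= mulr_gt0//=; apply: lt_trans T0T.
by move: pT; rewrite ltr_pdivlMr// mulrC.
Qed.

(** [|C| + 1] instead of [C] provides the strict margin needed by [LinfW_bounds]. The factors 2 and
    4 arise from bounding the modulus by |Re| + |Im|, once for the value and, for differences, once
    more for the displacement. *)
Lemma Phi_error_bounds eps : 0 < eps < eps1 -> forall c t z, 0 < t < T0 / eps ->
  N (err eps (complex.Re z, complex.Im z, c, t)) <= 2 * ((`|C| + 1) * eps ^+ 2) /\
  forall z', N (err eps (complex.Re z, complex.Im z, c, t)
      - err eps (complex.Re z', complex.Im z', c, t))
    <= 4 * ((`|C| + 1) * eps ^+ 2) * N (z - z').
Proof.
move=> he c t z ht; set B := _ * eps ^+ 2.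
have [_ [sR sI _]] := fam.
have cr p : slab (T0 / eps) p -> {for p, continuous (fun s => complex.Re (err eps s))}.
  move=> hp; have [h _] := Phi_cont he hp; have h' := pull_cont he hp (sR 0%N).1.
  rewrite (_ : (fun s => _) = (fun s => complex.Re (Phi eps s)
      - complex.Re (phi (q (eps * s.1.2, eps * s.2)) s.1.1))); first exact: (cvgB h h').
  by apply/funext => s; rewrite /Phi_error /pull; exact: raddfB.
have ci p : slab (T0 / eps) p -> {for p, continuous (fun s => complex.Im (err eps s))}.
  move=> hp; have [_ h] := Phi_cont he hp; have h' := pull_cont he hp (sI 0%N).1.
  rewrite (_ : (fun s => _) = (fun s => complex.Im (Phi eps s)
      - complex.Im (phi (q (eps * s.1.2, eps * s.2)) s.1.1))); first exact: (cvgB h h').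
  by apply/funext => s; rewrite /Phi_error /pull; exact: raddfB.
have /andP[e0 _] := he.
have BB : C * eps ^+ 2 < B.
  rewrite /B ltr_pM2r ?exprn_gt0//; have := ler_norm C; lra.
have bnd := LinfW_bounds cr ci (Phi_err he) BB ht.
have [b1 b2 _ _] := bnd (complex.Re z) (complex.Im z) c; split.
  by apply: le_trans (normc_le_abs _) _; lra.
move=> z'; have [_ _ b3 b4] := bnd (complex.Re z') (complex.Im z') c.
have {}b3 := b3 (complex.Re z) (complex.Im z).
have {}b4 := b4 (complex.Re z) (complex.Im z).
set u := err eps _ in b3 b4 *; set v := err eps _ in b3 b4 *.
have Re_sub (x y : R[i]) : complex.Re (x - y) = complex.Re x - complex.Re y := raddfB _ _ _.
have Im_sub (x y : R[i]) : complex.Im (x - y) = complex.Im x - complex.Im y := raddfB _ _ _.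
have B0 : 0 <= B by rewrite mulr_ge0 ?sqr_ge0// addr_ge0.
apply: le_trans (normc_le_abs _) _; rewrite Re_sub Im_sub.
have := Re_le_normc (z - z'); have := Im_le_normc (z - z'); rewrite Re_sub Im_sub => h1 h2.
have := ler_wpM2l B0 (lerD h2 h1); lra.
Qed.

Let absurd_bound (m B : R) : m <= 4 * B -> B <= m / 5 -> 0 < m -> False.
Proof. lra. Qed.

(** The rescaled loop is closed already in the plane of representatives, without using a translation
    by the period. So [l] is arbitrary and chosen last, and one statement serves the line and the
    circle. *)
Lemma reconnection (x3 t : R) : 0 < t < T0 -> discr q (x3, t) = 0 ->
  lin_indep2 (derC (dt R) (discr q) (x3, t)) (derC (d3 R) (discr q) (x3, t)) ->
  forall delta : R, 0 < delta ->
  exists eps0 : R, 0 < eps0 <= eps1 /\ forall eps : R, 0 < eps < eps0 -> forall l : R,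
    reconnects l (Phi eps) (window l (T0 / eps) delta eps x3 t).
Proof.
move=> ht D0 indep delta delta0.
have [sg [gam [sg0 cgam gam_loop hgam]]] :=
  @discr_loop R T q q_C1 T0 delta (x3, t) T0T delta0 ht D0 indep.
pose p (a : R) := q (gam a).
have inOm a : Om (gam a).
  by have [_ _ /andP[g0 gT] _] := hgam a; rewrite /= g0 (lt_trans gT).
have cp : continuous p.
  move=> a; apply: (@continuous_comp _ _ _ gam q); first exact: cgam.
  by have [] := q_C1 (inOm a).
have cpi i : continuous (fun a => p a 0 i).
  move=> a; apply: (@continuous_comp _ _ _ p (fun M : 'rV[R]_4 => M 0 i)); first exact: cp.
  exact: coord_continuous.
have cI : compact `[0 : R, pi]%classic by exact: segment_compact.
have [Q0 [Q00 hQ0]] := compact_bound cI (cpi 0).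
have [Q1 [Q10 hQ1]] := compact_bound cI (cpi 1).
have [r [s [rs _]]] := vpoly_roots (p 0).
have [g [g0 ag bg]] := family_factor fam rs.
have [S [m [m0 far]]] := far_field (vortex_family_config (p 0) fam) g0 ag bg.
(* Beyond this radius the maximum norm, which is at least half the modulus, exceeds [S], so
   [far_field] applies; [Q0 + Q1] bounds |q_1| along the loop and [2 * sg] leaves room for the discs
   around the approximate roots. *)
pose R0 := 2 * `|S| + (Q0 + Q1) + 2 * sg.
have cK : compact (p @` `[0, pi]).
  by apply: continuous_compact => //; exact: continuous_subspaceT.
have [E0 [L [E00 L0 hE]]] := uniform_gauge fam R0 cK.
(* The first two entries are the smallness conditions of [monodromy]. The last two give (2 B)^2 <= 4
   B < m, so the error cannot cancel phi in the far field. *)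
pose b0 := Num.min (sg ^+ 2 / (256 * E0)) (Num.min (sg / (32 * (E0 + L))) (Num.min 1 (m / 5))).
have EL : 0 < 32 * (E0 + L) by rewrite mulr_gt0// ltr_wpDr.
have E256 : 0 < 256 * E0 by exact: mulr_gt0 (ltr0Sn R 255) E00.
have b00 : 0 < b0.
  by rewrite !lt_min ltr01 ![0 < _ / _]divr_gt0// exprn_gt0.
pose C1 := `|C| + 1.
have C10 : 0 < C1 by rewrite ltr_wpDl.
(* For eps < 1 the quantity B = C1 eps^2 is at most C1 eps, which the last entry keeps below
   [b0]. *)
exists (Num.min eps1 (Num.min 1 (b0 / C1))); split.
  by rewrite ge_min lexx andbT !lt_min eps1_gt0 ltr01 divr_gt0.
move=> eps /andP[e0]; rewrite !lt_min => /and3P[e1 e2 e3] l.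
have he : 0 < eps < eps1 by rewrite e0.
pose B := C1 * eps ^+ 2.
have Bb : B < b0.
  apply: le_lt_trans (_ : C1 * eps < _); last by move: e3; rewrite ltr_pdivlMr// mulrC.
  by rewrite /B ler_pM2l// expr2 ler_piMl // ltW.
have [B1 B2 B3 B4] : [/\ B <= sg ^+ 2 / (256 * E0), B <= sg / (32 * (E0 + L)), B <= 1 & B <= m / 5].
  by split; apply: le_trans (ltW Bb) _; rewrite /b0 !ge_min lexx ?orbT.
have B0 : 0 <= B by rewrite mulr_ge0 ?sqr_ge0// ltW.
pose Gam a : E2 R := ((gam a).1 / eps, (gam a).2 / eps).
have GamT a : 0 < (Gam a).2 < T0 / eps.
  by have [_ _ /andP[h1 h2] _] := hgam a; rewrite /= divr_gt0//= ltr_pM2r ?invr_gt0.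
pose er a z := err eps (complex.Re z, complex.Im z, (Gam a).1, (Gam a).2).
have PhiE a z : at_point (Phi eps) z (Gam a) = phi (p a) (complex.Re z, complex.Im z) + er a z.
  rewrite /er /Phi_error /at_point /pull /= ![eps * (_ / eps)]mulrC !divfK ?gt_eqF//.
  by rewrite /p -surjective_pairing addrC subrK.
have er_bnd a z : N (er a z) <= 2 * B.
  by have [] := Phi_error_bounds he (Gam a).1 z (GamT a).
have er_lip a z z' : N (er a z - er a z') <= 4 * B * N (z - z').
  by have [_ h] := Phi_error_bounds he (Gam a).1 z (GamT a); exact: h.
have cGam1 : continuous (fun a => (Gam a).1).
  move=> a; have k : {for a, continuous (fun=> eps^-1 : R)} by exact: cvg_cst.
  have h : {for a, continuous (fun a => (gam a).1)}.
    by apply: (@continuous_comp _ _ _ gam fst); [exact: cgam|exact: cvg_fst].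
  exact: (cvgM h k).
have cGam2 : continuous (fun a => (Gam a).2).
  move=> a; have k : {for a, continuous (fun=> eps^-1 : R)} by exact: cvg_cst.
  have h : {for a, continuous (fun a => (gam a).2)}.
    by apply: (@continuous_comp _ _ _ gam snd); [exact: cgam|exact: cvg_snd].
  exact: (cvgM h k).
have Hcont a z e : 0 <= a <= pi -> 0 < e -> exists2 d, 0 < d &
    forall a', 0 <= a' <= pi -> `|a' - a| < d ->
      N (at_point (Phi eps) z (Gam a') - at_point (Phi eps) z (Gam a)) < e.
  move=> _ e_gt0.
  pose pt a : E4 R := (complex.Re z, complex.Im z, (Gam a).1, (Gam a).2).
  have cpt : {for a, continuous pt}.
    have k : {for a, continuous (fun=> (complex.Re z, complex.Im z) : E2 R)} by exact: cvg_cst.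
    exact: (continuous_pair (continuous_pair k (cGam1 a)) (cGam2 a)).
  have [cr ci] := Phi_cont he (GamT a : slab (T0 / eps) (pt a)).
  have cr' : {for a, continuous (fun a => complex.Re (Phi eps (pt a)))}.
    exact: (@continuous_comp _ _ _ pt (fun s => complex.Re (Phi eps s))).
  have ci' : {for a, continuous (fun a => complex.Im (Phi eps (pt a)))}.
    exact: (@continuous_comp _ _ _ pt (fun s => complex.Im (Phi eps s))).
  have e20 : 0 < e / 2 by rewrite divr_gt0.
  have [d1 d10 h1] := continuous_dist cr' e20.
  have [d2 d20 h2] := continuous_dist ci' e20.
  exists (Num.min d1 d2); first by rewrite lt_min d10.
  move=> a' _; rewrite lt_min => /andP[l1 l2].
  apply: le_lt_trans (normc_le_abs _) _.
  have := h1 a' l1; have := h2 a' l2; rewrite -!raddfB /at_point -/(pt a) -/(pt a').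
  by move=> /= k1 k2; rewrite [e]splitr; exact: ltrD.
have sup_le (z : R[i]) : `|S| <= N z / 2 -> S <= `|((complex.Re z, complex.Im z) : E2 R)|.
  move=> h; apply: le_trans (ler_norm _) (le_trans h _); rewrite ler_pdivrMr//.
  apply: le_trans (normc_le_abs _) _; rewrite prod_normE/= mulr_natr mulr2n.
  by apply: lerD; rewrite le_max lexx ?orbT.
(* Distant zeros have to be excluded only at the base point of the loop: the definition of
   reconnection quantifies over the zeros there, and their lifts are confined by the discs. *)
have zeros_R0 z : at_point (Phi eps) z (Gam 0) = 0 -> N z <= R0.
  move=> z0; rewrite leNgt; apply/negP => zR.
  have big : `|S| <= N z / 2.
    rewrite ler_pdivlMr// mulrC; apply: le_trans (ltW zR); rewrite /R0 -addrA lerDl.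
    by rewrite !addr_ge0// mulr_ge0// ltW.
  have := far _ (sup_le z big).
  have phiE : phi (p 0) (complex.Re z, complex.Im z) = - er 0 z.
    by apply/eqP; rewrite -addr_eq0 -PhiE z0.
  rewrite /usq -normc_sqr phiE normcN => mle.
  have : N (er 0 z) ^+ 2 <= (2 * B) ^+ 2.
    by rewrite ler_pXn2r ?nnegrE ?normc_ge0// mulr_ge0.
  have : (2 * B) ^+ 2 <= 4 * B by rewrite exprMn -natrX ler_pM2l// expr2 ler_piMl.
  by move=> h1 h2; exact: (absurd_bound (le_trans mle (le_trans h2 h1)) B4 m0).
have gaugeE a : exists E : R[i] -> R, 0 <= a <= pi ->
    [/\ forall z, N z <= R0 -> 0 < E z <= E0,
        forall z, N z <= R0 -> (E z)%:C * phi (p a) (complex.Re z, complex.Im z) = vpoly (p a) z &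
        forall z z', N z <= R0 -> N z' <= R0 -> `|E z - E z'| <= L * N (z - z')].
  have [Ia|] := boolP (0 <= a <= pi); last by exists (fun=> 0).
  have [|E hEa] := hE (p a); first by exists a => //=; rewrite in_itv.
  by exists E.
have [E hEE] := choice gaugeE.
have pR0 a : 0 <= a <= pi -> N (cq1 (p a)) + 2 * sg <= R0.
  move=> Ia; have Ia' : `[0, pi]%classic a by rewrite /= in_itv.
  rewrite /R0 lerD2r; apply: le_trans (normc_le_abs _) _.
  by apply: ler_wpDl; [rewrite mulr_ge0|apply: lerD; [exact: hQ0|exact: hQ1]].
have [ex lifts] := @monodromy R phi (Phi eps) Gam p sg R0 E0 L B er E sg0 cpi
  (congr1 q gam_loop) (fun a => let: And4 _ _ _ h := hgam a in h) pR0
  (fun a z _ => PhiE a z) (fun a z Ia => let: And3 h _ _ := hEE a Ia in h z)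
  (fun a z Ia => let: And3 _ h _ := hEE a Ia in h z)
  (fun a z z' Ia => let: And3 _ _ h := hEE a Ia in h z z')
  (fun a z _ => er_bnd a z) (fun a z z' _ => er_lip a z z')
  ltac:(by move: B1; rewrite ler_pdivlMr// mulrC)
  ltac:(by move: B2; rewrite ler_pdivlMr// mulrC) Hcont zeros_R0.
exists 0, pi, Gam; split => //.
- exact: pi_gt0.
- split; last first.
    by rewrite /Gam gam_loop; split => //; exists 0; rewrite mul0r addr0.
  move=> a _ rr rr0.
  have [d1 d10 h1] := continuous_dist (cGam1 a) rr0.
  have [d2 d20 h2] := continuous_dist (cGam2 a) rr0.
  exists (Num.min d1 d2); first by rewrite lt_min d10.
  move=> a' _; rewrite lt_min => /andP[l1 l2]; split; last exact: h2.
  by exists 0; rewrite mul0r subr0; exact: h1.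
- move=> a _; have [h1 h2 _ _] := hgam a; split; first exact: GamT.
  + by exists 0; rewrite mul0r subr0 /= -mulrBl normrM (gtr0_norm (x := eps^-1)) ?invr_gt0// ltr_pM2r ?invr_gt0.
  + by rewrite /= -mulrBl normrM (gtr0_norm (x := eps^-1)) ?invr_gt0// ltr_pM2r ?invr_gt0.
Qed.

End Reconnection.

Theorem theorem3 (R : realType) (k0 k1 : R)
    (phi : 'rV[R]_4 -> E2 R -> R[i]) (calA : 'rV[R]_4 -> 'I_2 -> E2 R -> R)
    (chi : 'I_4 -> 'rV[R]_4 -> E2 R -> R) :
  0 <= k0 <= 1 -> 0 <= k1 <= 1 -> (k0 = 0 -> 0 < k1) ->
  vortex_family phi calA -> gauge_fixing phi chi ->
  (forall (T T0 eps1 C : R) (q : E2 R -> 'rV[R]_4)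
      (Phi : R -> E4 R -> R[i]) (A : R -> 'I_4 -> E4 R -> R),
    0 < T0 < T -> 0 < eps1 ->
    wave_map_solution phi calA chi k0 k1 0 T q ->
    cont_in_H 0 17 T (fun y => 'D_(d3 R) q y) ->
    cont_in_H 0 17 T (fun y => k0 *: 'D_(dt R) q y) ->
    finite_H_norm 0 17 T k0 q ->
    associated_line phi calA k0 k1 T0 eps1 C q Phi A ->
    forall x3 t : R, 0 < t < T0 ->
    discr q (x3, t) = 0 ->
    lin_indep2 (derC (dt R) (discr q) (x3, t)) (derC (d3 R) (discr q) (x3, t)) ->
    forall delta : R, 0 < delta ->
    exists eps0 : R, 0 < eps0 <= eps1 /\ forall eps : R, 0 < eps < eps0 ->
      reconnects 0 (Phi eps) (window 0 (T0 / eps) delta eps x3 t))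
  /\
  (forall (iota l T T0 eps1 C : R) (q : E2 R -> 'rV[R]_4)
      (Phi : R -> E4 R -> R[i]) (A : R -> 'I_4 -> E4 R -> R),
    0 < l -> 0 < T0 < T -> 0 < eps1 ->
    (forall y t, q (y + l, t) = q (y, t)) ->
    wave_map_solution phi calA chi k0 k1 iota T q ->
    finite_H_norm l 17 T k0 q ->
    associated_circle phi calA k0 k1 T0 eps1 C q Phi A l iota ->
    forall x3 t : R, 0 < t < T0 ->
    discr q (x3, t) = 0 ->
    lin_indep2 (derC (dt R) (discr q) (x3, t)) (derC (d3 R) (discr q) (x3, t)) ->
    forall delta : R, 0 < delta ->
    exists eps0 : R, 0 < eps0 <= eps1 /\ forall eps : R, 0 < eps < eps0 ->
      reconnects (l / eps) (Phi eps) (window (l / eps) (T0 / eps) delta eps x3 t)).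
Proof.
move=> /andP[k0_ge0 _] _ _ fam _.
have C1 iota T q : wave_map_solution phi calA chi k0 k1 iota T q ->
    forall y, [set y | 0 < y.2 < T] y -> [/\ {for y, continuous q},
      derivable q y (d3 R) /\ {for y, continuous (fun s => 'D_(d3 R) q s)} &
      derivable q y (dt R) /\ {for y, continuous (fun s => 'D_(dt R) q s)}].
  by move=> [_ reg _] y hy; have [c dq3 dqt _ _] := reg y hy; exact: And3 c dq3 dqt.
split.
- move=> T T0 eps1 C q Phi A /andP[T00 T0T] eps10 wm _ _ _ sol x3 t ht D0 indep delta de0.
  have cont eps : 0 < eps < eps1 -> forall p, slab (T0 / eps) p ->
      {for p, continuous (fun s => complex.Re (Phi eps s))} /\
      {for p, continuous (fun s => complex.Im (Phi eps s))}.
    by move=> he; have [[h _ _ _] _ _ _] := sol eps he; exact: h.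
  have err eps : 0 < eps < eps1 ->
      (LinfW (T0 / eps) 2 (Phi_error phi q Phi eps) <= (C * eps ^+ 2)%:E)%E.
    move=> he; have [_ h _ _] := sol eps he; apply: le_trans h.
    have tau0 : 0 < T0 / eps by rewrite divr_gt0//; case/andP: he.
    rewrite leeDl//; apply: mule_ge0; first by rewrite lee_fin.
    exact: (@LinfW_dt_ge0 R (T0 / eps) _ 1 tau0).
  have [eps0 [h0 h]] := reconnection fam T0T eps10 (C1 _ _ _ wm) cont err ht D0 indep de0.
  by exists eps0; split => // eps he; exact: h.
- move=> iota l T T0 eps1 C q Phi A l0 /andP[T00 T0T] eps10 _ wm _ sol x3 t ht D0 indep delta de0.
  have cont eps : 0 < eps < eps1 -> forall p, slab (T0 / eps) p ->
      {for p, continuous (fun s => complex.Re (Phi eps s))} /\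
      {for p, continuous (fun s => complex.Im (Phi eps s))}.
    by move=> he; have [[h _ _ _] _ _ _] := sol eps he; exact: h.
  have err eps : 0 < eps < eps1 ->
      (LinfW (T0 / eps) 2 (Phi_error phi q Phi eps) <= (C * eps ^+ 2)%:E)%E.
    by move=> he; have [_ h _ _] := sol eps he.
  have [eps0 [h0 h]] := reconnection fam T0T eps10 (C1 _ _ _ wm) cont err ht D0 indep de0.
  by exists eps0; split => // eps he; exact: h.
Qed.
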